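(* Let $\beta=(\beta_n)_{n\ge0}$ be a sequence of positive numbers with $\liminf_{n\to\infty}\beta_n^{1/n}\ge1$. Then all composition operators on $H^2(\beta)$ are bounded (that is, $C_\varphi$ is bounded on $H^2(\beta)$ for every symbol $\varphi$) if and only if $\beta$ is essentially decreasing and slowly oscillating.
   Context: $\mathbb{D}$ is the open unit disk of $\mathbb{C}$. For a sequence $\beta=(\beta_n)_{n\ge0}$ of positive numbers with $\liminf_{n\to\infty}\beta_n^{1/n}\ge1$, $H^2(\beta)$ is the Hilbert space of analytic functions $f(z)=\sum_{n\ge0}a_nz^n$ on $\mathbb{D}$ such that $\|f\|^2=\sum_{n\ge0}|a_n|^2\beta_n<\infty$. A symbol is a non-constant analytic map $\varphi:\mathbb{D}\to\mathbb{D}$, and $C_\varphi(f)=f\circ\varphi$; it is bounded on $H^2(\beta)$ if it maps $H^2(\beta)$ boundedly into itself. The sequence $\beta$ is essentially decreasing if for some constant $C\ge1$ one has $\beta_m\le C\beta_n$ for all $m\ge n\ge0$. It is slowly oscillating if there are constants $0<c<1<C$ such that $c\le\beta_m/\beta_n\le C$ whenever $n/2\le m\le2n$. *)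

(* Defs.v *)
From Stdlib Require Import Reals.
From Coquelicot Require Import Coquelicot.

Open Scope R_scope.

Definition in_disk (z : C) : Prop := Cmod z < 1.

(* Functions on the disk are represented by total functions C -> C; their
   values outside the disk are never constrained. *)

Definition analytic_at (f : C -> C) (z0 : C) : Prop :=
  exists a : nat -> C,
    locally (T := C_UniformSpace) z0 (fun z : C =>
      is_pseries (K := C_AbsRing) (V := C_NormedModule) a (z - z0)%C (f z)).

Definition symbol (phi : C -> C) : Prop :=
  (forall z : C, in_disk z -> in_disk (phi z)) /\
  (forall z : C, in_disk z -> analytic_at phi z) /\
  (exists z w : C, in_disk z /\ in_disk w /\ phi z <> phi w).

Definition has_expansion (f : C -> C) (a : nat -> C) : Prop :=
  forall z : C, in_disk z ->
    is_pseries (K := C_AbsRing) (V := C_NormedModule) a z (f z).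

(* The index n = 0, where / INR n is a junk value, does not affect the liminf. *)
Definition admissible_weight (beta : nat -> R) : Prop :=
  (forall n : nat, 0 < beta n) /\
  Rbar_le (Finite 1) (LimInf_seq (fun n : nat => Rpower (beta n) (/ INR n))).

(* The expansion a is unique, so N is determined by f. *)
Definition is_H2_norm (beta : nat -> R) (f : C -> C) (N : R) : Prop :=
  0 <= N /\
  exists a : nat -> C,
    has_expansion f a /\
    is_series (fun n : nat => Cmod (a n) ^ 2 * beta n) (N ^ 2).

Definition in_H2 (beta : nat -> R) (f : C -> C) : Prop :=
  exists a : nat -> C,
    has_expansion f a /\
    ex_series (fun n : nat => Cmod (a n) ^ 2 * beta n).

Definition compose (phi f : C -> C) : C -> C := fun z => f (phi z).

Definition composition_bounded (beta : nat -> R) (phi : C -> C) : Prop :=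
  (forall f : C -> C, in_H2 beta f -> in_H2 beta (compose phi f)) /\
  exists M : R, forall (f : C -> C) (N N' : R),
    is_H2_norm beta f N -> is_H2_norm beta (compose phi f) N' -> N' <= M * N.

Definition essentially_decreasing (beta : nat -> R) : Prop :=
  exists K : R, 1 <= K /\
    forall m n : nat, (n <= m)%nat -> beta m <= K * beta n.

Definition slowly_oscillating (beta : nat -> R) : Prop :=
  exists c K : R, 0 < c /\ c < 1 /\ 1 < K /\
    forall m n : nat, INR n / 2 <= INR m <= 2 * INR n ->
      c <= beta m / beta n <= K.

(* Main.v *)
(** Sufficiency.  The harmonic extension of [|f|^2] from the unit circle dominates [|f|^2] in
    the disk; composing it with [phi] and averaging over circles bounds [C_phi] for [beta = 1].
    As [[z^m] phi^n] is exponentially small once [n >= q m], the partial sums up to [l] of the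
    squared coefficients of [f o phi] are controlled by those of [f] up to [q l].  Abel summation
    against a decreasing majorant of [beta] turns this into the weighted estimate, slow
    oscillation absorbing the factor [q].

    Slow oscillation.  Let [E_x(z) = exp (- x (1 + z) / (1 - z))], with coefficients [e_k(x)].
    Since [E_s^n = E_(s n)], boundedness of [C_(E_s)] for all [s] in an interval, integrated in
    [s], compares [beta_n] with the values [beta_k] weighted by the mass of [e_k^2] on an interval
    [[s1 n, s2 n]], and dually for [1 / beta].  That mass is explicit, because the derivative of
    [(e_k - e_(k-1))^2] is [- 2 (e_k^2 - e_(k-1)^2)].  Uniformity in [s] comes from a Baire category
    argument on some interval, transported to all others by automorphisms [T] with
    [E_s o T = E_(lambda s)].  The arithmetic mean of [beta] near [n] is then at most [C beta_n], its
    harmonic mean near [m] at least [beta_m / C], and the two means are compared.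

    Essential decrease.  If [beta_(m_i) / beta_(n_i)] is unbounded with [n_i <= m_i], take
    [phi(z) = (1 - S) z + sum_i eps_i z^(m_i)] with [eps_i = 1 / (8 n_i)] and [n_i] sparse: [phi] maps
    [z^n + ... + z^(2n-1)], for [n = n_i], to a function with a fixed proportion of its mass in a
    window of length comparable to [n_i] starting at [m_i]. *)

Require Import Defs.
From Stdlib Require Import Arith Reals Lra Lia ClassicalEpsilon.
From Coquelicot Require Import Coquelicot.

Open Scope R_scope.

(** Means over [N]-th roots of unity stand in for circle integrals: aliasing costs at most a tail of
    the power series, so Bessel's inequality, the Cauchy estimates and the mean value property
    follow by letting [N] grow. A symbol is only locally analytic by definition, so its global
    expansion has to be produced before its coefficients can be used.

    A single [e_k(s n)^2] may vanish, so no lower bound holds for one [s]; only the average over [s]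
    is bounded below. That average needs one constant for a whole interval of [s], which boundedness
    of each operator does not supply. Conditions are stated on finite sections, continuous in [s],
    so that the Baire argument can run. Testing on [z^n] controls [beta] near [n]; the dual test
    uses the coefficients [e_m(s n) / beta_n] and reads off the [m]-th coefficient of the image.

    The gliding hump symbol has nonnegative coefficients, so its powers are bounded below term by
    term, without cancellation. Slow oscillation is proved first because it lets [beta] be treated
    as constant, up to a factor, on the window of the hump. *)

Fixpoint rsum (u : nat -> R) (n : nat) : R :=
  match n with O => 0 | S k => rsum u k + u k end.

Fixpoint csum (u : nat -> C) (n : nat) : C :=
  match n with O => 0%C | S k => (csum u k + u k)%C end.

Lemma rsum_ext (u v : nat -> R) n :
  (forall k, (k < n)%nat -> u k = v k) -> rsum u n = rsum v n.
Proof.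
induction n as [|n IH]; intros H; simpl; [reflexivity|].
rewrite IH, H; auto.
Qed.

Lemma csum_ext (u v : nat -> C) n :
  (forall k, (k < n)%nat -> u k = v k) -> csum u n = csum v n.
Proof.
induction n as [|n IH]; intros H; simpl; [reflexivity|].
rewrite IH, H; auto.
Qed.

Lemma rsum_le (u v : nat -> R) n :
  (forall k, (k < n)%nat -> u k <= v k) -> rsum u n <= rsum v n.
Proof.
induction n as [|n IH]; intros H; simpl; [lra|].
apply Rplus_le_compat; auto.
Qed.

Lemma rsum_ge0 (u : nat -> R) n :
  (forall k, (k < n)%nat -> 0 <= u k) -> 0 <= rsum u n.
Proof.
induction n as [|n IH]; intros H; simpl; [lra|].
apply Rplus_le_le_0_compat; auto.
Qed.

Lemma rsum_eq0 (u : nat -> R) n : (forall k, (k < n)%nat -> u k = 0) -> rsum u n = 0.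
Proof.
induction n as [|n IH]; intros H; simpl; [reflexivity|].
rewrite IH, H by auto; ring.
Qed.

Lemma csum_eq0 (u : nat -> C) n : (forall k, (k < n)%nat -> u k = 0%C) -> csum u n = 0%C.
Proof.
induction n as [|n IH]; intros H; simpl; [reflexivity|].
rewrite IH, H by auto; ring.
Qed.

Lemma pow_le1 (x : R) n : 0 <= x <= 1 -> 0 <= x ^ n <= 1.
Proof.
intros Hx; split; [apply pow_le; lra|rewrite <- (pow1 n); apply pow_incr; exact Hx].
Qed.

Lemma INR_ge1 n : (1 <= n)%nat -> 1 <= INR n.
Proof. intros H; change 1 with (INR 1); apply le_INR, H. Qed.

Lemma rsum_plus (u v : nat -> R) n :
  rsum (fun k => u k + v k) n = rsum u n + rsum v n.
Proof. induction n as [|n IH]; simpl; [ring|]. rewrite IH; ring. Qed.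

Lemma rsum_scal (c : R) (u : nat -> R) n :
  rsum (fun k => c * u k) n = c * rsum u n.
Proof. induction n as [|n IH]; simpl; [ring|]. rewrite IH; ring. Qed.

Lemma rsum_const (c : R) n : rsum (fun _ => c) n = INR n * c.
Proof.
induction n as [|n IH]; [simpl; ring|].
rewrite S_INR; simpl; rewrite IH; ring.
Qed.

Lemma csum_plus (u v : nat -> C) n :
  csum (fun k => u k + v k)%C n = (csum u n + csum v n)%C.
Proof. induction n as [|n IH]; simpl; [ring|]. rewrite IH; ring. Qed.

Lemma csum_scal (c : C) (u : nat -> C) n :
  csum (fun k => c * u k)%C n = (c * csum u n)%C.
Proof. induction n as [|n IH]; simpl; [ring|]. rewrite IH; ring. Qed.

Lemma Cmod_csum (u : nat -> C) n :
  Cmod (csum u n) <= rsum (fun k => Cmod (u k)) n.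
Proof.
induction n as [|n IH]; simpl; [rewrite Cmod_0; lra|].
eapply Rle_trans; [apply Cmod_triangle|lra].
Qed.

Lemma rsum_shift (u : nat -> R) n :
  rsum u (S n) = u O + rsum (fun k => u (S k)) n.
Proof.
induction n as [|n IH]; [simpl; ring|].
change (rsum u (S (S n))) with (rsum u (S n) + u (S n)); rewrite IH; simpl; ring.
Qed.

Lemma csum_shift (u : nat -> C) n :
  csum u (S n) = (u O + csum (fun k => u (S k)) n)%C.
Proof.
induction n as [|n IH]; [simpl; ring|].
change (csum u (S (S n))) with (csum u (S n) + u (S n))%C; rewrite IH; simpl; ring.
Qed.

Lemma rsum_add (u : nat -> R) n m :
  rsum u (n + m) = rsum u n + rsum (fun k => u (n + k)%nat) m.
Proof.
induction m as [|m IH]; [rewrite Nat.add_0_r; simpl; ring|].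
rewrite Nat.add_succ_r; simpl; rewrite IH; ring.
Qed.

Lemma csum_add (u : nat -> C) n m :
  csum u (n + m) = (csum u n + csum (fun k => u (n + k)%nat) m)%C.
Proof.
induction m as [|m IH]; [rewrite Nat.add_0_r; simpl; ring|].
rewrite Nat.add_succ_r; simpl; rewrite IH; ring.
Qed.

Lemma rsum_mono (u : nat -> R) n m :
  (forall k, 0 <= u k) -> (n <= m)%nat -> rsum u n <= rsum u m.
Proof.
intros Hu Hnm; replace m with (n + (m - n))%nat by lia.
rewrite rsum_add.
assert (0 <= rsum (fun k => u (n + k)%nat) (m - n)) by (apply rsum_ge0; auto); lra.
Qed.

Lemma rsum_tail_le (u : nat -> R) n m :
  (forall k, 0 <= u k) -> rsum (fun k => u (n + k)%nat) m <= rsum u (n + m).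
Proof.
intros Hu; rewrite rsum_add; assert (0 <= rsum u n) by (apply rsum_ge0; auto); lra.
Qed.

Lemma rsum_term_le (u : nat -> R) n k :
  (forall k, 0 <= u k) -> (k < n)%nat -> u k <= rsum u n.
Proof.
intros Hu Hk; apply Rle_trans with (rsum u (S k)); [|apply rsum_mono; auto].
simpl; assert (0 <= rsum u k) by (apply rsum_ge0; auto); lra.
Qed.

Lemma rsum_exchange (u : nat -> nat -> R) n m :
  rsum (fun i => rsum (fun j => u i j) m) n = rsum (fun j => rsum (fun i => u i j) n) m.
Proof.
induction n as [|n IH]; simpl.
- induction m as [|m IHm]; simpl; [reflexivity|]. rewrite <- IHm; ring.
- rewrite IH, <- rsum_plus; reflexivity.
Qed.

Lemma csum_exchange (u : nat -> nat -> C) n m :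
  csum (fun i => csum (fun j => u i j) m) n = csum (fun j => csum (fun i => u i j) n) m.
Proof.
induction n as [|n IH]; simpl.
- induction m as [|m IHm]; simpl; [reflexivity|]. rewrite <- IHm; ring.
- rewrite IH, <- csum_plus; reflexivity.
Qed.

Lemma Re_csum (u : nat -> C) n : Re (csum u n) = rsum (fun k => Re (u k)) n.
Proof. induction n as [|n IH]; simpl; [reflexivity|]. rewrite <- IH; reflexivity. Qed.

Lemma Im_csum (u : nat -> C) n : Im (csum u n) = rsum (fun k => Im (u k)) n.
Proof. induction n as [|n IH]; simpl; [reflexivity|]. rewrite <- IH; reflexivity. Qed.

Lemma Cconj_csum (u : nat -> C) n : Cconj (csum u n) = csum (fun k => Cconj (u k)) n.
Proof.
induction n as [|n IH]; simpl.
- unfold Cconj; simpl; rewrite Ropp_0; reflexivity.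
- rewrite Cplus_conj, IH; reflexivity.
Qed.

Lemma csum_RtoC (u : nat -> R) n : csum (fun k => RtoC (u k)) n = RtoC (rsum u n).
Proof. induction n as [|n IH]; simpl; [reflexivity|]. rewrite IH, RtoC_plus; reflexivity. Qed.

(** * Absolutely convergent series *)

Lemma sum_n_rsum (u : nat -> R) n : sum_n u n = rsum u (S n).
Proof.
induction n as [|n IH]; [rewrite sum_O; simpl; ring|].
rewrite sum_Sn, IH; reflexivity.
Qed.

Lemma is_series_rsum (u : nat -> R) l : is_series u l <-> is_lim_seq (rsum u) l.
Proof.
rewrite is_lim_seq_incr_1; split; intros H.
- apply is_lim_seq_ext with (sum_n u); [apply sum_n_rsum|exact H].
- apply is_lim_seq_ext with (v := sum_n u) in H; [exact H|].
  intros n; symmetry; apply sum_n_rsum.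
Qed.

Lemma ex_series_bounded (u : nat -> R) M :
  (forall n, 0 <= u n) -> (forall n, rsum u n <= M) -> ex_series u.
Proof.
intros Hu HM.
destruct (ex_finite_lim_seq_incr (rsum u) M) as [l Hl]; auto.
- intros n; simpl; specialize (Hu n); lra.
- exists l; apply is_series_rsum; exact Hl.
Qed.

Lemma rsum_le_Series (u : nat -> R) n :
  (forall n, 0 <= u n) -> ex_series u -> rsum u n <= Series u.
Proof.
intros Hu Hex.
apply Series_correct, is_series_rsum in Hex.
apply (is_lim_seq_incr_compare (rsum u)); auto.
intros k; simpl; specialize (Hu k); lra.
Qed.

Lemma Series_le_bound (u : nat -> R) M :
  ex_series u -> (forall n, rsum u n <= M) -> Series u <= M.
Proof.
intros Hex HM.
apply Series_correct, is_series_rsum in Hex.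
apply (is_lim_seq_le (rsum u) (fun _ => M) (Series u) M); auto.
apply is_lim_seq_const.
Qed.

Lemma Series_ge0 (u : nat -> R) : (forall n, 0 <= u n) -> ex_series u -> 0 <= Series u.
Proof. intros Hu Hex; apply (rsum_le_Series u 0); auto. Qed.

Lemma Series_term_le (u : nat -> R) n :
  (forall n, 0 <= u n) -> ex_series u -> u n <= Series u.
Proof.
intros Hu Hex; eapply Rle_trans; [|apply (rsum_le_Series u (S n)); auto].
apply rsum_term_le; auto.
Qed.

Lemma ex_series_dom (u v : nat -> R) :
  (forall n, 0 <= u n <= v n) -> ex_series v -> ex_series u.
Proof.
intros H Hv; apply (ex_series_le (K := R_AbsRing) (V := R_CompleteNormedModule) u v); auto.
intros n; change (Rabs (u n) <= v n); rewrite Rabs_pos_eq; apply H.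
Qed.

Lemma ex_series_scal (c : R) (u : nat -> R) : ex_series u -> ex_series (fun n => c * u n).
Proof. apply (ex_series_scal_l (K := R_AbsRing) c u). Qed.

Lemma ex_series_geom_scal (c q : R) : 0 <= q < 1 -> ex_series (fun n => c * q ^ n).
Proof.
intros Hq; apply (ex_series_scal_l (K := R_AbsRing) c (fun n => q ^ n)).
apply ex_series_geom; rewrite Rabs_pos_eq; lra.
Qed.

Lemma Series_finite (u : nat -> R) N :
  (forall n, (N <= n)%nat -> u n = 0) -> is_series u (rsum u N).
Proof.
intros H; apply is_series_rsum.
apply is_lim_seq_incr_n with N.
apply is_lim_seq_ext with (fun _ => rsum u N); [|apply is_lim_seq_const].
intros n; rewrite Nat.add_comm, rsum_add.
rewrite (rsum_eq0 (fun k => u (N + k)%nat)); [ring|].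
intros k _; apply H; lia.
Qed.

Lemma Series_split (u : nat -> R) N :
  ex_series u -> Series u = rsum u N + Series (fun k => u (N + k)%nat).
Proof.
intros Hu; destruct N as [|N]; [simpl; rewrite Rplus_0_l; apply Series_ext; reflexivity|].
rewrite (Series_incr_n u (S N)); [|lia|exact Hu].
f_equal; rewrite <- sum_n_Reals; apply sum_n_rsum.
Qed.

(** * Exchange of two summations *)

Section Fubini_nonneg.
Variable u : nat -> nat -> R.
Hypothesis Hu : forall n k, 0 <= u n k.
Hypothesis Hrow : forall n, ex_series (u n).
Hypothesis Hsum : ex_series (fun n => Series (u n)).

Let fubini_col k : ex_series (fun n => u n k).
Proof.
apply ex_series_dom with (fun n => Series (u n)); [|exact Hsum].
intros n; split; [apply Hu|apply Series_term_le; auto].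
Qed.

Let fubini_partial K :
  ex_series (fun n => rsum (u n) K) /\
  Series (fun n => rsum (u n) K) = rsum (fun k => Series (fun n => u n k)) K.
Proof.
induction K as [|K [IH1 IH2]]; simpl.
- split; [exists 0; apply (Series_finite (fun _ => 0) 0); auto|].
  apply is_series_unique, (Series_finite (fun _ => 0) 0); auto.
- split.
  + apply (ex_series_plus (fun n => rsum (u n) K) (fun n => u n K)); auto.
  + rewrite Series_plus, IH2; auto.
Qed.

Let fubini_bound K : rsum (fun k => Series (fun n => u n k)) K <= Series (fun n => Series (u n)).
Proof.
rewrite <- (proj2 (fubini_partial K)).
apply Series_le; [|exact Hsum].
intros n; split; [apply rsum_ge0; auto|apply rsum_le_Series; auto].
Qed.

(** Finitely many columns are exchanged first and bounded by the full double sum. The same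
    inequality for the transposed array then gives equality. *)
Lemma fubini_nonneg_half :
  (forall k, ex_series (fun n => u n k)) /\
  ex_series (fun k => Series (fun n => u n k)) /\
  Series (fun k => Series (fun n => u n k)) <= Series (fun n => Series (u n)).
Proof.
assert (He : ex_series (fun k => Series (fun n => u n k))).
{ apply ex_series_bounded with (Series (fun n => Series (u n))); [|exact fubini_bound].
  intros k; apply Series_ge0; auto. }
repeat split; auto; apply Series_le_bound; auto.
Qed.
End Fubini_nonneg.

Lemma fubini_nonneg (u : nat -> nat -> R) :
  (forall n k, 0 <= u n k) -> (forall n, ex_series (u n)) ->
  ex_series (fun n => Series (u n)) ->
  (forall k, ex_series (fun n => u n k)) /\
  ex_series (fun k => Series (fun n => u n k)) /\
  Series (fun k => Series (fun n => u n k)) = Series (fun n => Series (u n)).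
Proof.
intros Hu Hrow Hsum.
destruct (fubini_nonneg_half u Hu Hrow Hsum) as (H1 & H2 & H3).
destruct (fubini_nonneg_half (fun k n => u n k)) as (H4 & H5 & H6); auto.
repeat split; auto; apply Rle_antisym; auto.
Qed.

(** [u] is the difference of the nonnegative arrays [|u|] and [|u| - u], to which the nonnegative
    case applies. *)
Lemma fubini_R (u : nat -> nat -> R) :
  (forall n, ex_series (fun k => Rabs (u n k))) ->
  ex_series (fun n => Series (fun k => Rabs (u n k))) ->
  Series (fun k => Series (fun n => u n k)) = Series (fun n => Series (u n)).
Proof.
intros Hrow Hsum.
set (p := fun n k => Rabs (u n k)); set (q := fun n k => Rabs (u n k) - u n k).
assert (Hq : forall n k, 0 <= q n k <= 2 * p n k).
{ intros n k; unfold p, q; generalize (Rle_abs (u n k)) (Rle_abs (- u n k)).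
  rewrite Rabs_Ropp; lra. }
assert (Hp0 : forall n k, 0 <= p n k) by (intros; apply Rabs_pos).
assert (Hqrow : forall n, ex_series (q n)).
{ intros n; apply ex_series_dom with (fun k => 2 * p n k); [auto|].
  apply (ex_series_scal_l (K := R_AbsRing) 2 (p n)); apply Hrow. }
assert (Hqsum : ex_series (fun n => Series (q n))).
{ apply ex_series_dom with (fun n => 2 * Series (p n)).
  - intros n; split; [apply Series_ge0; auto; intros; apply Hq|].
    rewrite <- Series_scal_l; apply Series_le; [apply Hq|].
    apply (ex_series_scal_l (K := R_AbsRing) 2 (p n)); apply Hrow.
  - apply (ex_series_scal_l (K := R_AbsRing) 2 (fun n => Series (p n))); apply Hsum. }
destruct (fubini_nonneg p Hp0 Hrow Hsum) as (P1 & P2 & P3).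
destruct (fubini_nonneg q (fun n k => proj1 (Hq n k)) Hqrow Hqsum) as (Q1 & Q2 & Q3).
assert (E : forall n k, u n k = p n k - q n k) by (intros; unfold p, q; ring).
transitivity (Series (fun k => Series (fun n => p n k) - Series (fun n => q n k))).
{ apply Series_ext; intros k; rewrite <- Series_minus; auto.
  apply Series_ext; auto. }
rewrite Series_minus, P3, Q3; auto.
rewrite <- Series_minus; auto.
apply Series_ext; intros n; rewrite <- Series_minus; [|apply Hrow|auto].
apply Series_ext; auto.
Qed.

Definition Csum (u : nat -> C) : C :=
  (Series (fun n => Re (u n)), Series (fun n => Im (u n))).

Definition absC (u : nat -> C) : Prop := ex_series (fun n => Cmod (u n)).

Lemma im_le_Cmod (z : C) : Rabs (Im z) <= Cmod z.
Proof. eapply Rle_trans; [apply Rmax_r|apply Rmax_Cmod]. Qed.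

Lemma absC_Re_abs u : absC u -> ex_series (fun n => Rabs (Re (u n))).
Proof. apply ex_series_dom; intros n; split; [apply Rabs_pos|apply re_le_Cmod]. Qed.

Lemma absC_Im_abs u : absC u -> ex_series (fun n => Rabs (Im (u n))).
Proof. apply ex_series_dom; intros n; split; [apply Rabs_pos|apply im_le_Cmod]. Qed.

Lemma absC_Re u : absC u -> ex_series (fun n => Re (u n)).
Proof. intros H; apply ex_series_Rabs, absC_Re_abs, H. Qed.

Lemma absC_Im u : absC u -> ex_series (fun n => Im (u n)).
Proof. intros H; apply ex_series_Rabs, absC_Im_abs, H. Qed.

Lemma absC_ext (u v : nat -> C) : (forall n, u n = v n) -> absC u -> absC v.
Proof. intros H; apply ex_series_ext; intros n; rewrite H; reflexivity. Qed.

Lemma absC_dom (u : nat -> C) (v : nat -> R) :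
  (forall n, Cmod (u n) <= v n) -> ex_series v -> absC u.
Proof. intros H; apply ex_series_dom; intros n; split; [apply Cmod_ge_0|apply H]. Qed.

Lemma absC_scal c u : absC u -> absC (fun n => c * u n)%C.
Proof.
intros Hu; apply absC_dom with (fun n => Cmod c * Cmod (u n)).
- intros n; rewrite Cmod_mult; lra.
- apply (ex_series_scal_l (K := R_AbsRing) (Cmod c) (fun n => Cmod (u n))); auto.
Qed.

Lemma absC_shift u N : absC u <-> absC (fun k => u (N + k)%nat).
Proof. apply (ex_series_incr_n (fun n => Cmod (u n)) N). Qed.

Lemma Csum_ext (u v : nat -> C) : (forall n, u n = v n) -> Csum u = Csum v.
Proof.
intros H; unfold Csum; f_equal; apply Series_ext; intros n; rewrite H; reflexivity.
Qed.

Lemma Csum_plus u v : absC u -> absC v -> Csum (fun n => u n + v n)%C = (Csum u + Csum v)%C.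
Proof.
intros Hu Hv; unfold Csum, Cplus at 3; simpl; f_equal; rewrite <- Series_plus;
  auto using absC_Re, absC_Im.
Qed.

Lemma Csum_scal c u : absC u -> Csum (fun n => c * u n)%C = (c * Csum u)%C.
Proof.
intros Hu; unfold Csum, Cmult at 3; simpl.
assert (Hr := absC_Re u Hu); assert (Hi := absC_Im u Hu).
assert (S : forall (a : R) (w : nat -> R), ex_series w -> ex_series (fun n => a * w n))
  by (intros a w; apply (ex_series_scal_l (K := R_AbsRing) a w)).
f_equal; rewrite <- !Series_scal_l.
- rewrite <- Series_minus; auto.
- rewrite <- Series_plus; auto.
Qed.

Lemma Csum_RtoC (u : nat -> R) : Csum (fun n => RtoC (u n)) = RtoC (Series u).
Proof.
unfold Csum, RtoC; simpl; f_equal.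
apply is_series_unique, (Series_finite (fun _ => 0) 0); auto.
Qed.

(** Multiplying by the conjugate of the sum makes it real and nonnegative, which reduces the
    inequality to real series. *)
Lemma Cmod_Csum u : absC u -> Cmod (Csum u) <= Series (fun n => Cmod (u n)).
Proof.
intros Hu; set (s := Csum u).
destruct (Req_dec (Cmod s) 0) as [E|E].
{ rewrite E; apply Series_ge0; auto; intros; apply Cmod_ge_0. }
assert (Hs : 0 < Cmod s) by (generalize (Cmod_ge_0 s); lra).
apply Rmult_le_reg_l with (Cmod s); auto.
replace (Cmod s * Cmod s) with (Re (Cconj s * s)).
2:{ transitivity (Cmod s ^ 2); [rewrite Cmod2_alt; destruct s; simpl; ring|ring]. }
unfold s at 2; rewrite <- Csum_scal, <- Series_scal_l; auto.
apply Rle_trans with (Series (fun n => Rabs (Re (Cconj s * u n)))).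
- eapply Rle_trans; [apply Rle_abs|].
  apply Series_Rabs, absC_Re_abs, absC_scal, Hu.
- apply Series_le; [|apply ex_series_scal; exact Hu].
  intros n; split; [apply Rabs_pos|].
  eapply Rle_trans; [apply re_le_Cmod|]; rewrite Cmod_mult, Cmod_conj; lra.
Qed.

Lemma Csum_split u N :
  absC u -> Csum u = (csum u N + Csum (fun k => u (N + k)%nat))%C.
Proof.
intros Hu; apply injective_projections; unfold Csum at 1; simpl.
- rewrite (Series_split _ N), <- Re_csum; auto using absC_Re.
- rewrite (Series_split _ N), <- Im_csum; auto using absC_Im.
Qed.

Lemma Csum_finite (u : nat -> C) N : (forall n, (N <= n)%nat -> u n = 0%C) -> Csum u = csum u N.
Proof.
intros H; apply injective_projections; unfold Csum; simpl.
- change (fst (csum u N)) with (Re (csum u N)); rewrite Re_csum.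
  apply is_series_unique, Series_finite; intros n Hn; rewrite H; auto.
- change (snd (csum u N)) with (Im (csum u N)); rewrite Im_csum.
  apply is_series_unique, Series_finite; intros n Hn; rewrite H; auto.
Qed.

Lemma absC_finite (u : nat -> C) N : (forall n, (N <= n)%nat -> u n = 0%C) -> absC u.
Proof.
intros H; exists (rsum (fun n => Cmod (u n)) N); apply Series_finite.
intros n Hn; rewrite H, Cmod_0; auto.
Qed.

Lemma sum_n_csum (u : nat -> C) n : sum_n (G := C_AbelianMonoid) u n = csum u (S n).
Proof.
induction n as [|n IH]; [rewrite sum_O; simpl; ring|].
rewrite sum_Sn, IH; reflexivity.
Qed.

Lemma is_series_C (u : nat -> C) (l : C) :
  is_series (V := C_NormedModule) u l <->
  is_series (fun n => Re (u n)) (Re l) /\ is_series (fun n => Im (u n)) (Im l).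
Proof.
assert (E1 : forall n, sum_n (fun n => Re (u n)) n = Re (sum_n (G := C_AbelianMonoid) u n))
  by (intros; rewrite sum_n_csum, sum_n_rsum, Re_csum; reflexivity).
assert (E2 : forall n, sum_n (fun n => Im (u n)) n = Im (sum_n (G := C_AbelianMonoid) u n))
  by (intros; rewrite sum_n_csum, sum_n_rsum, Im_csum; reflexivity).
split.
- intros H; split; apply filterlim_locally; intros eps;
    destruct (proj1 (filterlim_locally _ _) H eps) as [N HN]; exists N; intros n Hn.
  + rewrite E1; apply (HN n Hn).
  + rewrite E2; apply (HN n Hn).
- intros [H1 H2]; apply filterlim_locally; intros eps.
  destruct (proj1 (filterlim_locally _ _) H1 eps) as [N1 HN1].
  destruct (proj1 (filterlim_locally _ _) H2 eps) as [N2 HN2].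
  exists (max N1 N2); intros n Hn; split.
  + change (ball (Re l) eps (Re (sum_n (G := C_AbelianMonoid) u n))).
    rewrite <- E1; apply HN1; lia.
  + change (ball (Im l) eps (Im (sum_n (G := C_AbelianMonoid) u n))).
    rewrite <- E2; apply HN2; lia.
Qed.

Lemma Csum_correct u :
  absC u -> is_series (V := C_NormedModule) u (Csum u).
Proof.
intros Hu; apply is_series_C; split; apply Series_correct; auto using absC_Re, absC_Im.
Qed.

Lemma Csum_unique (u : nat -> C) (l : C) :
  is_series (V := C_NormedModule) u l -> Csum u = l.
Proof.
intros H; apply is_series_C in H; destruct H as [H1 H2].
unfold Csum; rewrite (is_series_unique _ _ H1), (is_series_unique _ _ H2).
destruct l; reflexivity.
Qed.

Lemma fubini_C (u : nat -> nat -> C) :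
  (forall n, absC (u n)) ->
  ex_series (fun n => Series (fun k => Cmod (u n k))) ->
  (forall k, absC (fun n => u n k)) /\
  ex_series (fun k => Series (fun n => Cmod (u n k))) /\
  absC (fun k => Csum (fun n => u n k)) /\
  absC (fun n => Csum (u n)) /\
  Csum (fun k => Csum (fun n => u n k)) = Csum (fun n => Csum (u n)).
Proof.
intros Hrow Hsum.
destruct (fubini_nonneg (fun n k => Cmod (u n k))) as (H1 & H2 & _); auto.
{ intros; apply Cmod_ge_0. }
split; [exact H1|]; split; [exact H2|]; split; [|split].
- apply absC_dom with (fun k => Series (fun n => Cmod (u n k))); auto.
  intros k; apply Cmod_Csum, H1.
- apply absC_dom with (fun n => Series (fun k => Cmod (u n k))); auto.
  intros n; apply Cmod_Csum, Hrow.
- unfold Csum; simpl; f_equal; apply fubini_R.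
  + intros n; apply absC_Re_abs, Hrow.
  + apply ex_series_dom with (fun n => Series (fun k => Cmod (u n k))); auto.
    intros n; split.
    * apply Series_ge0; [intros; apply Rabs_pos|apply absC_Re_abs, Hrow].
    * apply Series_le; [|apply Hrow].
      intros k; split; [apply Rabs_pos|apply re_le_Cmod].
  + intros n; apply absC_Im_abs, Hrow.
  + apply ex_series_dom with (fun n => Series (fun k => Cmod (u n k))); auto.
    intros n; split.
    * apply Series_ge0; [intros; apply Rabs_pos|apply absC_Im_abs, Hrow].
    * apply Series_le; [|apply Hrow].
      intros k; split; [apply Rabs_pos|apply im_le_Cmod].
Qed.

(** * Power series on a disk *)

Definition psum (a : nat -> C) (h : C) : C := Csum (fun n => a n * h ^ n)%C.

Definition psabs (a : nat -> C) (r : R) : Prop := ex_series (fun n => Cmod (a n) * r ^ n).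

Definition exp_at (f : C -> C) (z0 : C) (a : nat -> C) (rho : R) : Prop :=
  (forall r, 0 <= r < rho -> psabs a r) /\
  (forall h, Cmod h < rho -> f (z0 + h)%C = psum a h).

Lemma psabs_absC a r h : psabs a r -> Cmod h <= r -> absC (fun n => a n * h ^ n)%C.
Proof.
intros Ha Hh; apply absC_dom with (fun n => Cmod (a n) * r ^ n); auto.
intros n; rewrite Cmod_mult, Cmod_pow; apply Rmult_le_compat_l; [apply Cmod_ge_0|].
apply pow_incr; split; [apply Cmod_ge_0|exact Hh].
Qed.

Lemma psabs_le a r s : 0 <= r <= s -> psabs a s -> psabs a r.
Proof.
intros Hr; apply ex_series_dom; intros n; split.
- apply Rmult_le_pos; [apply Cmod_ge_0|apply pow_le; lra].
- apply Rmult_le_compat_l; [apply Cmod_ge_0|apply pow_incr; lra].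
Qed.

Lemma psabs_of_bound a r s M :
  0 <= r < s -> (forall n, Cmod (a n) * s ^ n <= M) -> psabs a r.
Proof.
intros Hr H; apply ex_series_dom with (fun n => M * (r / s) ^ n).
- intros n; split; [apply Rmult_le_pos; [apply Cmod_ge_0|apply pow_le; lra]|].
  replace (Cmod (a n) * r ^ n) with (Cmod (a n) * s ^ n * (r / s) ^ n).
  + apply Rmult_le_compat_r; auto; apply pow_le.
    apply Rdiv_le_0_compat; lra.
  + unfold Rdiv; rewrite Rpow_mult_distr, pow_inv; field; apply pow_nonzero; lra.
- apply ex_series_geom_scal; split; [apply Rdiv_le_0_compat; lra|].
  apply Rmult_lt_reg_r with s; [lra|]; unfold Rdiv; rewrite Rmult_assoc, Rinv_l; lra.
Qed.

Lemma is_pseries_C (a : nat -> C) (h l : C) :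
  is_pseries (V := C_NormedModule) a h l <->
  is_series (V := C_NormedModule) (fun n => a n * h ^ n)%C l.
Proof.
assert (E : forall n, pow_n (K := C_AbsRing) h n = (h ^ n)%C).
{ intros n; induction n as [|n IH]; [reflexivity|].
  change (pow_n (K := C_AbsRing) h (S n)) with (h * pow_n (K := C_AbsRing) h n)%C.
  rewrite IH; reflexivity. }
assert (E' : forall n, scal (V := C_NormedModule) (pow_n (K := C_AbsRing) h n) (a n) = (a n * h ^ n)%C).
{ intros n; rewrite E; apply Cmult_comm. }
unfold is_pseries; split; intros H; revert H; apply is_series_ext; intros n;
  [|symmetry]; apply E'.
Qed.

Lemma ex_series_tail_bound (u : nat -> R) :
  ex_series u -> exists N, forall n, (N <= n)%nat -> Rabs (u n) <= 1.
Proof.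
intros H; apply ex_series_lim_0 in H.
apply is_lim_seq_spec in H; destruct (H (mkposreal 1 Rlt_0_1)) as [N HN].
exists N; intros n Hn; specialize (HN n Hn); simpl in HN.
rewrite Rminus_0_r in HN; lra.
Qed.

(** Convergence at one point forces bounded terms there, hence geometric decay at smaller radii.
    Real and imaginary parts are eventually at most 1, whence [sqrt 2]. *)
Lemma psabs_of_series a s l r :
  0 <= r < s ->
  is_series (V := C_NormedModule) (fun n => a n * RtoC s ^ n)%C l ->
  psabs a r.
Proof.
intros Hr H; apply is_series_C in H; destruct H as [H1 H2].
destruct (ex_series_tail_bound (fun n => Re (a n * RtoC s ^ n))%C) as [N1 HN1];
  [eexists; apply H1|].
destruct (ex_series_tail_bound (fun n => Im (a n * RtoC s ^ n))%C) as [N2 HN2];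
  [eexists; apply H2|].
set (N := max N1 N2).
assert (B : forall n, (N <= n)%nat -> Cmod (a n) * s ^ n <= sqrt 2).
{ intros n Hn.
  replace (Cmod (a n) * s ^ n) with (Cmod (a n * RtoC s ^ n)%C).
  - eapply Rle_trans; [apply Cmod_2Rmax|].
    rewrite <- (Rmult_1_r (sqrt 2)) at 2; apply Rmult_le_compat_l; [apply sqrt_pos|].
    apply Rmax_lub; [apply (HN1 n)|apply (HN2 n)]; unfold N in Hn; lia.
  - rewrite Cmod_mult, Cmod_pow, Cmod_R, Rabs_pos_eq; [reflexivity|lra]. }
apply psabs_of_bound with s (Rmax (sqrt 2) (rsum (fun n => Cmod (a n) * s ^ n) N)); auto.
intros n; destruct (le_lt_dec N n) as [Hn|Hn].
- eapply Rle_trans; [apply B; auto|apply Rmax_l].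
- eapply Rle_trans; [|apply Rmax_r].
  apply (rsum_term_le (fun n => Cmod (a n) * s ^ n)); auto.
  intros k; apply Rmult_le_pos; [apply Cmod_ge_0|apply pow_le; lra].
Qed.

Lemma exp_at_intro f z0 a rho :
  (forall h, Cmod h < rho ->
     is_pseries (V := C_NormedModule) a h (f (z0 + h)%C)) ->
  exp_at f z0 a rho.
Proof.
intros H; split.
- intros r Hr; apply psabs_of_series with ((r + rho) / 2) (f (z0 + RtoC ((r + rho) / 2)))%C.
  + lra.
  + apply is_pseries_C, H; rewrite Cmod_R, Rabs_pos_eq; lra.
- intros h Hh; symmetry; apply Csum_unique, is_pseries_C, H, Hh.
Qed.

Lemma exp_at_elim f z0 a rho h :
  exp_at f z0 a rho -> Cmod h < rho ->
  is_pseries (V := C_NormedModule) a h (f (z0 + h)%C).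
Proof.
intros [H1 H2] Hh; apply is_pseries_C; rewrite H2; auto.
apply Csum_correct, psabs_absC with (Cmod h); [|lra].
apply H1; split; [apply Cmod_ge_0|exact Hh].
Qed.

Lemma in_disk_R r : 0 <= r < 1 -> in_disk (RtoC r).
Proof. intros Hr; unfold in_disk; rewrite Cmod_R, Rabs_pos_eq; lra. Qed.

Lemma in_disk_0 : in_disk 0.
Proof. apply in_disk_R; lra. Qed.

Lemma has_expansion_exp_at f a : has_expansion f a <-> exp_at f 0 a 1.
Proof.
split; intros H.
- apply exp_at_intro; intros h Hh; rewrite Cplus_0_l; apply H, Hh.
- intros z Hz; rewrite <- (Cplus_0_l z) at 2; apply exp_at_elim with 1; auto.
Qed.

Lemma exp_at_le f z0 a r s : r <= s -> exp_at f z0 a s -> exp_at f z0 a r.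
Proof.
intros H [H1 H2]; split; [intros t Ht; apply H1; lra|intros h Hh; apply H2; lra].
Qed.

(** Neighbourhoods in [C_UniformSpace] are squares while expansions live on discs; the factor 2 is a
    convenient bound for [sqrt 2]. *)
Lemma Cmod_box (z : C) d : Rabs (fst z) < d -> Rabs (snd z) < d -> Cmod z < 2 * d.
Proof.
intros H1 H2.
assert (S2 : sqrt 2 <= 2).
{ rewrite <- (sqrt_square 2) at 2; [apply sqrt_le_1|]; lra. }
eapply Rle_lt_trans; [apply Cmod_2Rmax|].
apply Rle_lt_trans with (2 * Rmax (Rabs (fst z)) (Rabs (snd z))).
- apply Rmult_le_compat_r; auto; eapply Rle_trans; [apply Rabs_pos|apply Rmax_l].
- apply Rmult_lt_compat_l; [lra|]; apply Rmax_lub_lt; auto.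
Qed.

Lemma analytic_at_exp_at f z0 : analytic_at f z0 <-> exists a rho, 0 < rho /\ exp_at f z0 a rho.
Proof.
split.
- intros [a [eps Ha]]; exists a, eps; split; [apply cond_pos|].
  apply exp_at_intro; intros h Hh.
  replace h with (z0 + h - z0)%C at 1 by ring; apply Ha.
  split; (eapply Rle_lt_trans; [|apply Hh]).
  + change (Rabs (fst (z0 + h)%C - fst z0) <= Cmod h).
    replace (fst (z0 + h)%C - fst z0) with (Re h) by (simpl; unfold Re; ring).
    apply re_le_Cmod.
  + change (Rabs (snd (z0 + h)%C - snd z0) <= Cmod h).
    replace (snd (z0 + h)%C - snd z0) with (Im h) by (simpl; unfold Im; ring).
    apply im_le_Cmod.
- intros (a & rho & Hr & H); exists a.
  assert (Hr2 : 0 < rho / 2) by lra.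
  exists (mkposreal _ Hr2); intros z [Hz1 Hz2].
  replace z with (z0 + (z - z0))%C at 2 by ring.
  apply exp_at_elim with rho; auto.
  replace rho with (2 * (rho / 2)) by field.
  apply Cmod_box; [apply Hz1|apply Hz2].
Qed.

(** * Means over roots of unity *)

Definition cis (t : R) : C := (cos t, sin t).

Lemma cis_plus s t : cis (s + t) = (cis s * cis t)%C.
Proof.
unfold cis; rewrite cos_plus, sin_plus; apply injective_projections; simpl; ring.
Qed.

Lemma cis_pow t n : (cis t ^ n)%C = cis (INR n * t).
Proof.
induction n as [|n IH].
- simpl; rewrite Rmult_0_l; unfold cis; rewrite cos_0, sin_0; reflexivity.
- rewrite Cpow_S, IH, <- cis_plus, S_INR; f_equal; ring.
Qed.

Lemma cis_conj t : Cconj (cis t) = cis (- t).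
Proof. unfold cis, Cconj; simpl; rewrite cos_neg, sin_neg; reflexivity. Qed.

Lemma Cmod_cis t : Cmod (cis t) = 1.
Proof.
unfold Cmod, cis; simpl; replace (_ + _) with (Rsqr (sin t) + Rsqr (cos t)) by (unfold Rsqr; ring).
rewrite sin2_cos2; apply sqrt_1.
Qed.

Definition zeta (N j : nat) : C := cis (INR j * (2 * PI / INR N)).

Lemma Cmod_zeta N j : Cmod (zeta N j) = 1.
Proof. apply Cmod_cis. Qed.

Definition mean (N : nat) (u : nat -> C) : C := (csum u N / INR N)%C.

Lemma mean_ext N u v : (forall j, u j = v j) -> mean N u = mean N v.
Proof. intros H; unfold mean; rewrite (csum_ext u v); auto. Qed.

Lemma mean_plus N u v : mean N (fun j => u j + v j)%C = (mean N u + mean N v)%C.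
Proof. unfold mean; rewrite csum_plus; unfold Cdiv; ring. Qed.

Lemma mean_scal N c u : mean N (fun j => c * u j)%C = (c * mean N u)%C.
Proof. unfold mean; rewrite csum_scal; unfold Cdiv; ring. Qed.

Lemma mean_csum N (u : nat -> nat -> C) L :
  mean N (fun j => csum (fun m => u m j) L) = csum (fun m => mean N (u m)) L.
Proof.
unfold mean; rewrite csum_exchange; unfold Cdiv.
rewrite Cmult_comm, <- csum_scal; apply csum_ext; intros; apply Cmult_comm.
Qed.

Lemma INR_C_neq0 N : (0 < N)%nat -> RtoC (INR N) <> 0%C.
Proof. intros H E; apply RtoC_inj in E; apply (not_0_INR N); [lia|exact E]. Qed.

Lemma Cmod_mean N u B : (0 < N)%nat -> (forall j, Cmod (u j) <= B) -> Cmod (mean N u) <= B.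
Proof.
intros HN H; unfold mean.
assert (HN' : 0 < INR N) by (apply lt_0_INR; auto).
rewrite Cmod_div, Cmod_R, Rabs_pos_eq; [|lra|apply INR_C_neq0; auto].
apply Rmult_le_reg_r with (INR N); auto; unfold Rdiv; rewrite Rmult_assoc, Rinv_l, Rmult_1_r by lra.
eapply Rle_trans; [apply Cmod_csum|].
eapply Rle_trans; [apply rsum_le; intros; apply H|]; rewrite rsum_const; lra.
Qed.

Lemma csum_geom (w : C) N : ((w - 1) * csum (fun j => w ^ j) N = w ^ N - 1)%C.
Proof. induction N as [|N IH]; simpl; [ring|]. rewrite Cmult_plus_distr_l, IH; ring. Qed.

(** Off the diagonal this is a geometric sum whose ratio is an [N]-th root of unity different from
    1. *)
Lemma mean_zeta N k m :
  (k < N)%nat -> (m < N)%nat ->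
  mean N (fun j => zeta N j ^ k * Cconj (zeta N j) ^ m)%C = if Nat.eq_dec k m then 1%C else 0%C.
Proof.
intros Hk Hm.
assert (HN : 0 < INR N) by (apply lt_0_INR; lia).
set (th := (INR k - INR m) * (2 * PI / INR N)).
assert (E : forall j, (zeta N j ^ k * Cconj (zeta N j) ^ m)%C = (cis th ^ j)%C).
{ intros j; unfold zeta; rewrite cis_conj, !cis_pow, <- cis_plus; f_equal; unfold th; ring. }
rewrite (mean_ext N _ (fun j => cis th ^ j)%C E); unfold mean.
destruct (Nat.eq_dec k m) as [Ekm|Ekm].
- rewrite (csum_ext _ (fun _ => RtoC 1)).
  + rewrite (csum_RtoC (fun _ => 1)), rsum_const, Rmult_1_r; field; apply INR_C_neq0; lia.
  + intros j _; unfold th; rewrite Ekm, cis_pow.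
    replace (INR j * _) with 0 by ring; unfold cis; rewrite cos_0, sin_0; reflexivity.
- assert (Hw : (cis th ^ N)%C = 1%C).
  { rewrite cis_pow; unfold th.
    replace (INR N * _) with (2 * INR k * PI + - (2 * INR m * PI)) by (field; lra).
    rewrite cis_plus, <- cis_conj; unfold cis.
    rewrite <- (Rplus_0_l (2 * INR k * PI)), <- (Rplus_0_l (2 * INR m * PI)).
    rewrite !cos_period, !sin_period, cos_0, sin_0; unfold Cconj; simpl.
    apply injective_projections; simpl; ring. }
  (* The real part of [cis th - 1] is [-2 sin^2 (th / 2)], and [0 < |k - m| < N] keeps [|th / 2|]
     strictly between 0 and [PI]. *)
  assert (Hn : (cis th - 1)%C <> 0%C).
  { intros Ez; apply (f_equal Re) in Ez; simpl in Ez.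
    replace th with (2 * (th / 2)) in Ez by field; rewrite cos_2a_sin in Ez.
    assert (Hs : forall i j, (j < N)%nat -> INR i < INR j -> sin ((INR j - INR i) * PI / INR N) <> 0).
    { intros i j Hj Hij; apply lt_INR in Hj; generalize (pos_INR i) PI_RGT_0; intros.
      apply Rgt_not_eq, sin_gt_0; [apply Rdiv_lt_0_compat; nra|].
      apply Rlt_div_l; nra. }
    destruct (Rtotal_order (INR k) (INR m)) as [Hlt|[He|Hgt]].
    - apply (Hs k m Hm Hlt); replace (_ / _) with (- (th / 2)) by (unfold th; field; lra).
      rewrite sin_neg; nra.
    - apply INR_eq in He; contradiction.
    - apply (Hs m k Hk Hgt); replace (_ / _) with (th / 2) by (unfold th; field; lra); nra. }
  assert (G := csum_geom (cis th) N); rewrite Hw in G.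
  assert (G0 : csum (fun j => cis th ^ j)%C N = 0%C).
  { transitivity (/ (cis th - 1) * ((cis th - 1) * csum (fun j => cis th ^ j) N))%C;
      [field; exact Hn|rewrite G; ring]. }
  change (csum (fun j => cis th ^ j)%C N / INR N = 0)%C.
  rewrite G0; unfold Cdiv; ring.
Qed.

Definition dft (N : nat) (g : nat -> C) (m : nat) : C :=
  mean N (fun j => g j * Cconj (zeta N j) ^ m)%C.

Lemma Re_mult_conj z : Re (z * Cconj z)%C = Cmod z ^ 2.
Proof. rewrite Cmod2_alt; destruct z; simpl; ring. Qed.

Lemma Re_minus z w : Re (z - w)%C = Re z - Re w.
Proof. reflexivity. Qed.

(** Nonnegativity of the mean of [|g - Q|^2], where [Q] is built from the first [L] coefficients of
    [g]. By orthogonality the mean of [g * conj Q] and that of [|Q|^2] are both the left-hand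
    side. *)
Lemma dft_bessel N g L :
  (0 < N)%nat -> (L <= N)%nat ->
  rsum (fun m => Cmod (dft N g m) ^ 2) L <= rsum (fun j => Cmod (g j) ^ 2) N / INR N.
Proof.
intros HN HL.
set (A := dft N g).
set (Q := fun j => csum (fun m => A m * zeta N j ^ m)%C L).
assert (E1 : mean N (fun j => g j * Cconj (Q j))%C = csum (fun m => A m * Cconj (A m))%C L).
{ rewrite (mean_ext N _ (fun j => csum (fun m => Cconj (A m) * (g j * Cconj (zeta N j) ^ m)) L)%C).
  - rewrite mean_csum; apply csum_ext; intros m _; rewrite mean_scal; unfold A, dft; ring.
  - intros j; unfold Q; rewrite Cconj_csum, <- csum_scal; apply csum_ext; intros m _.
    rewrite Cmult_conj, Cpow_conj; ring. }
assert (E2 : mean N (fun j => Q j * Cconj (Q j))%C = csum (fun m => A m * Cconj (A m))%C L).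
{ rewrite (mean_ext N _ (fun j => csum (fun m => csum (fun k =>
     (A k * Cconj (A m)) * (zeta N j ^ k * Cconj (zeta N j) ^ m)) L) L)%C).
  - rewrite mean_csum; apply csum_ext; intros m Hm; rewrite mean_csum.
    rewrite (csum_ext _ (fun k => if Nat.eq_dec k m then A m * Cconj (A m) else 0)%C).
    + clear -Hm; induction L as [|L IH]; [lia|]; simpl.
      destruct (Nat.eq_dec L m) as [->|Hne].
      * rewrite csum_eq0; [ring|].
        intros k Hk; destruct (Nat.eq_dec k m); [lia|reflexivity].
      * rewrite IH by lia; ring.
    + intros k Hk; rewrite mean_scal, mean_zeta by lia.
      destruct (Nat.eq_dec k m) as [->|]; ring.
  - intros j; unfold Q at 2; rewrite Cconj_csum, <- csum_scal; apply csum_ext; intros m _.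
    unfold Q; rewrite Cmult_comm, <- csum_scal; apply csum_ext; intros k _.
    rewrite Cmult_conj, Cpow_conj; ring. }
assert (HN' : 0 < INR N) by (apply lt_0_INR; auto).
assert (Rm : forall h k, Re (mean N (fun j => h j * Cconj (k j))%C)
    = rsum (fun j => Re (h j * Cconj (k j))%C) N / INR N).
{ intros h k; unfold mean, Cdiv; rewrite <- RtoC_inv by lra.
  rewrite re_scal_r, Re_csum; reflexivity. }
apply (f_equal Re) in E1, E2; rewrite Rm, Re_csum in E1, E2.
rewrite (rsum_ext (fun m => Re _) (fun m => Cmod (A m) ^ 2) L) in E1, E2
  by (intros; apply Re_mult_conj).
set (S0 := rsum (fun m => Cmod (A m) ^ 2) L) in *.
assert (P : rsum (fun j => 2 * Re (g j * Cconj (Q j))%C) N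
   <= rsum (fun j => Cmod (g j) ^ 2 + Re (Q j * Cconj (Q j))%C) N).
{ apply rsum_le; intros j _; rewrite Re_mult_conj, !Cmod2_alt.
  generalize (pow2_ge_0 (Re (g j) - Re (Q j))) (pow2_ge_0 (Im (g j) - Im (Q j))).
  destruct (g j), (Q j); simpl; lra. }
rewrite rsum_scal, rsum_plus in P.
apply Rmult_le_compat_r with (r := / INR N) in P; [|apply Rlt_le, Rinv_0_lt_compat, HN'].
unfold Rdiv in *; lra.
Qed.

(** Frequencies below [N] are separated exactly by [mean_zeta]; those from [N] on alias, and the
    tail bounds their total contribution. *)
Lemma dft_psum N (d : nat -> C) r m :
  0 <= r -> psabs d r -> (m < N)%nat ->
  Cmod (dft N (fun j => psum d (r * zeta N j)%C) m - d m * RtoC r ^ m)%C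
    <= Series (fun k => Cmod (d (N + k)%nat) * r ^ (N + k)).
Proof.
intros Hr Hd Hm.
set (T := fun j => Csum (fun k => d (N + k)%nat * (r * zeta N j) ^ (N + k))%C).
assert (Hz : forall j, Cmod (r * zeta N j)%C <= r)
  by (intros; rewrite Cmod_mult, Cmod_zeta, Cmod_R, Rabs_pos_eq; lra).
assert (E : forall j, psum d (r * zeta N j)%C =
   (csum (fun k => (d k * RtoC r ^ k) * zeta N j ^ k) N + T j)%C).
{ intros j; unfold psum; rewrite (Csum_split _ N); [|apply psabs_absC with r; auto].
  f_equal; apply csum_ext; intros; rewrite Cpow_mult_l; ring. }
unfold dft.
rewrite (mean_ext N _ (fun j => csum (fun k => (d k * RtoC r ^ k) * (zeta N j ^ k * Cconj (zeta N j) ^ m)) N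
   + T j * Cconj (zeta N j) ^ m)%C).
2:{ intros j; rewrite E, Cmult_plus_distr_r; f_equal.
    rewrite Cmult_comm, <- csum_scal; apply csum_ext; intros; ring. }
rewrite mean_plus, mean_csum.
rewrite (csum_ext _ (fun k => if Nat.eq_dec k m then d m * RtoC r ^ m else 0)%C).
2:{ intros k Hk; rewrite mean_scal, mean_zeta by auto; destruct (Nat.eq_dec k m) as [->|]; ring. }
replace (csum _ N) with (d m * RtoC r ^ m)%C.
2:{ clear -Hm; induction N as [|N IH]; [lia|]; simpl.
    destruct (Nat.eq_dec N m) as [->|Hne].
    - rewrite csum_eq0; [ring|].
      intros k Hk; destruct (Nat.eq_dec k m); [lia|reflexivity].
    - rewrite <- IH by lia; ring. }
replace (_ - _)%C with (mean N (fun j => T j * Cconj (zeta N j) ^ m)%C) by ring.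
apply Cmod_mean; [lia|]; intros j.
rewrite Cmod_mult, Cmod_pow, Cmod_conj, Cmod_zeta, pow1, Rmult_1_r.
assert (Ha : absC (fun k => d (N + k)%nat * (r * zeta N j) ^ (N + k))%C).
{ apply (absC_shift (fun k => d k * (r * zeta N j) ^ k)%C N), psabs_absC with r; auto. }
eapply Rle_trans; [apply Cmod_Csum, Ha|].
right; apply Series_ext; intros k.
rewrite Cmod_mult, Cmod_pow, Cmod_mult, Cmod_zeta, Cmod_R, Rabs_pos_eq, Rmult_1_r; auto.
Qed.

Lemma Series_tail_lim (u : nat -> R) eps :
  0 < eps -> ex_series u ->
  exists N0, forall N, (N0 <= N)%nat -> Rabs (Series (fun k => u (N + k)%nat)) < eps.
Proof.
intros He Hu; assert (H := Hu).
apply Series_correct, is_series_rsum, is_lim_seq_spec in H.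
destruct (H (mkposreal _ He)) as [N0 HN0]; exists N0; intros N HN.
specialize (HN0 N HN); simpl in HN0; rewrite (Series_split u N Hu) in HN0.
rewrite <- Rabs_Ropp; replace (- _) with (rsum u N - (rsum u N + Series (fun k => u (N + k)%nat))) by ring.
exact HN0.
Qed.

Lemma mean_psum_lim (d : nat -> C) r eps :
  0 <= r -> psabs d r -> 0 < eps ->
  exists N0, forall N, (N0 <= N)%nat -> (0 < N)%nat ->
    Cmod (mean N (fun j => psum d (r * zeta N j)%C) - d O)%C < eps.
Proof.
intros Hr Hd He.
destruct (Series_tail_lim _ eps He Hd) as [N0 HN0]; exists N0; intros N HN HN'.
eapply Rle_lt_trans; [|apply (HN0 N HN)]; eapply Rle_trans; [|apply Rle_abs].
eapply Rle_trans; [|apply (dft_psum N d r O); auto].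
right; f_equal; unfold dft; simpl; f_equal; [|ring].
apply mean_ext; intros; ring.
Qed.

(** The discrete inequality for large [N]. The bound [B] is required only asymptotically because it
    will be the limit of a mean, not a bound at each point. *)
Lemma bessel (d : nat -> C) r B :
  0 <= r -> psabs d r ->
  (forall eps, 0 < eps -> exists N0, forall N, (N0 <= N)%nat -> (0 < N)%nat ->
     rsum (fun j => Cmod (psum d (r * zeta N j)%C) ^ 2) N / INR N <= B + eps) ->
  forall L, rsum (fun m => (Cmod (d m) * r ^ m) ^ 2) L <= B.
Proof.
intros Hr Hd HB L; apply le_epsilon; intros eps He.
set (x := fun m => Cmod (d m) * r ^ m) in *.
assert (Hx : forall m, 0 <= x m)
  by (intros; apply Rmult_le_pos; [apply Cmod_ge_0|apply pow_le; auto]).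
set (S0 := rsum x L).
assert (HS : 0 <= S0) by (apply rsum_ge0; auto).
assert (He2 : 0 < eps / 2) by lra.
(* With the tail [t] below this value, the error [2 t S0] caused by squaring stays under
   [eps / 2]. *)
assert (He3 : 0 < eps / (4 * (S0 + 1))) by (apply Rdiv_lt_0_compat; lra).
destruct (HB _ He2) as [N1 HN1].
destruct (Series_tail_lim _ _ He3 Hd) as [N2 HN2].
set (N := S (max L (max N1 N2))).
specialize (HN1 N ltac:(unfold N; lia) ltac:(unfold N; lia)).
specialize (HN2 N ltac:(unfold N; lia)).
set (t := Series _) in HN2.
assert (Ht : 0 <= t).
{ apply Series_ge0; [intros; apply Hx|].
  apply (ex_series_incr_n x N); exact Hd. }
rewrite Rabs_pos_eq in HN2 by auto.
set (g := fun j => psum d (r * zeta N j)%C).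
change (rsum (fun j => Cmod (g j) ^ 2) N / INR N <= B + eps / 2) in HN1.
assert (HA := dft_bessel N g L ltac:(unfold N; lia) ltac:(unfold N; lia)).
(* If [t <= x m], this is the square of [x m - t <= |dft|]; otherwise the left side is at most 0. *)
assert (Hm : forall m, (m < L)%nat -> x m ^ 2 + (-2 * t) * x m <= Cmod (dft N g m) ^ 2).
{ intros m Hm.
  assert (D := dft_psum N d r m Hr Hd ltac:(unfold N; lia)); fold g in D; fold t in D.
  assert (T : x m <= Cmod (dft N g m) + t).
  { replace (x m) with (Cmod (d m * RtoC r ^ m)%C)
      by (unfold x; rewrite Cmod_mult, Cmod_pow, Cmod_R, Rabs_pos_eq; auto).
    replace (d m * RtoC r ^ m)%C with (dft N g m + - (dft N g m - d m * RtoC r ^ m))%C by ring.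
    eapply Rle_trans; [apply Cmod_triangle|]; rewrite Cmod_opp; lra. }
  generalize (Cmod_ge_0 (dft N g m)) (Hx m); intros.
  destruct (Rle_dec t (x m)); nra. }
apply rsum_le in Hm; rewrite rsum_plus, rsum_scal in Hm.
change (rsum (fun m => x m) L) with S0 in Hm.
assert (2 * t * S0 <= eps / 2).
{ apply Rle_trans with (2 * (eps / (4 * (S0 + 1))) * (S0 + 1)); [|right; field; lra].
  apply Rmult_le_compat; try lra. }
change (rsum (fun m => x m ^ 2) L <= B + eps); fold S0 in Hm; lra.
Qed.

Lemma bessel_bounded (d : nat -> C) r M :
  0 <= r -> psabs d r -> (forall z, Cmod z = r -> Cmod (psum d z) <= M) ->
  forall L, rsum (fun m => (Cmod (d m) * r ^ m) ^ 2) L <= M ^ 2.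
Proof.
intros Hr Hd HM; apply bessel; auto; intros eps He; exists O; intros N _ HN.
assert (HN' : 0 < INR N) by (apply lt_0_INR; auto).
apply Rle_trans with (M ^ 2); [|lra].
apply Rmult_le_reg_r with (INR N); auto; unfold Rdiv; rewrite Rmult_assoc, Rinv_l, Rmult_1_r by lra.
rewrite Rmult_comm, <- rsum_const; apply rsum_le; intros j _; apply pow_incr.
split; [apply Cmod_ge_0|apply HM].
rewrite Cmod_mult, Cmod_zeta, Cmod_R, Rabs_pos_eq; lra.
Qed.

(** A single term of the Bessel sum. *)
Lemma cauchy_estimate (d : nat -> C) r M m :
  0 <= r -> psabs d r -> (forall z, Cmod z = r -> Cmod (psum d z) <= M) ->
  Cmod (d m) * r ^ m <= M.
Proof.
intros Hr Hd HM.
assert (B := bessel_bounded d r M Hr Hd HM (S m)).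
assert (0 <= M).
{ eapply Rle_trans; [apply Cmod_ge_0|apply (HM (RtoC r))].
  rewrite Cmod_R, Rabs_pos_eq; auto. }
assert (T := rsum_term_le (fun m => (Cmod (d m) * r ^ m) ^ 2) (S m) m
  ltac:(intros; apply pow2_ge_0) ltac:(lia)); simpl in T, B.
apply Rsqr_incr_0_var; auto; unfold Rsqr; lra.
Qed.

Lemma psum_eq0 (d : nat -> C) r m :
  0 < r -> psabs d r -> (forall z, Cmod z = r -> psum d z = 0%C) -> d m = 0%C.
Proof.
intros Hr Hd H; apply Cmod_eq_0.
assert (E := cauchy_estimate d r 0 m ltac:(lra) Hd
  ltac:(intros z Hz; rewrite H, Cmod_0; auto; lra)).
assert (0 < r ^ m) by (apply pow_lt; auto).
generalize (Cmod_ge_0 (d m)); nra.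
Qed.

Lemma exp_at_unique f z0 a b r s :
  0 < r -> 0 < s -> exp_at f z0 a r -> exp_at f z0 b s -> forall n, a n = b n.
Proof.
intros Hr Hs [A1 A2] [B1 B2] n.
set (t := Rmin r s / 2).
assert (Ht : 0 < t < Rmin r s) by (unfold t; assert (0 < Rmin r s) by (apply Rmin_pos; auto); lra).
assert (t < r /\ t < s) as [Htr Hts]
  by (generalize (Rmin_l r s) (Rmin_r r s); split; lra).
assert (Ha := A1 t ltac:(lra)); assert (Hb := B1 t ltac:(lra)).
cut (a n + (-1) * b n = 0)%C.
{ intros E; replace (a n) with (a n + (-1) * b n + b n)%C by ring; rewrite E; ring. }
apply (psum_eq0 (fun n => a n + (-1) * b n)%C t); [lra| |].
- apply ex_series_dom with (fun n => Cmod (a n) * t ^ n + Cmod (b n) * t ^ n).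
  + intros k; assert (0 <= t ^ k) by (apply pow_le; lra); split.
    * apply Rmult_le_pos; auto; apply Cmod_ge_0.
    * rewrite <- Rmult_plus_distr_r; apply Rmult_le_compat_r; auto.
      eapply Rle_trans; [apply Cmod_triangle|].
      rewrite Cmod_mult; replace (Cmod (-1)) with 1; [lra|].
      rewrite Cmod_R, Rabs_left; lra.
  + apply (ex_series_plus (fun n => Cmod (a n) * t ^ n) (fun n => Cmod (b n) * t ^ n)); auto.
- intros z Hz; unfold psum.
  rewrite (Csum_ext _ (fun n => a n * z ^ n + (-1) * (b n * z ^ n))%C) by (intros; ring).
  assert (absC (fun n => a n * z ^ n)%C) by (apply psabs_absC with t; auto; lra).
  assert (absC (fun n => b n * z ^ n)%C) by (apply psabs_absC with t; auto; lra).
  rewrite Csum_plus, Csum_scal; auto using absC_scal.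
  fold (psum a z) (psum b z); rewrite <- A2, <- B2 by lra; ring.
Qed.

Lemma le_of_left_limit (F : R -> R) x M :
  0 < x -> continuity_pt F x -> (forall r, 0 < r < x -> F r <= M) -> F x <= M.
Proof.
intros Hx HF H; apply le_epsilon; intros eps He.
destruct (HF eps He) as [del [Hdel HF']].
set (r := Rmax (x / 2) (x - del / 2)).
assert (Hr : x / 2 <= r < x /\ x - del / 2 <= r).
{ unfold r; split; [split|]; [apply Rmax_l|apply Rmax_lub_lt; lra|apply Rmax_r]. }
specialize (HF' r); simpl in HF'; unfold R_dist in HF'.
assert (D : Rabs (F r - F x) < eps).
{ apply HF'; split; [split; [exact I|lra]|].
  rewrite Rabs_left; lra. }
apply Rabs_def2 in D; specialize (H r ltac:(lra)); lra.
Qed.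

Lemma cauchy_estimate_open (d : nat -> C) rho M m :
  0 < rho -> (forall r, 0 <= r < rho -> psabs d r) ->
  (forall z, Cmod z < rho -> Cmod (psum d z) <= M) ->
  Cmod (d m) * rho ^ m <= M.
Proof.
intros Hr Hd HM.
apply (le_of_left_limit (fun r => Cmod (d m) * r ^ m)); auto.
- apply derivable_continuous_pt; reg.
- intros r Hr'; apply cauchy_estimate; [lra|apply Hd; lra|].
  intros z Hz; apply HM; lra.
Qed.

(** * Taylor shifts and global expansions *)

(** The value 0 for [k > n] turns binomial expansions into full double series indexed by all
    pairs. *)
Fixpoint bin (n k : nat) : nat :=
  match n, k with
  | _, O => 1%nat
  | O, S _ => 0%nat
  | S n', S k' => (bin n' k' + bin n' k)%nat
  end.

Lemma bin_gt n k : (n < k)%nat -> bin n k = 0%nat.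
Proof.
revert k; induction n as [|n IH]; intros [|k] H; simpl; try lia.
rewrite !IH by lia; reflexivity.
Qed.

Lemma binomial_C (x y : C) n :
  csum (fun k => RtoC (INR (bin n k)) * x ^ (n - k) * y ^ k)%C (S n) = ((x + y) ^ n)%C.
Proof.
induction n as [|n IH]; [simpl; ring|].
rewrite csum_shift, Cpow_S, Cmult_plus_distr_r.
rewrite (csum_ext _ (fun k => y * (RtoC (INR (bin n k)) * x ^ (n - k) * y ^ k)
   + RtoC (INR (bin n (S k))) * x ^ (n - k) * y ^ (S k))%C).
2:{ intros k Hk; simpl bin; rewrite plus_INR, RtoC_plus, Nat.sub_succ, Cpow_S; ring. }
rewrite csum_plus, csum_scal, IH.
set (F := fun k => (RtoC (INR (bin n k)) * x ^ (S n - k) * y ^ k)%C).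
assert (E : (csum F (S (S n)) = x * (x + y) ^ n)%C).
{ rewrite <- IH, <- csum_scal.
  change (csum F (S (S n))) with (csum F (S n) + F (S n))%C.
  unfold F at 2; rewrite bin_gt by lia; rewrite (csum_ext F (fun k => x * (RtoC (INR (bin n k)) * x ^ (n - k) * y ^ k))%C (S n)).
  - simpl (INR 0); rewrite !Cmult_0_l, Cplus_0_r; reflexivity.
  - intros k Hk; unfold F; replace (S n - k)%nat with (S (n - k)) by lia.
    rewrite Cpow_S; ring. }
rewrite <- E, (csum_shift F (S n)); unfold F; simpl (bin (S n) 0).
rewrite (csum_ext (fun k => RtoC (INR (bin n (S k))) * x ^ (n - k) * y ^ S k)%C
   (fun k => RtoC (INR (bin n (S k))) * x ^ (S n - S k) * y ^ S k)%C) by (intros; reflexivity).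
assert (Eb : bin n 0 = 1%nat) by (destruct n; reflexivity).
rewrite Eb; ring.
Qed.

Lemma binomial_R (x y : R) n :
  rsum (fun k => INR (bin n k) * x ^ (n - k) * y ^ k) (S n) = (x + y) ^ n.
Proof.
apply RtoC_inj; rewrite RtoC_pow, RtoC_plus, <- binomial_C, <- csum_RtoC.
apply csum_ext; intros k _; rewrite !RtoC_mult, !RtoC_pow; reflexivity.
Qed.

(** The Taylor coefficient [f^(k)(h0) / k!] of the sum of the series: expand each [(h0 + h)^n] and
    collect [h^k]. *)
Definition shift (a : nat -> C) (h0 : C) (k : nat) : C :=
  Csum (fun n => RtoC (INR (bin (n + k) k)) * a (n + k)%nat * h0 ^ n)%C.

Section Shift.
Variables (a : nat -> C) (h0 : C) (rho s : R).
Hypothesis Ha : psabs a s.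
Hypothesis Hrho : 0 < rho.
Hypothesis Hs : Cmod h0 + rho <= s.

Let term (h : C) (n k : nat) : C := (RtoC (INR (bin n k)) * a n * h0 ^ (n - k) * h ^ k)%C.

Let term_row h n : absC (term h n).
Proof.
apply (absC_finite (term h n) (S n)); intros k Hk; unfold term.
rewrite bin_gt by lia; simpl (INR 0); ring.
Qed.

Let term_row_sum h n : Csum (term h n) = (a n * (h0 + h) ^ n)%C.
Proof.
rewrite (Csum_finite _ (S n)).
- rewrite <- binomial_C, <- csum_scal; apply csum_ext; intros; unfold term; ring.
- intros k Hk; unfold term; rewrite bin_gt by lia; simpl (INR 0); ring.
Qed.

Let term_row_abs h n :
  Series (fun k => Cmod (term h n k)) = Cmod (a n) * (Cmod h0 + Cmod h) ^ n.
Proof.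
assert (E : forall k, Cmod (term h n k) =
  Cmod (a n) * (INR (bin n k) * Cmod h0 ^ (n - k) * Cmod h ^ k)).
{ intros k; unfold term; rewrite !Cmod_mult, !Cmod_pow, Cmod_R, Rabs_pos_eq by apply pos_INR; ring. }
rewrite (Series_ext _ _ E), Series_scal_l; f_equal.
rewrite <- binomial_R; apply is_series_unique, Series_finite.
intros k Hk; rewrite bin_gt by lia; simpl (INR 0); ring.
Qed.

Let term_sum h : Cmod h <= rho -> ex_series (fun n => Series (fun k => Cmod (term h n k))).
Proof.
intros Hh; apply ex_series_dom with (fun n => Cmod (a n) * s ^ n); [|exact Ha].
intros n; rewrite term_row_abs; generalize (Cmod_ge_0 h0) (Cmod_ge_0 h) (Cmod_ge_0 (a n)); intros.
split; [apply Rmult_le_pos; auto; apply pow_le; lra|].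
apply Rmult_le_compat_l; auto; apply pow_incr; lra.
Qed.

(** The double series is evaluated at the positive number [rho], so that its columns can be divided
    by [rho^k]. *)
Lemma shift_abs k : absC (fun n => RtoC (INR (bin (n + k) k)) * a (n + k)%nat * h0 ^ n)%C.
Proof.
assert (Hr : Cmod (RtoC rho) <= rho) by (rewrite Cmod_R, Rabs_pos_eq; lra).
destruct (fubini_C (term rho) (term_row rho) (term_sum rho Hr)) as [H _].
specialize (H k); apply (absC_shift _ k) in H.
assert (Hk : (RtoC rho ^ k)%C <> 0%C).
{ apply Cpow_nz; intros E; apply RtoC_inj in E; lra. }
apply absC_ext with (fun n => / RtoC rho ^ k * term rho (k + n) k)%C; [|apply absC_scal, H].
intros n; unfold term; replace (k + n - k)%nat with n by lia.
rewrite (Nat.add_comm n k); field; exact Hk.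
Qed.

Let term_col h k : Csum (fun n => term h n k) = (shift a h0 k * h ^ k)%C.
Proof.
assert (E : forall n, (h ^ k * (RtoC (INR (bin (n + k) k)) * a (n + k)%nat * h0 ^ n))%C
   = term h (k + n) k).
{ intros n; unfold term; replace (k + n - k)%nat with n by lia.
  rewrite (Nat.add_comm n k); ring. }
rewrite (Csum_split _ k).
- rewrite csum_eq0.
  + rewrite <- (Csum_ext _ _ E), Csum_scal by apply shift_abs; unfold shift; ring.
  + intros n Hn; unfold term; rewrite bin_gt by lia; simpl (INR 0); ring.
- apply (absC_shift _ k).
  apply absC_ext with (1 := E), absC_scal, shift_abs.
Qed.

Lemma psabs_shift : psabs (shift a h0) rho.
Proof.
assert (Hr : Cmod (RtoC rho) <= rho) by (rewrite Cmod_R, Rabs_pos_eq; lra).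
destruct (fubini_C (term rho) (term_row rho) (term_sum rho Hr)) as (_ & _ & H & _).
refine (ex_series_ext _ _ _ H); intros k.
rewrite term_col, Cmod_mult, Cmod_pow, Cmod_R, Rabs_pos_eq; [reflexivity|lra].
Qed.

Lemma psum_shift h : Cmod h <= rho -> psum a (h0 + h)%C = psum (shift a h0) h.
Proof.
intros Hh.
destruct (fubini_C (term h) (term_row h) (term_sum h Hh)) as (_ & _ & _ & _ & H).
unfold psum; rewrite <- (Csum_ext _ _ (term_row_sum h)), <- H.
apply Csum_ext; intros k; apply term_col.
Qed.
End Shift.

Lemma exp_at_shift f z0 a rho h0 :
  Cmod h0 < rho -> exp_at f z0 a rho ->
  exp_at f (z0 + h0)%C (shift a h0) (rho - Cmod h0).
Proof.
intros Hh [H1 H2]; generalize (Cmod_ge_0 h0); intros Hh0; split.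
- intros r Hr.
  set (t := (r + (rho - Cmod h0)) / 2).
  apply psabs_le with t; [unfold t; lra|].
  apply psabs_shift with (Cmod h0 + t); try (unfold t; lra).
  apply H1; unfold t; lra.
- intros h Hr; rewrite <- Cplus_assoc, H2.
  + generalize (Cmod_ge_0 h); intros Hh1.
    set (t := (Cmod h + (rho - Cmod h0)) / 2).
    apply psum_shift with t (Cmod h0 + t); try (unfold t; lra).
    apply H1; unfold t; lra.
  + eapply Rle_lt_trans; [apply Cmod_triangle|lra].
Qed.

Lemma has_expansion_analytic f a z : has_expansion f a -> in_disk z -> analytic_at f z.
Proof.
intros H Hz; apply analytic_at_exp_at.
apply has_expansion_exp_at in H; unfold in_disk in Hz.
exists (shift a z), (1 - Cmod z); split; [lra|].
rewrite <- (Cplus_0_l z) at 1; apply exp_at_shift; auto.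
Qed.

(** Compactness is applied on a square that sticks out of the closed disc of radius [rho]. A centre
    outside this disc gets a radius too small to reach it, so points of the disc are only covered
    from centres inside. *)
Lemma uniform_radius f rho :
  rho < 1 -> (forall z, in_disk z -> analytic_at f z) ->
  exists d, 0 < d /\ forall z, Cmod z <= rho -> exists a, exp_at f z a d.
Proof.
intros Hrho Hf.
assert (HC : forall w : C, exists r : posreal,
   (* A point covered from [w] lies in a square of half-side [r], hence within [2 r] of [w]; an
      expansion of radius [4 r] leaves it a radius of at least [2 r]. *)
   (Cmod w <= rho -> exists a, exp_at f w a (4 * r)) /\ (rho < Cmod w -> 2 * r <= Cmod w - rho)).
{ intros w; destruct (Rle_lt_dec (Cmod w) rho) as [Hw|Hw].
  - destruct (proj1 (analytic_at_exp_at f w) (Hf w ltac:(unfold in_disk; lra)))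
      as (a & r & Hr & Ha).
    assert (Hr4 : 0 < r / 4) by lra.
    exists (mkposreal _ Hr4); split; [|lra]; intros _; exists a; simpl.
    replace (4 * (r / 4)) with r by field; exact Ha.
  - assert (Hr : 0 < (Cmod w - rho) / 2) by lra.
    exists (mkposreal _ Hr); simpl; split; lra. }
set (del := fun x y => proj1_sig (constructive_indefinite_description _ (HC (x, y)))).
destruct (compactness_value_2d (- rho) rho (- rho) rho del) as [d Hd].
exists d; split; [apply cond_pos|]; intros z Hz.
apply NNPP; intros Hno.
apply (Hd (fst z) (snd z)).
- apply Rabs_le_between; eapply Rle_trans; [apply re_le_Cmod|exact Hz].
- apply Rabs_le_between; eapply Rle_trans; [apply im_le_Cmod|exact Hz].
- intros (u & v & _ & _ & Hu & Hv & Hdel); apply Hno.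
  unfold del in *; destruct (constructive_indefinite_description _ (HC (u, v))) as [r [R1 R2]].
  simpl in *.
  assert (Hzw : Cmod (z - (u, v))%C < 2 * r) by (apply Cmod_box; assumption).
  destruct (Rle_lt_dec (Cmod (u, v)) rho) as [Hw|Hw].
  + destruct (R1 Hw) as [a Ha].
    exists (shift a (z - (u, v))%C).
    apply exp_at_le with (4 * r - Cmod (z - (u, v))%C); [generalize (cond_pos r); lra|].
    replace z with ((u, v) + (z - (u, v)))%C at 1 by ring.
    apply exp_at_shift; auto; generalize (cond_pos r); lra.
  + exfalso; specialize (R2 Hw).
    assert (Cmod (u, v) <= Cmod z + Cmod (z - (u, v))%C); [|lra].
    rewrite <- (Cmod_opp (z - (u, v))%C).
    replace (u, v) with (z + - (z - (u, v)))%C at 1 by ring; apply Cmod_triangle.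
Qed.

Lemma rsum_half_pow n : rsum (fun k => (1 / 2) ^ k) n <= 2.
Proof.
cut (rsum (fun k => (1 / 2) ^ k) n = 2 - 2 * (1 / 2) ^ n).
{ assert (0 < (1 / 2) ^ n) by (apply pow_lt; lra); lra. }
induction n as [|n IH]; simpl; [ring|rewrite IH; field].
Qed.

(* The Cauchy estimates on all disks of radius [d] centred in [|z| <= rho], followed by the
   Cauchy estimates for the Taylor coefficients [shift b z k] as functions of the centre [z],
   bound the binomial terms of [b n * (r + d/2)^n]. *)
Lemma exp_at_extend f b rho :
  0 < rho < 1 -> (forall z, in_disk z -> Cmod (f z) <= 1) ->
  (forall z, in_disk z -> analytic_at f z) ->
  exp_at f 0 b rho -> exists rho', rho < rho' /\ exp_at f 0 b rho'.
Proof.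
intros Hrho Hb Hf He.
destruct (uniform_radius f rho (proj2 Hrho) Hf) as (d0 & Hd0 & Hd1).
set (d := Rmin d0 (1 - rho)).
assert (Hd : 0 < d) by (apply Rmin_pos; lra).
assert (Hdr : d <= 1 - rho) by apply Rmin_r.
assert (Hloc : forall z, Cmod z < rho -> exp_at f z (shift b z) d).
{ intros z Hz; destruct (Hd1 z (Rlt_le _ _ Hz)) as [a Ha].
  apply exp_at_le with (r := d) in Ha; [|apply Rmin_l].
  assert (Hs := exp_at_shift f 0 b rho z Hz He); rewrite Cplus_0_l in Hs.
  assert (E := exp_at_unique f z a (shift b z) d (rho - Cmod z) Hd ltac:(lra) Ha Hs).
  destruct Ha as [A1 A2]; split.
  - intros r Hr; refine (ex_series_ext _ _ _ (A1 r Hr)); intros n; rewrite E; reflexivity.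
  - intros h Hh; rewrite A2 by auto; apply Csum_ext; intros n; rewrite E; reflexivity. }
assert (Hcoef : forall z k, Cmod z < rho -> Cmod (shift b z k) * d ^ k <= 1).
{ intros z k Hz; destruct (Hloc z Hz) as [A1 A2].
  apply cauchy_estimate_open; auto; intros h Hh; rewrite <- A2 by auto.
  apply Hb; unfold in_disk; eapply Rle_lt_trans; [apply Cmod_triangle|lra]. }
(* This keeps [r < rho] while [r + d / 2 >= rho + d / 4], so convergence up to [r + d / 2] is a real
   gain. *)
set (r := rho - Rmin (d / 4) (rho / 2)).
assert (Hmin : 0 < Rmin (d / 4) (rho / 2)) by (apply Rmin_pos; lra).
assert (Hr : 0 < r < rho).
{ generalize (Rmin_r (d / 4) (rho / 2)); unfold r; lra. }
assert (Hrd : rho + d / 4 <= r + d / 2).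
{ generalize (Rmin_l (d / 4) (rho / 2)); unfold r; lra. }
assert (Hbin : forall n k, (k <= n)%nat ->
   INR (bin n k) * Cmod (b n) * r ^ (n - k) * d ^ k <= 1).
{ intros n k Hk.
  set (c := fun n => (RtoC (INR (bin (n + k) k)) * b (n + k)%nat)%C).
  assert (Hc : Cmod (c (n - k)%nat) * r ^ (n - k) <= / d ^ k).
  { apply cauchy_estimate; [lra| |].
    - assert (Ha : absC (fun n => RtoC (INR (bin (n + k) k)) * b (n + k)%nat * RtoC r ^ n)%C).
      { apply (shift_abs b (RtoC r) ((rho - r) / 2) (r + (rho - r) / 2)).
        - apply He; lra.
        - lra.
        - rewrite Cmod_R, Rabs_pos_eq; lra. }
      refine (ex_series_ext _ _ _ Ha); intros j; cbv beta.
      rewrite Cmod_mult, Cmod_pow, Cmod_R, Rabs_pos_eq; [reflexivity|lra].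
    - intros z Hz; change (psum c z) with (shift b z k).
      apply Rmult_le_reg_r with (d ^ k); [apply pow_lt; auto|].
      rewrite Rinv_l by (apply pow_nonzero; lra); apply Hcoef; lra. }
  unfold c in Hc; replace (n - k + k)%nat with n in Hc by lia.
  rewrite Cmod_mult, Cmod_R, Rabs_pos_eq in Hc by apply pos_INR.
  assert (0 < d ^ k) by (apply pow_lt; auto).
  apply Rmult_le_reg_r with (/ d ^ k); [apply Rinv_0_lt_compat; auto|].
  rewrite Rmult_assoc, Rinv_r, Rmult_1_r, Rmult_1_l by lra; exact Hc. }
(* The binomial terms with step [d] are at most 1; halving the step inserts the factors [(1/2)^k],
   whose sum is at most 2. *)
assert (Hbn : forall n, Cmod (b n) * (r + d / 2) ^ n <= 2).
{ intros n; rewrite <- binomial_R, <- rsum_scal.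
  eapply Rle_trans; [|apply (rsum_half_pow (S n))]; apply rsum_le; intros k Hk.
  replace (Cmod (b n) * (INR (bin n k) * r ^ (n - k) * (d / 2) ^ k))
    with (INR (bin n k) * Cmod (b n) * r ^ (n - k) * d ^ k * (1 / 2) ^ k).
  - rewrite <- (Rmult_1_l ((1 / 2) ^ k)) at 2.
    apply Rmult_le_compat_r; [apply pow_le; lra|apply Hbin; lia].
  - replace (d / 2) with (d * (1 / 2)) by field; rewrite (Rpow_mult_distr d); ring. }
assert (Hps : forall t, 0 <= t < r + d / 2 -> psabs b t)
  by (intros t Ht; apply psabs_of_bound with (r + d / 2) 2; auto).
exists (r + d / 2); split; [lra|]; split; [exact Hps|].
intros z Hz; destruct (Rlt_le_dec (Cmod z) rho) as [Hlt|Hge]; [apply He, Hlt|].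
(* Beyond the old disc, [f z] is read from the local expansion at [z0], the point of modulus [r] on
   the ray through [z], which lies within [d / 2] of [z]. *)
set (z0 := (RtoC (r / Cmod z) * z)%C).
assert (Hz0 : Cmod z0 = r).
{ unfold z0; rewrite Cmod_mult, Cmod_R, Rabs_pos_eq; [field; lra|apply Rdiv_le_0_compat; lra]. }
assert (Hzz : Cmod (z - z0)%C = Cmod z - r).
{ replace (z - z0)%C with (RtoC (1 - r / Cmod z) * z)%C by (unfold z0; rewrite RtoC_minus; ring).
  rewrite Cmod_mult, Cmod_R, Rabs_pos_eq; [field; lra|].
  assert (r / Cmod z <= 1); [|lra].
  apply Rmult_le_reg_r with (Cmod z); [lra|]; unfold Rdiv; rewrite Rmult_assoc, Rinv_l; lra. }
rewrite Cplus_0_l; replace z with (z0 + (z - z0))%C by ring.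
rewrite (psum_shift b z0 (Cmod z - r) (Cmod z)); try lra.
- apply Hloc; lra.
- apply Hps; lra.
Qed.

(** The coefficients are those of the germ at 0. The supremum of the radii up to 1 on which they
    represent [f] is attained, and [exp_at_extend] rules out a value below 1. *)
Lemma disk_expansion f :
  (forall z, in_disk z -> Cmod (f z) <= 1) -> (forall z, in_disk z -> analytic_at f z) ->
  exists b, has_expansion f b.
Proof.
intros Hb Hf.
destruct (proj1 (analytic_at_exp_at f 0) (Hf 0%C in_disk_0))
  as (b & r0 & Hr0 & He0).
exists b; apply has_expansion_exp_at.
set (P := fun rho => 0 < rho <= 1 /\ exp_at f 0 b rho).
assert (HP : P (Rmin r0 1)).
{ split; [split; [apply Rmin_pos; lra|apply Rmin_r]|].
  apply exp_at_le with r0; auto; apply Rmin_l. }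
destruct (completeness P) as [m [Hm1 Hm2]].
{ exists 1; intros x [Hx _]; lra. }
{ eexists; apply HP. }
assert (Hm0 : 0 < m) by (destruct HP as [[HP1 _] HP2]; eapply Rlt_le_trans; [apply HP1|apply Hm1; split; auto; split; auto; apply Rmin_r]).
assert (Hm : exp_at f 0 b m).
{ assert (Hex : forall t, t < m -> exists rho, t < rho /\ exp_at f 0 b rho).
  { intros t Ht; apply NNPP; intros Hno.
    apply (Rlt_not_le _ _ Ht), Hm2; intros x [Hx1 Hx2].
    apply Rnot_lt_le; intros Hlt; apply Hno; exists x; auto. }
  split.
  - intros t [Ht0 Ht]; destruct (Hex t Ht) as (x & Hx & [X1 _]); apply X1; lra.
  - intros h Hh; destruct (Hex _ Hh) as (x & Hx & [_ X2]); apply X2; lra. }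
assert (Hm3 : m <= 1) by (apply Hm2; intros x [Hx _]; lra).
destruct (Rle_lt_or_eq_dec _ _ Hm3) as [Hlt|Heq]; [exfalso|rewrite Heq in Hm; exact Hm].
destruct (exp_at_extend f b m (conj Hm0 Hlt) Hb Hf Hm) as (m' & Hm' & He').
assert (Rmin m' 1 <= m).
{ apply Hm1; split; [split; [apply Rmin_pos; lra|apply Rmin_r]|].
  apply exp_at_le with m'; auto; apply Rmin_l. }
assert (m < Rmin m' 1) by (apply Rmin_glb_lt; lra).
lra.
Qed.

(** * Products, powers and composition of expansions *)

Definition conv (a b : nat -> C) (k : nat) : C :=
  csum (fun i => a i * b (k - i)%nat)%C (S k).

(** Exchange of summation: row [n] of [u] carries the second series shifted by [n], so that columns
    collect equal powers of [z]. *)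
Lemma conv_psum_aux a b r z :
  psabs a r -> psabs b r -> Cmod z <= r ->
  absC (fun k => conv a b k * z ^ k)%C /\ psum (conv a b) z = (psum a z * psum b z)%C.
Proof.
intros Ha Hb Hz.
assert (Ha' := psabs_absC a r z Ha Hz); assert (Hb' := psabs_absC b r z Hb Hz).
set (u := fun n k : nat => if le_dec n k then ((a n * z ^ n) * (b (k - n)%nat * z ^ (k - n)))%C else 0%C).
assert (U1 : forall n k, (k < n)%nat -> u n k = 0%C)
  by (intros n k H; unfold u; destruct (le_dec n k); [lia|reflexivity]).
assert (U2 : forall n j, u n (n + j)%nat = ((a n * z ^ n) * (b j * z ^ j))%C).
{ intros n j; unfold u; destruct (le_dec n (n + j)); [|lia].
  replace (n + j - n)%nat with j by lia; reflexivity. }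
assert (Hrow : forall n, absC (u n)).
{ intros n; apply (absC_shift (u n) n), absC_ext with (fun j => (a n * z ^ n) * (b j * z ^ j))%C.
  - intros j; symmetry; apply U2.
  - apply absC_scal, Hb'. }
assert (Hrowsum : forall n, Csum (u n) = ((a n * z ^ n) * psum b z)%C).
{ intros n; rewrite (Csum_split _ n), csum_eq0 by auto.
  rewrite (Csum_ext _ _ (U2 n)), Csum_scal by exact Hb'; unfold psum; ring. }
assert (Hrowabs : forall n, Series (fun k => Cmod (u n k)) =
   Series (fun j => Cmod (b j * z ^ j)%C) * Cmod (a n * z ^ n)%C).
{ intros n; rewrite (Series_split _ n) by apply Hrow.
  rewrite rsum_eq0, Rplus_0_l.
  - rewrite Rmult_comm, <- Series_scal_l; apply Series_ext; intros j; rewrite U2; apply Cmod_mult.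
  - intros k Hk; rewrite U1, Cmod_0; auto. }
assert (Hsum : ex_series (fun n => Series (fun k => Cmod (u n k)))).
{ refine (ex_series_ext _ _ (fun n => eq_sym (Hrowabs n)) _); apply ex_series_scal, Ha'. }
assert (Hcol : forall k, Csum (fun n => u n k) = (conv a b k * z ^ k)%C).
{ intros k; rewrite (Csum_finite _ (S k)) by (intros; apply U1; lia).
  unfold conv; rewrite Cmult_comm, <- csum_scal; apply csum_ext; intros n Hn.
  unfold u; destruct (le_dec n k); [|lia].
  replace (z ^ k)%C with (z ^ n * z ^ (k - n))%C by (rewrite <- Cpow_add_r; f_equal; lia); ring. }
destruct (fubini_C u Hrow Hsum) as (_ & _ & H1 & _ & H2); split.
- exact (absC_ext _ _ Hcol H1).
- unfold psum at 1; rewrite <- (Csum_ext _ _ Hcol), H2, (Csum_ext _ _ Hrowsum).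
  rewrite (Csum_ext _ (fun n => psum b z * (a n * z ^ n))%C) by (intros; ring).
  rewrite Csum_scal by exact Ha'; unfold psum at 2; apply Cmult_comm.
Qed.

Lemma psabs_conv a b r : 0 <= r -> psabs a r -> psabs b r -> psabs (conv a b) r.
Proof.
intros Hr Ha Hb.
destruct (conv_psum_aux a b r (RtoC r) Ha Hb) as [H _]; [rewrite Cmod_R, Rabs_pos_eq; lra|].
refine (ex_series_ext _ _ _ H); intros k; cbv beta.
rewrite Cmod_mult, Cmod_pow, Cmod_R, Rabs_pos_eq; auto.
Qed.

Fixpoint cpow (b : nat -> C) (n : nat) : nat -> C :=
  match n with
  | O => fun k => match k with O => 1%C | S _ => 0%C end
  | S n' => conv b (cpow b n')
  end.

Lemma psabs_cpow b n r : 0 <= r -> psabs b r -> psabs (cpow b n) r.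
Proof.
intros Hr Hb; induction n as [|n IH]; [|apply psabs_conv; auto].
exists (rsum (fun k => Cmod (cpow b 0 k) * r ^ k) 1); apply Series_finite.
intros [|k] Hk; [lia|]; simpl; rewrite Cmod_0; ring.
Qed.

Lemma psum_cpow b n r z :
  psabs b r -> Cmod z <= r -> psum (cpow b n) z = (psum b z ^ n)%C.
Proof.
intros Hb Hz; assert (Hr : 0 <= r) by (generalize (Cmod_ge_0 z); lra).
induction n as [|n IH].
- unfold psum; rewrite (Csum_finite _ 1); [simpl; ring|].
  intros [|k] Hk; [lia|]; simpl; ring.
- simpl cpow; rewrite Cpow_S, <- IH; apply conv_psum_aux with r; auto using psabs_cpow.
Qed.

Lemma psum_0 a : psum a 0 = a O.
Proof.
unfold psum; rewrite (Csum_finite _ 1); [simpl; ring|].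
intros [|k] Hk; [lia|]; simpl; ring.
Qed.

Definition rconv (a b : nat -> R) (k : nat) : R := rsum (fun i => a i * b (k - i)%nat) (S k).

Fixpoint rpow (a : nat -> R) (n : nat) : nat -> R :=
  match n with
  | O => fun k => match k with O => 1 | S _ => 0 end
  | S n' => rconv a (rpow a n')
  end.

Lemma cpow_RtoC (a : nat -> R) n k : cpow (fun k => RtoC (a k)) n k = RtoC (rpow a n k).
Proof.
revert k; induction n as [|n IH]; intros k; [destruct k; reflexivity|].
simpl cpow; simpl rpow; unfold conv, rconv; rewrite <- csum_RtoC; apply csum_ext.
intros i _; rewrite IH, RtoC_mult; reflexivity.
Qed.

Lemma rconv_ge0 a b k : (forall i, 0 <= a i) -> (forall i, 0 <= b i) -> 0 <= rconv a b k.
Proof. intros Ha Hb; apply rsum_ge0; intros; apply Rmult_le_pos; auto. Qed.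

Lemma rpow_ge0 a n k : (forall i, 0 <= a i) -> 0 <= rpow a n k.
Proof.
intros Ha; revert k; induction n as [|n IH]; intros k; [destruct k; simpl; lra|].
apply rconv_ge0; auto.
Qed.

(** Transported from [cpow]. The real copy of the convolution powers exists for the later
    coefficientwise inequalities between nonnegative sequences. *)
Lemma rpow_series q n r :
  (forall i, 0 <= q i) -> 0 <= r -> ex_series (fun k => q k * r ^ k) ->
  is_series (fun k => rpow q n k * r ^ k) (Series (fun k => q k * r ^ k) ^ n).
Proof.
intros Hq Hr Hex.
assert (Hps : psabs (fun k => RtoC (q k)) r).
{ refine (ex_series_ext _ _ _ Hex); intros k; rewrite Cmod_R, Rabs_pos_eq; auto. }
assert (Hpn : ex_series (fun k => rpow q n k * r ^ k)).
{ refine (ex_series_ext _ _ _ (psabs_cpow _ n r Hr Hps)); intros k.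
  rewrite cpow_RtoC, Cmod_R, Rabs_pos_eq; auto using rpow_ge0. }
replace (Series (fun k => q k * r ^ k) ^ n) with (Series (fun k => rpow q n k * r ^ k)).
{ apply Series_correct, Hpn. }
assert (E : forall w : nat -> R, psum (fun k => RtoC (w k)) (RtoC r) = RtoC (Series (fun k => w k * r ^ k))).
{ intros w; rewrite <- Csum_RtoC; apply Csum_ext; intros k; rewrite RtoC_mult, RtoC_pow; reflexivity. }
apply RtoC_inj; rewrite RtoC_pow, <- !E, <- (psum_cpow _ n r); auto.
- apply Csum_ext; intros k; rewrite cpow_RtoC; reflexivity.
- rewrite Cmod_R, Rabs_pos_eq; lra.
Qed.

Lemma has_expansion_psum f a z : has_expansion f a -> in_disk z -> f z = psum a z.
Proof.
intros H Hz; apply has_expansion_exp_at in H; destruct H as [_ H].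
rewrite <- H by exact Hz; rewrite Cplus_0_l; reflexivity.
Qed.

Lemma has_expansion_abs f a r : has_expansion f a -> 0 <= r < 1 -> psabs a r.
Proof. intros H; apply has_expansion_exp_at in H; apply H. Qed.

Lemma has_expansion_intro f a :
  (forall r, 0 <= r < 1 -> psabs a r) -> (forall z, in_disk z -> f z = psum a z) ->
  has_expansion f a.
Proof.
intros H1 H2; apply has_expansion_exp_at; split; auto.
intros h Hh; rewrite Cplus_0_l; auto.
Qed.

Lemma has_expansion_unique f a b : has_expansion f a -> has_expansion f b -> forall n, a n = b n.
Proof.
intros Ha Hb; apply has_expansion_exp_at in Ha; apply has_expansion_exp_at in Hb.
apply (exp_at_unique f 0 a b 1 1); auto; lra.
Qed.

Lemma has_expansion_ext f g a :
  (forall z, in_disk z -> f z = g z) -> has_expansion f a -> has_expansion g a.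
Proof. intros H Ha z Hz; rewrite <- H by exact Hz; apply Ha, Hz. Qed.

Lemma has_expansion_pow f b n :
  has_expansion f b -> has_expansion (fun z => f z ^ n)%C (cpow b n).
Proof.
intros Hb; apply has_expansion_intro.
- intros r Hr; apply psabs_cpow; [lra|]; apply (has_expansion_abs f); auto.
- intros z Hz; rewrite (psum_cpow b n (Cmod z)); [|apply (has_expansion_abs f); auto; split; [apply Cmod_ge_0|exact Hz]|lra].
  rewrite <- (has_expansion_psum f b); auto.
Qed.

(** The norm [sum |b k| s^k] is submultiplicative under convolution. *)
Lemma cpow_bound b n s th :
  0 <= s -> (forall K, rsum (fun k => Cmod (b k) * s ^ k) K <= th) ->
  forall k, Cmod (cpow b n k) * s ^ k <= th ^ n.
Proof.
intros Hs Hb.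
assert (Hth : 0 <= th) by (apply (Hb O)).
induction n as [|n IH]; intros k.
- destruct k as [|k]; simpl; [rewrite Cmod_1; lra|rewrite Cmod_0; lra].
- simpl cpow; unfold conv.
  apply Rle_trans with (rsum (fun i => th ^ n * (Cmod (b i) * s ^ i)) (S k)).
  + rewrite Rmult_comm; eapply Rle_trans; [apply Rmult_le_compat_l; [apply pow_le; auto|apply Cmod_csum]|].
    rewrite <- rsum_scal; apply rsum_le; intros i Hi.
    rewrite Cmod_mult; replace (s ^ k) with (s ^ i * s ^ (k - i)) by (rewrite <- pow_add; f_equal; lia).
    specialize (IH (k - i)%nat).
    assert (0 <= Cmod (b i) * s ^ i) by (apply Rmult_le_pos; [apply Cmod_ge_0|apply pow_le; auto]).
    nra.
  + rewrite rsum_scal; simpl; rewrite Rmult_comm.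
    apply Rmult_le_compat_r; [apply pow_le; auto|apply (Hb (S k))].
Qed.

Lemma cpow_le1 f b n k :
  has_expansion f b -> (forall z, in_disk z -> Cmod (f z) <= 1) -> Cmod (cpow b n k) <= 1.
Proof.
intros Hb Hf; assert (Hp := has_expansion_pow f b n Hb).
assert (E := cauchy_estimate_open (cpow b n) 1 1 k Rlt_0_1).
rewrite pow1, Rmult_1_r in E; apply E.
- intros r Hr; apply (has_expansion_abs _ _ r Hp Hr).
- intros z Hz; rewrite <- (has_expansion_psum _ _ z Hp Hz), Cmod_pow.
  rewrite <- (pow1 n); apply pow_incr; split; [apply Cmod_ge_0|apply Hf, Hz].
Qed.

Lemma small_radius f b :
  has_expansion f b -> Cmod (f 0%C) < 1 ->
  exists s th, 0 < s < 1 /\ 0 < th < 1 /\ forall K, rsum (fun k => Cmod (b k) * s ^ k) K <= th.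
Proof.
intros Hb H0.
assert (Hb0 : f 0%C = b O).
{ rewrite (has_expansion_psum f b); [apply psum_0|exact Hb|unfold in_disk; rewrite Cmod_0; lra]. }
rewrite Hb0 in H0.
assert (Hh := has_expansion_abs f b (1 / 2) Hb ltac:(lra)).
set (S0 := Series (fun k => Cmod (b k) * (1 / 2) ^ k)).
assert (Hpos : forall k, 0 <= Cmod (b k) * (1 / 2) ^ k)
  by (intros; apply Rmult_le_pos; [apply Cmod_ge_0|apply pow_le; lra]).
assert (HS : 0 <= S0) by (apply Series_ge0; auto).
generalize (Cmod_ge_0 (b O)); intros Hb1.
(* The nonconstant terms contribute at most [2 s S0], which this choice makes at most half of the
   gap [1 - |b 0|]. *)
set (s := Rmin (1 / 2) ((1 - Cmod (b O)) / (4 * (S0 + 1)))).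
assert (Hs : 0 < s).
{ apply Rmin_pos; [lra|]; apply Rdiv_lt_0_compat; lra. }
assert (Hs2 : s <= 1 / 2) by apply Rmin_l.
assert (Hs3 : 4 * s * (S0 + 1) <= 1 - Cmod (b O)).
{ apply Rle_trans with (4 * ((1 - Cmod (b O)) / (4 * (S0 + 1))) * (S0 + 1)); [|right; field; lra].
  apply Rmult_le_compat_r; [lra|]; apply Rmult_le_compat_l; [lra|apply Rmin_r]. }
exists s, ((1 + Cmod (b O)) / 2); split; [lra|]; split; [lra|]; intros K.
assert (T : rsum (fun k => Cmod (b k) * s ^ k) K <= Cmod (b O) + 2 * s * S0); [|nra].
destruct K as [|K]; [simpl; nra|].
rewrite rsum_shift; simpl (s ^ 0); rewrite Rmult_1_r; apply Rplus_le_compat_l.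
apply Rle_trans with (rsum (fun k => 2 * s * (Cmod (b (S k)) * (1 / 2) ^ S k)) K).
- apply rsum_le; intros k _; simpl.
  replace (2 * s * (Cmod (b (S k)) * (1 / 2 * (1 / 2) ^ k)))
    with (Cmod (b (S k)) * (s * (1 / 2) ^ k)) by field.
  apply Rmult_le_compat_l; [apply Cmod_ge_0|]; apply Rmult_le_compat_l; [lra|].
  apply pow_incr; lra.
- rewrite rsum_scal; apply Rmult_le_compat_l; [lra|].
  eapply Rle_trans; [|apply (rsum_le_Series _ (S K)); auto].
  rewrite rsum_shift; generalize (Hpos O); cbv beta; lra.
Qed.

Lemma exp_le_exp x y : x <= y -> exp x <= exp y.
Proof.
intros H; destruct (Rle_lt_or_eq_dec _ _ H) as [Hlt|Heq]; [|rewrite Heq; lra].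
apply Rlt_le, exp_increasing, Hlt.
Qed.

(* Interpolation between [|q| <= 1] and the exponential bound [|q n k| s^k <= th^n]. *)
Lemma cpow_interpolate f b rho :
  has_expansion f b -> (forall z, in_disk z -> in_disk (f z)) -> rho < 1 ->
  exists t th, 0 < t < 1 /\ rho < t /\ 0 < th < 1 /\
    forall n k, Cmod (cpow b n k) * t ^ k <= th ^ n.
Proof.
intros Hb Hf Hrho.
assert (Hf0 : in_disk (f 0%C)) by (apply Hf, in_disk_0).
destruct (small_radius f b Hb Hf0) as (s & th & Hs & Hth & HK).
set (t := Rmax ((1 + rho) / 2) s).
assert (Ht : (1 + rho) / 2 <= t /\ s <= t < 1).
{ unfold t; split; [apply Rmax_l|split; [apply Rmax_r|apply Rmax_lub_lt; lra]]. }
assert (Hls : ln s < 0) by (rewrite <- ln_1; apply ln_increasing; lra).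
assert (Hlt : ln s <= ln t < 0).
{ split; [apply ln_le; lra|rewrite <- ln_1; apply ln_increasing; lra]. }
(* So [t = s^al], and [x t^k <= (x s^k)^al <= th^(al n)], because [x <= 1] and [al <= 1]. *)
set (al := ln t / ln s).
assert (Hal : 0 < al <= 1).
{ split.
  - unfold al; replace (ln t / ln s) with (- ln t / - ln s) by (field; lra).
    apply Rdiv_lt_0_compat; lra.
  - unfold al; apply Rmult_le_reg_r with (- ln s); [lra|].
    replace (ln t / ln s * - ln s) with (- ln t) by (field; lra); lra. }
assert (Hlth : ln th < 0) by (rewrite <- ln_1; apply ln_increasing; lra).
exists t, (exp (al * ln th)); split; [lra|]; split; [lra|]; split.
{ split; [apply exp_pos|]; rewrite <- exp_0; apply exp_increasing; nra. }
intros n k; set (x := Cmod (cpow b n k)).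
assert (Hx1 : x <= 1).
{ apply (cpow_le1 f); auto; intros z Hz; apply Rlt_le, Hf, Hz. }
assert (Hx2 := cpow_bound b n s th ltac:(lra) HK k); fold x in Hx2.
assert (Epow : forall y m, 0 < y -> y ^ m = exp (INR m * ln y)).
{ intros y m Hy; rewrite <- Rpower_pow by auto; reflexivity. }
destruct (Rle_lt_or_eq_dec 0 x (Cmod_ge_0 _)) as [Hx0|Hx0].
- rewrite Epow, (Epow (exp _)), ln_exp by (try apply exp_pos; lra).
  rewrite <- (exp_ln x) at 1 by auto; rewrite <- exp_plus; apply exp_le_exp.
  rewrite Epow, Epow in Hx2 by lra.
  rewrite <- (exp_ln x), <- exp_plus in Hx2 by auto.
  apply Rnot_lt_le; intros Hlt'; apply (Rle_not_lt _ _ Hx2), exp_increasing.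
  assert (Hlx : ln x <= 0) by (rewrite <- ln_1; apply ln_le; lra).
  replace (ln t) with (al * ln s) in Hlt' by (unfold al; field; lra).
  apply Rmult_lt_reg_l with al; [lra|]; nra.
- rewrite <- Hx0, Rmult_0_l; apply pow_le, Rlt_le, exp_pos.
Qed.

Definition comp_coef (b a : nat -> C) (k : nat) : C := Csum (fun n => a n * cpow b n k)%C.

Section Compose.
Variables (f phi : C -> C) (a b : nat -> C).
Hypothesis Ha : has_expansion f a.
Hypothesis Hb : has_expansion phi b.
Hypothesis Hphi : forall z, in_disk z -> in_disk (phi z).

Let term (z : C) (n k : nat) : C := (a n * cpow b n k * z ^ k)%C.

Let term_row z n : in_disk z -> absC (term z n).
Proof.
intros Hz; apply absC_ext with (fun k => a n * (cpow b n k * z ^ k))%C; [intros; unfold term; ring|].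
apply absC_scal, psabs_absC with (Cmod z); [|lra].
apply psabs_cpow; [apply Cmod_ge_0|]; apply (has_expansion_abs phi); auto.
split; [apply Cmod_ge_0|exact Hz].
Qed.

Let term_row_sum z n : in_disk z -> Csum (term z n) = (a n * phi z ^ n)%C.
Proof.
intros Hz; rewrite (has_expansion_psum _ _ z (has_expansion_pow phi b n Hb) Hz).
unfold psum; rewrite <- Csum_scal.
- apply Csum_ext; intros; unfold term; ring.
- apply psabs_absC with (Cmod z); [|lra].
  apply psabs_cpow; [apply Cmod_ge_0|]; apply (has_expansion_abs phi); auto.
  split; [apply Cmod_ge_0|exact Hz].
Qed.

(** [sum |b k| |z|^k] may exceed 1, so its powers do not control the rows. The interpolated bound
    provides decay in [n] at a radius [t] beyond [|z|], and the ratio [|z| / t] makes each row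
    geometric. *)
Let term_sum z : in_disk z -> ex_series (fun n => Series (fun k => Cmod (term z n k))).
Proof.
intros Hz; destruct (cpow_interpolate phi b (Cmod z) Hb Hphi Hz) as (t & th & Ht & Hzt & Hth & HQ).
generalize (Cmod_ge_0 z); intros Hz0.
assert (Hq : 0 <= Cmod z / t < 1).
{ split; [apply Rdiv_le_0_compat; lra|].
  apply Rmult_lt_reg_r with t; [lra|]; unfold Rdiv; rewrite Rmult_assoc, Rinv_l; lra. }
apply ex_series_dom with (fun n => / (1 - Cmod z / t) * (Cmod (a n) * th ^ n)).
- intros n; split; [apply Series_ge0; [intros; apply Cmod_ge_0|apply term_row, Hz]|].
  rewrite <- Series_geom by (rewrite Rabs_pos_eq; lra).
  rewrite Rmult_comm, <- Series_scal_l; apply Series_le.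
  + intros k; split; [apply Cmod_ge_0|]; unfold term.
    rewrite !Cmod_mult, Cmod_pow, Rmult_assoc, Rmult_assoc.
    apply Rmult_le_compat_l; [apply Cmod_ge_0|].
    replace (Cmod (cpow b n k) * Cmod z ^ k)
      with (Cmod (cpow b n k) * t ^ k * (Cmod z / t) ^ k).
    * apply Rmult_le_compat_r; [apply pow_le; lra|apply HQ].
    * rewrite Rmult_assoc, <- Rpow_mult_distr; do 2 f_equal; field; lra.
  + apply ex_series_geom_scal; exact Hq.
- apply ex_series_scal, (has_expansion_abs f); auto; lra.
Qed.

Lemma comp_coef_abs k : absC (fun n => a n * cpow b n k)%C.
Proof.
assert (Hz : in_disk (RtoC (1 / 2))) by (apply in_disk_R; lra).
destruct (fubini_C (term (RtoC (1 / 2)))) as [H _]; auto.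
assert (Hk : (RtoC (1 / 2) ^ k)%C <> 0%C).
{ apply Cpow_nz; intros E; apply RtoC_inj in E; lra. }
apply absC_ext with (fun n => / RtoC (1 / 2) ^ k * term (RtoC (1 / 2)) n k)%C.
- intros n; unfold term; field; exact Hk.
- apply absC_scal, H.
Qed.

Lemma has_expansion_compose : has_expansion (compose phi f) (comp_coef b a).
Proof.
assert (Hcol : forall z k, Csum (fun n => term z n k) = (comp_coef b a k * z ^ k)%C).
{ intros z k; unfold comp_coef; rewrite Cmult_comm, <- Csum_scal by apply comp_coef_abs.
  apply Csum_ext; intros; unfold term; ring. }
apply has_expansion_intro.
- intros r Hr.
  assert (Hz : in_disk (RtoC r)) by (apply in_disk_R; lra).
  destruct (fubini_C (term (RtoC r))) as (_ & _ & H & _); auto.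
  refine (ex_series_ext _ _ _ H); intros k; cbv beta.
  rewrite Hcol, Cmod_mult, Cmod_pow, Cmod_R, Rabs_pos_eq; lra.
- intros z Hz; destruct (fubini_C (term z)) as (_ & _ & _ & _ & H); auto.
  unfold psum, compose; rewrite <- (Csum_ext _ _ (Hcol z)), H.
  rewrite (has_expansion_psum f a) by auto.
  apply Csum_ext; intros n; rewrite term_row_sum; auto.
Qed.
End Compose.

(** * Boundedness on the unweighted space *)

Definition peval (a : nat -> C) (d : nat) (w : C) : C := csum (fun n => a n * w ^ n)%C d.

Definition trunc (a : nat -> C) (d n : nat) : C := if lt_dec n d then a n else 0%C.

Lemma trunc_lt a d n : (n < d)%nat -> trunc a d n = a n.
Proof. intros H; unfold trunc; destruct (lt_dec n d); [reflexivity|lia]. Qed.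

Lemma trunc_ge a d n : (d <= n)%nat -> trunc a d n = 0%C.
Proof. intros H; unfold trunc; destruct (lt_dec n d); [lia|reflexivity]. Qed.

Lemma has_expansion_peval a d : has_expansion (peval a d) (trunc a d).
Proof.
apply has_expansion_intro.
- intros r Hr; exists (rsum (fun n => Cmod (trunc a d n) * r ^ n) d); apply Series_finite.
  intros n Hn; rewrite trunc_ge, Cmod_0 by auto; ring.
- intros z _; unfold psum; rewrite (Csum_finite _ d).
  + apply csum_ext; intros n Hn; rewrite trunc_lt; auto.
  + intros n Hn; rewrite trunc_ge by auto; ring.
Qed.

Lemma comp_coef_trunc b a d m :
  comp_coef b (trunc a d) m = csum (fun n => a n * cpow b n m)%C d.
Proof.
unfold comp_coef; rewrite (Csum_finite _ d).
- apply csum_ext; intros n Hn; rewrite trunc_lt; auto.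
- intros n Hn; rewrite trunc_ge by auto; ring.
Qed.

(* The harmonic extension of [|f|^2] from the unit circle, for the polynomial [f] with
   coefficients [a 0, ..., a (d-1)]. *)
Fixpoint poisson (d : nat) (a : nat -> C) (w : C) : R :=
  match d with
  | O => 0
  | S d' => Cmod (a O) ^ 2 + 2 * Re (Cconj (a O) * (peval a (S d') w - a O))%C
            + poisson d' (fun n => a (S n)) w
  end.

Lemma peval_S a d w : peval a (S d) w = (a O + w * peval (fun n => a (S n)) d w)%C.
Proof.
unfold peval; rewrite csum_shift, <- csum_scal; f_equal; [simpl; ring|].
apply csum_ext; intros; rewrite Cpow_S; ring.
Qed.

Lemma Cmod2_plus x y : Cmod (x + y)%C ^ 2 = Cmod x ^ 2 + 2 * Re (Cconj x * y)%C + Cmod y ^ 2.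
Proof. rewrite !Cmod2_alt; destruct x, y; simpl; ring. Qed.

(** With [f = a 0 + w g], the first two terms of [poisson] are [|f|^2 - |w|^2 |g|^2]. Iterating,
    [poisson] is [|f|^2] plus [1 - |w|^2] times the sum of [|g|^2] over the successive quotients
    [g]. *)
Lemma poisson_S d a w :
  poisson (S d) a w = Cmod (peval a (S d) w) ^ 2
    - Cmod w ^ 2 * Cmod (peval (fun n => a (S n)) d w) ^ 2 + poisson d (fun n => a (S n)) w.
Proof.
change (poisson (S d) a w) with (Cmod (a O) ^ 2 + 2 * Re (Cconj (a O) * (peval a (S d) w - a O))%C
  + poisson d (fun n => a (S n)) w); rewrite peval_S.
set (g := peval _ d w); rewrite Cmod2_plus, Cmod_mult, Rpow_mult_distr.
replace (a O + w * g - a O)%C with (w * g)%C by ring; ring.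
Qed.

Lemma poisson_ge d a w : Cmod w <= 1 -> Cmod (peval a d w) ^ 2 <= poisson d a w.
Proof.
intros Hw; revert a; induction d as [|d IH]; intros a.
- unfold peval; simpl; rewrite Cmod_0; lra.
- rewrite poisson_S; specialize (IH (fun n => a (S n))).
  set (g := Cmod (peval _ d w)) in *.
  assert (Cmod w ^ 2 <= 1) by (rewrite <- (pow1 2); apply pow_incr; split; [apply Cmod_ge_0|auto]).
  assert (0 <= g ^ 2) by apply pow2_ge_0; nra.
Qed.

(** The constant is the maximum of the Poisson kernel. The extra term [|w| |f|^2] is what lets the
    induction absorb the part of [|a 0 + w g|^2] that comes from [g]. *)
Lemma poisson_le_aux d a w :
  Cmod w < 1 ->
  poisson d a w + Cmod w * Cmod (peval a d w) ^ 2
    <= (1 + Cmod w) / (1 - Cmod w) * rsum (fun n => Cmod (a n) ^ 2) d.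
Proof.
intros Hw; revert a; induction d as [|d IH]; intros a.
- unfold peval; simpl; rewrite Cmod_0; lra.
- rewrite poisson_S, rsum_shift; specialize (IH (fun n => a (S n))).
  set (r := Cmod w) in *; assert (Hr : 0 <= r) by apply Cmod_ge_0.
  set (g := Cmod (peval (fun n => a (S n)) d w)) in *.
  set (x := Cmod (a O)).
  (* Convexity of the square, applied to [x + r g = (1 - r) (x / (1 - r)) + r g]. *)
  assert (HF : Cmod (peval a (S d) w) ^ 2 <= x ^ 2 / (1 - r) + r * g ^ 2).
  { apply Rle_trans with ((x + r * g) ^ 2).
    - apply pow_incr; split; [apply Cmod_ge_0|]; rewrite peval_S.
      eapply Rle_trans; [apply Cmod_triangle|]; rewrite Cmod_mult; unfold x, r, g; lra.
    - apply Rmult_le_reg_r with (1 - r); [lra|].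
      replace ((x ^ 2 / (1 - r) + r * g ^ 2) * (1 - r))
        with (x ^ 2 + r * (1 - r) * g ^ 2) by (field; lra).
      assert (0 <= r * (x - (1 - r) * g) ^ 2) by (apply Rmult_le_pos; [lra|apply pow2_ge_0]); nra. }
  replace ((1 + r) / (1 - r) * (x ^ 2 + rsum (fun k => Cmod (a (S k)) ^ 2) d))
    with ((1 + r) * (x ^ 2 / (1 - r)) + (1 + r) / (1 - r) * rsum (fun k => Cmod (a (S k)) ^ 2) d)
    by (field; lra).
  nra.
Qed.

Lemma poisson_le d a w :
  Cmod w < 1 -> poisson d a w <= (1 + Cmod w) / (1 - Cmod w) * rsum (fun n => Cmod (a n) ^ 2) d.
Proof.
intros Hw; eapply Rle_trans; [|apply poisson_le_aux; auto].
assert (0 <= Cmod w * Cmod (peval a d w) ^ 2); [|lra].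
apply Rmult_le_pos; [apply Cmod_ge_0|apply pow2_ge_0].
Qed.

Lemma Re_mean N u : (0 < N)%nat -> Re (mean N u) = rsum (fun j => Re (u j)) N / INR N.
Proof.
intros HN; assert (0 < INR N) by (apply lt_0_INR; auto).
unfold mean, Cdiv; rewrite <- RtoC_inv, re_scal_r, Re_csum by lra; reflexivity.
Qed.

Lemma mean_value f e r eps :
  has_expansion f e -> 0 <= r < 1 -> 0 < eps ->
  exists N0, forall N, (N0 <= N)%nat -> (0 < N)%nat ->
    Cmod (mean N (fun j => f (r * zeta N j)%C) - f 0)%C < eps.
Proof.
intros He Hr Heps.
destruct (mean_psum_lim e r eps (proj1 Hr) (has_expansion_abs f e r He Hr) Heps) as [N0 HN0].
exists N0; intros N HN HN'.
rewrite (mean_ext N _ (fun j => psum e (r * zeta N j)%C)).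
- rewrite (has_expansion_psum f e 0), psum_0; auto using in_disk_0.
- intros j; apply has_expansion_psum; auto.
  unfold in_disk; rewrite Cmod_mult, Cmod_zeta, Cmod_R, Rabs_pos_eq; lra.
Qed.

Lemma continuity_pt_rsum (F : nat -> R -> R) x n :
  (forall k, continuity_pt (F k) x) -> continuity_pt (fun r => rsum (fun k => F k r) n) x.
Proof.
intros H; induction n as [|n IH]; simpl.
- apply continuity_pt_const; intros ? ?; reflexivity.
- apply (continuity_pt_plus (fun r => rsum (fun k => F k r) n) (F n)); auto.
Qed.

(** The form in which harmonicity is used: after composition with [phi] this is still the real part
    of an analytic function, so it has the mean value property. *)
Lemma poisson_peval d a : exists e, forall w, poisson d a w = Re (peval e d w).
Proof.
revert a; induction d as [|d IH]; intros a; [exists a; reflexivity|].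
destruct (IH (fun n => a (S n))) as [e He].
set (h := fun n => match n with O => RtoC (Cmod (a O) ^ 2) | S _ => (2 * Cconj (a O) * a n)%C end).
exists (fun n => h n + trunc e d n)%C; intros w.
assert (E : peval (fun n => h n + trunc e d n)%C (S d) w = (peval h (S d) w + peval e d w)%C).
{ unfold peval; rewrite (csum_ext _ (fun n => h n * w ^ n + trunc e d n * w ^ n)%C) by (intros; ring).
  rewrite csum_plus; f_equal; simpl; rewrite trunc_ge by auto.
  rewrite (csum_ext _ (fun n => e n * w ^ n)%C); [ring|].
  intros n Hn; rewrite trunc_lt; auto. }
assert (E2 : peval h (S d) w
  = (RtoC (Cmod (a O) ^ 2) + RtoC 2 * (Cconj (a O) * (peval a (S d) w - a O)))%C).
{ rewrite !peval_S; unfold h, peval; f_equal.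
  rewrite (csum_ext _ (fun n => 2 * Cconj (a O) * (a (S n) * w ^ n))%C), csum_scal by (intros; ring); ring. }
rewrite E, E2; change (poisson (S d) a w) with (Cmod (a O) ^ 2
  + 2 * Re (Cconj (a O) * (peval a (S d) w - a O))%C + poisson d (fun n => a (S n)) w).
rewrite He, <- (re_scal_l 2); reflexivity.
Qed.

Section Unweighted.
Variables (phi : C -> C) (b : nat -> C).
Hypothesis Hb : has_expansion phi b.
Hypothesis Hphi : forall z, in_disk z -> in_disk (phi z).

Lemma poisson_mean d a r eps :
  0 <= r < 1 -> 0 < eps ->
  exists N0, forall N, (N0 <= N)%nat -> (0 < N)%nat ->
    Rabs (rsum (fun j => poisson d a (phi (r * zeta N j)%C)) N / INR N
          - poisson d a (phi 0%C)) < eps.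
Proof.
intros Hr Heps; destruct (poisson_peval d a) as [e He].
destruct (mean_value _ _ r eps (has_expansion_compose _ phi _ b (has_expansion_peval e d) Hb Hphi)
  Hr Heps) as [N0 HN0].
exists N0; intros N HN HN'; eapply Rle_lt_trans; [|apply (HN0 N HN HN')].
rewrite He, (rsum_ext _ (fun j => Re (compose phi (peval e d) (r * zeta N j)%C)))
  by (intros; apply He).
rewrite <- Re_mean by exact HN'; apply (re_le_Cmod (_ - compose phi (peval e d) 0)%C).
Qed.

(** Littlewood subordination: on each circle [|f o phi|^2] is at most [poisson] at [phi], whose mean
    tends to [poisson] at [phi 0]. Then [r] tends to 1. *)
Lemma unweighted_bound a d L :
  rsum (fun m => Cmod (csum (fun n => a n * cpow b n m)%C d) ^ 2) L
    <= (1 + Cmod (phi 0%C)) / (1 - Cmod (phi 0%C)) * rsum (fun n => Cmod (a n) ^ 2) d.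
Proof.
assert (H0 : Cmod (phi 0%C) < 1) by (apply Hphi, in_disk_0).
set (c := comp_coef b (trunc a d)).
set (F := compose phi (peval a d)).
assert (HF : has_expansion F c) by (apply has_expansion_compose; auto using has_expansion_peval).
assert (Hr : forall r, 0 < r < 1 -> rsum (fun m => (Cmod (c m) * r ^ m) ^ 2) L <= poisson d a (phi 0%C)).
{ intros r Hr; apply bessel; [lra|apply (has_expansion_abs F); auto; lra|].
  intros eps He; destruct (poisson_mean d a r eps ltac:(lra) He) as [N0 HN0].
  exists N0; intros N HN HN'; specialize (HN0 N HN HN').
  apply Rabs_def2 in HN0.
  apply Rle_trans with (rsum (fun j => poisson d a (phi (r * zeta N j)%C)) N / INR N); [|lra].
  apply Rmult_le_compat_r; [apply Rlt_le, Rinv_0_lt_compat, lt_0_INR; auto|].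
  apply rsum_le; intros j _.
  assert (Hz : in_disk (r * zeta N j)%C)
    by (unfold in_disk; rewrite Cmod_mult, Cmod_zeta, Cmod_R, Rabs_pos_eq; lra).
  rewrite <- (has_expansion_psum F c) by auto.
  apply poisson_ge, Rlt_le, Hphi, Hz. }
eapply Rle_trans; [|apply poisson_le, H0].
rewrite (rsum_ext _ (fun m => (Cmod (c m) * 1 ^ m) ^ 2)).
2:{ intros m _; rewrite pow1, Rmult_1_r; unfold c; rewrite comp_coef_trunc; reflexivity. }
apply (le_of_left_limit (fun r => rsum (fun m => (Cmod (c m) * r ^ m) ^ 2) L)); [lra| |exact Hr].
apply (continuity_pt_rsum (fun m r => (Cmod (c m) * r ^ m) ^ 2)).
intros k; apply derivable_continuous_pt; reg.
Qed.
End Unweighted.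

(** * Sufficiency *)

Lemma pow_le_pow_base (x : R) (n m : nat) : 0 <= x <= 1 -> (n <= m)%nat -> x ^ m <= x ^ n.
Proof.
intros Hx Hnm; replace m with (n + (m - n))%nat by lia; rewrite pow_add.
rewrite <- (Rmult_1_r (x ^ n)) at 2; apply Rmult_le_compat_l; [apply pow_le; lra|].
rewrite <- (pow1 (m - n)); apply pow_incr; lra.
Qed.

Lemma pow_eventually_le (x y : R) : 0 < x < 1 -> 0 < y -> exists q, (1 <= q)%nat /\ x ^ q <= y.
Proof.
intros Hx Hy.
destruct (pow_lt_1_zero x ltac:(rewrite Rabs_pos_eq; lra) y Hy) as [N HN].
exists (S N); split; [lia|]; eapply Rle_trans; [apply Rle_abs|]; apply Rlt_le, HN; lia.
Qed.

(** Bounds the coefficients of a function of the space by a multiple of [rho^(-n/2)], for [rho] as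
    close to 1 as desired. The constant includes the inverse weights before the liminf takes
    effect. *)
Lemma weight_lower beta rho :
  admissible_weight beta -> 0 < rho < 1 ->
  exists K, 0 < K /\ forall n, rho ^ n <= K * beta n.
Proof.
intros [Hpos Hlim] Hrho.
assert (Hev : exists N, forall n, (N <= n)%nat -> rho < Rpower (beta n) (/ INR n)).
{ assert (HL := proj2_sig (ex_LimInf_seq (fun n => Rpower (beta n) (/ INR n)))).
  change (proj1_sig _) with (LimInf_seq (fun n => Rpower (beta n) (/ INR n))) in HL.
  destruct (LimInf_seq (fun n => Rpower (beta n) (/ INR n))) as [l| |]; simpl in *.
  - assert (He : 0 < l - rho) by lra.
    destruct (proj2 (HL (mkposreal _ He))) as [N HN]; exists N; intros n Hn.
    specialize (HN n Hn); simpl in HN; lra.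
  - destruct (HL rho) as [N HN]; exists N; auto.
  - contradiction. }
destruct Hev as [N HN].
assert (HK0 : 0 <= rsum (fun n => / beta n) (S N))
  by (apply rsum_ge0; intros; apply Rlt_le, Rinv_0_lt_compat, Hpos).
exists (1 + rsum (fun n => / beta n) (S N)); split; [lra|]; intros n.
specialize (Hpos n) as Hn; destruct (le_lt_dec n N) as [Hle|Hlt].
- apply Rle_trans with 1; [rewrite <- (pow1 n); apply pow_incr; lra|].
  apply Rmult_le_reg_r with (/ beta n); [apply Rinv_0_lt_compat; auto|].
  rewrite Rmult_assoc, Rinv_r, Rmult_1_r, Rmult_1_l by lra.
  assert (T := rsum_term_le (fun n => / beta n) (S N) n
    ltac:(intros; apply Rlt_le, Rinv_0_lt_compat, Hpos) ltac:(lia)); cbv beta in T; lra.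
- assert (HnR : 0 < INR n) by (apply lt_0_INR; lia).
  apply Rle_trans with (beta n); [|nra].
  replace (beta n) with (Rpower (beta n) (/ INR n) ^ n).
  + apply pow_incr; split; [lra|apply Rlt_le, HN; lia].
  + rewrite <- Rpower_pow by apply exp_pos.
    rewrite Rpower_mult, Rinv_l, Rpower_1; lra.
Qed.

(** One factor [K] for each doubling of the index. *)
Lemma slowly_oscillating_iter beta K :
  1 <= K -> (forall n, 0 < beta n) ->
  (forall m n, INR n / 2 <= INR m <= 2 * INR n -> beta m / beta n <= K) ->
  forall r m n, (m <= n)%nat -> (n <= 2 ^ r * m)%nat -> beta m <= K ^ r * beta n.
Proof.
intros HK Hpos Hosc r; induction r as [|r IH]; intros m n H1 H2.
- simpl in *; replace n with m by lia; lra.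
- assert (P : (1 <= 2 ^ r)%nat) by (apply Nat.neq_0_lt_0, Nat.pow_nonzero; lia).
  destruct (le_lt_dec n (2 ^ r * m)) as [Hle|Hgt].
  + eapply Rle_trans; [apply IH; eassumption|].
    apply Rmult_le_compat_r; [apply Rlt_le, Hpos|]; apply Rle_pow; [lra|lia].
  + assert (Hn : (2 ^ r * m <= n /\ n <= 2 * (2 ^ r * m))%nat) by (simpl in H2; lia).
    eapply Rle_trans; [apply (IH m (2 ^ r * m)%nat); nia|].
    simpl; rewrite (Rmult_comm K), Rmult_assoc; apply Rmult_le_compat_l; [apply pow_le; lra|].
    assert (Hr : beta (2 ^ r * m)%nat / beta n <= K).
    { apply Hosc; destruct Hn as [Hn1 Hn2]; apply le_INR in Hn1, Hn2.
      rewrite mult_INR in Hn2; simpl (INR 2) in Hn2; generalize (pos_INR n); lra. }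
    apply Rmult_le_reg_r with (/ beta n); [apply Rinv_0_lt_compat, Hpos|].
    specialize (Hpos n); rewrite Rmult_assoc, Rinv_r, Rmult_1_r; [exact Hr|lra].
Qed.

(** [w n] is the supremum of [beta] over the indices from [n] on. *)
Lemma decreasing_majorant beta K :
  (forall m n, (n <= m)%nat -> beta m <= K * beta n) ->
  exists w : nat -> R, (forall n, beta n <= w n <= K * beta n) /\ (forall n, w (S n) <= w n).
Proof.
intros HK.
assert (Hlub : forall n, exists l, is_lub (fun y => exists m, (n <= m)%nat /\ y = beta m) l).
{ intros n; destruct (completeness (fun y => exists m, (n <= m)%nat /\ y = beta m)) as [l Hl].
  - exists (K * beta n); intros y (m & Hm & ->); apply HK, Hm.
  - exists (beta n), n; auto.
  - exists l; exact Hl. }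
exists (fun n => proj1_sig (constructive_indefinite_description _ (Hlub n))); split; intros n.
- destruct (constructive_indefinite_description _ (Hlub n)) as [l [L1 L2]]; simpl; split.
  + apply L1; exists n; auto.
  + apply L2; intros y (m & Hm & ->); apply HK, Hm.
- destruct (constructive_indefinite_description _ (Hlub n)) as [l [L1 L2]].
  destruct (constructive_indefinite_description _ (Hlub (S n))) as [l' [L1' L2']]; simpl.
  apply L2'; intros y (m & Hm & ->); apply L1; exists m; split; [lia|reflexivity].
Qed.

Lemma abel_bound (w x y : nat -> R) B L :
  (forall n, 0 <= w n) -> (forall n, w (S n) <= w n) -> 
  (forall l, rsum x l <= rsum y l + B) ->
  rsum (fun m => w m * x m) L <= rsum (fun m => w m * y m) L + w O * B.
Proof.
intros Hw Hdec HB.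
(* Summation by parts stopped at [L]; the boundary term [w L * (rsum x L - rsum y L)] has to be kept
   for the induction. *)
assert (P : rsum (fun m => w m * x m) L - rsum (fun m => w m * y m) L
   <= w L * (rsum x L - rsum y L) + (w O - w L) * B).
{ induction L as [|L IH]; [simpl; lra|].
  specialize (HB (S L)); specialize (Hdec L); simpl in *.
  assert (w (S L) * (rsum x L + x L - (rsum y L + y L) - B)
     >= w L * (rsum x L + x L - (rsum y L + y L) - B)) by nra.
  nra. }
specialize (HB L); specialize (Hw L); nra.
Qed.

Lemma rsum_blocks (u : nat -> R) q l :
  rsum (fun m => rsum (fun i => u (q * m + i)%nat) q) l = rsum u (q * l).
Proof.
induction l as [|l IH]; [rewrite Nat.mul_0_r; reflexivity|].
rewrite Nat.mul_succ_r, rsum_add; simpl; rewrite IH; reflexivity.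
Qed.

(** Each of the first [l] terms of the geometric series is at least [x^l]. *)
Lemma mul_pow_le (x : R) l : 0 < x < 1 -> INR l * x ^ l <= / (1 - x).
Proof.
intros Hx; rewrite <- (Series_geom x) by (rewrite Rabs_pos_eq; lra).
eapply Rle_trans; [|apply (rsum_le_Series (fun n => x ^ n) l)].
- rewrite <- rsum_const; apply rsum_le; intros k Hk; apply pow_le_pow_base; [lra|lia].
- intros; apply pow_le; lra.
- apply ex_series_geom; rewrite Rabs_pos_eq; lra.
Qed.

Lemma Cmod2_plus_le x y : Cmod (x + y)%C ^ 2 <= 2 * Cmod x ^ 2 + 2 * Cmod y ^ 2.
Proof.
generalize (Cmod_triangle x y) (Cmod_ge_0 x) (Cmod_ge_0 y) (Cmod_ge_0 (x + y)%C); intros.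
apply Rle_trans with ((Cmod x + Cmod y) ^ 2); [apply pow_incr; lra|].
generalize (pow2_ge_0 (Cmod x - Cmod y)); nra.
Qed.

Section Sufficiency.
Variables (beta : nat -> R) (phi : C -> C) (b : nat -> C).
Hypothesis Hbeta : admissible_weight beta.
Hypothesis Hdec : essentially_decreasing beta.
Hypothesis Hosc : slowly_oscillating beta.
Hypothesis Hb : has_expansion phi b.
Hypothesis Hphi : forall z, in_disk z -> in_disk (phi z).

Let Hpos : forall n, 0 < beta n := proj1 Hbeta.

(* The entries [cpow b n m] with [n >= q m] are exponentially small in [n], which leaves a
   fixed multiple of the unweighted estimate on the remaining, lower triangular part. *)
Lemma partial_sums_bound :
  exists (q : nat) K0 R0, (1 <= q)%nat /\ 0 <= K0 /\ 0 <= R0 /\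
    forall (f : C -> C) (a : nat -> C) A, has_expansion f a ->
      (forall n, Cmod (a n) ^ 2 * beta n <= A) ->
      forall l, rsum (fun m => Cmod (comp_coef b a m) ^ 2) l
                <= K0 * rsum (fun n => Cmod (a n) ^ 2) (q * l) + R0 * A.
Proof.
assert (H0 : in_disk (phi 0%C)) by (apply Hphi, in_disk_0).
destruct (small_radius phi b Hb H0) as (s & th & Hs & Hth & HK).
(* [th] is split into four equal factors [ka]: two pay for the division by [s^m], one for the growth
   of [|a n|], and the last leaves a convergent geometric series. *)
set (ka := sqrt (sqrt th)).
assert (Hsq : forall x, 0 < x < 1 -> 0 < sqrt x < 1).
{ intros x Hx; split; [apply sqrt_lt_R0; lra|]; rewrite <- sqrt_1; apply sqrt_lt_1; lra. }
assert (Hka : 0 < ka < 1) by (apply Hsq, Hsq, Hth).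
assert (Ek : (ka ^ 2) ^ 2 = th).
{ unfold ka; rewrite !pow2_sqrt; auto; try lra; apply sqrt_pos. }
assert (Hka2 : 0 < ka ^ 2 < 1) by (simpl; nra).
(* With this [q], [n >= q m] forces [(ka^2)^n <= s^m]. *)
destruct (pow_eventually_le (ka ^ 2) s Hka2 (proj1 Hs)) as (q & Hq1 & Hq).
destruct (weight_lower beta (ka ^ 2) Hbeta Hka2) as (D & HD & HDn).
set (K1 := (1 + Cmod (phi 0%C)) / (1 - Cmod (phi 0%C))).
assert (HK1 : 0 <= K1).
{ unfold in_disk in H0; apply Rdiv_le_0_compat; [generalize (Cmod_ge_0 (phi 0%C))|]; lra. }
exists q, (2 * K1), (2 * D * / (1 - ka) * (/ (1 - ka)) ^ 2).
assert (Hik : 0 < / (1 - ka)) by (apply Rinv_0_lt_compat; lra).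
split; [auto|]; split; [lra|]; split.
{ apply Rmult_le_pos; [|apply pow_le; lra]; apply Rmult_le_pos; lra. }
intros f a A Hf HA l.
assert (HA0 : 0 <= A).
{ eapply Rle_trans; [|apply (HA O)]; apply Rmult_le_pos; [apply pow2_ge_0|apply Rlt_le, Hpos]. }
assert (Hsmall : forall n m, (q * m <= n)%nat -> Cmod (cpow b n m) <= (ka ^ 2) ^ n).
{ intros n m Hnm.
  assert (Hc := cpow_bound b n s th ltac:(lra) HK m).
  assert (Hsm : (ka ^ 2) ^ n <= s ^ m).
  { eapply Rle_trans; [apply (pow_le_pow_base (ka ^ 2) (q * m) n); [lra|auto]|].
    rewrite pow_mult; apply pow_incr; split; [apply pow_le; lra|auto]. }
  rewrite <- Ek, <- pow_mult, Nat.mul_comm, pow_mult in Hc.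
  assert (0 < s ^ m) by (apply pow_lt; lra).
  assert (0 < (ka ^ 2) ^ n) by (apply pow_lt; lra).
  apply Rmult_le_reg_r with (s ^ m); auto; simpl in *; nra. }
set (T := sqrt (A * D) * / (1 - ka)).
assert (Hterm : forall n m, (q * m <= n)%nat -> Cmod (a n * cpow b n m)%C <= sqrt (A * D) * ka ^ n).
{ intros n m Hnm; rewrite Cmod_mult.
  apply Rle_trans with (Cmod (a n) * (ka ^ 2) ^ n); [apply Rmult_le_compat_l; [apply Cmod_ge_0|auto]|].
  assert (Hkn : 0 < ka ^ n) by (apply pow_lt; lra).
  rewrite <- (sqrt_pow2 (ka ^ n)), <- sqrt_mult_alt by (try apply Rmult_le_pos; lra).
  rewrite <- (sqrt_pow2 (Cmod (a n) * (ka ^ 2) ^ n))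
    by (apply Rmult_le_pos; [apply Cmod_ge_0|apply pow_le; lra]).
  apply sqrt_le_1_alt.
  replace ((Cmod (a n) * (ka ^ 2) ^ n) ^ 2) with (Cmod (a n) ^ 2 * (ka ^ 2) ^ n * (ka ^ n) ^ 2)
    by (replace ((ka ^ 2) ^ n) with ((ka ^ n) ^ 2) by (rewrite <- !pow_mult; f_equal; lia); ring).
  apply Rmult_le_compat_r; [apply pow_le; lra|].
  apply Rle_trans with (Cmod (a n) ^ 2 * (D * beta n)).
  - apply Rmult_le_compat_l; [apply pow2_ge_0|apply HDn].
  - specialize (HA n); nra. }
assert (Hsplit : forall m, (m < l)%nat -> Cmod (comp_coef b a m) ^ 2
   <= 2 * Cmod (csum (fun n => a n * cpow b n m)%C (q * l)) ^ 2 + 2 * (T * ka ^ l) ^ 2).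
{ intros m Hm.
  assert (Habs := comp_coef_abs f phi a b Hf Hb Hphi m).
  unfold comp_coef; rewrite (Csum_split _ (q * l)) by exact Habs.
  eapply Rle_trans; [apply Cmod2_plus_le|]; apply Rplus_le_compat_l.
  apply Rmult_le_compat_l; [lra|]; apply pow_incr; split; [apply Cmod_ge_0|].
  apply (absC_shift _ (q * l)) in Habs.
  eapply Rle_trans; [apply Cmod_Csum, Habs|].
  apply Rle_trans with (Series (fun k => (sqrt (A * D) * ka ^ l) * ka ^ k)).
  - apply Series_le; [|apply ex_series_geom_scal; lra].
    intros k; split; [apply Cmod_ge_0|].
    eapply Rle_trans; [apply Hterm; nia|].
    rewrite Rmult_assoc, <- pow_add; apply Rmult_le_compat_l; [apply sqrt_pos|].
    apply pow_le_pow_base; [lra|nia].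
  - rewrite Series_scal_l, Series_geom by (rewrite Rabs_pos_eq; lra).
    unfold T; right; ring. }
eapply Rle_trans; [apply rsum_le, Hsplit|].
rewrite rsum_plus, rsum_scal, rsum_const.
apply Rplus_le_compat.
- rewrite Rmult_assoc; apply Rmult_le_compat_l; [lra|].
  apply (unweighted_bound phi b Hb Hphi).
(* Summing the tails over [m < l] costs a factor [l], absorbed by one of the two factors [ka^l]. *)
- assert (HAD : 0 <= A * D) by nra.
  replace (INR l * (2 * (T * ka ^ l) ^ 2))
    with (2 * (A * D) * (/ (1 - ka)) ^ 2 * ((INR l * ka ^ l) * ka ^ l)).
  2:{ unfold T; rewrite !Rpow_mult_distr, pow2_sqrt by auto; ring. }
  replace (2 * D * / (1 - ka) * (/ (1 - ka)) ^ 2 * A)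
    with (2 * (A * D) * (/ (1 - ka)) ^ 2 * (/ (1 - ka) * 1)) by ring.
  apply Rmult_le_compat_l; [apply Rmult_le_pos; [lra|apply pow_le; lra]|].
  apply Rmult_le_compat.
  + apply Rmult_le_pos; [apply pos_INR|apply pow_le; lra].
  + apply pow_le; lra.
  + apply mul_pow_le, Hka.
  + rewrite <- (pow1 l); apply pow_incr; lra.
Qed.

(** For [m >= 1] the quotient of the indices [q m + i] and [m] is below [2 q], so a fixed number of
    doublings links them. *)
Lemma block_weight (q : nat) :
  (1 <= q)%nat -> exists D, 0 <= D /\ forall m i, (i < q)%nat -> beta m <= D * beta (q * m + i)%nat.
Proof.
intros Hq; destruct Hosc as (c & K & _ & _ & HK & H).
assert (P := slowly_oscillating_iter beta K ltac:(lra) Hpos (fun m n Hmn => proj2 (H m n Hmn))).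
assert (Hr : (2 * q <= 2 ^ q * 2)%nat) by (generalize (Nat.pow_gt_lin_r 2 q ltac:(lia)); lia).
(* Slow oscillation compares index 0 only with itself; the block of [m = 0] is finite and this sum
   covers it. *)
set (D0 := rsum (fun i => beta O / beta i) q).
assert (HD0 : 0 <= D0) by (apply rsum_ge0; intros; apply Rlt_le, Rdiv_lt_0_compat; apply Hpos).
assert (HKr : 0 <= K ^ S q) by (apply pow_le; lra).
exists (K ^ S q + D0); split; [lra|]; intros m i Hi.
assert (Hn := Hpos (q * m + i)%nat).
destruct m as [|m].
- rewrite Nat.mul_0_r, Nat.add_0_l in *.
  assert (T := rsum_term_le (fun i => beta O / beta i) q i
    ltac:(intros; apply Rlt_le, Rdiv_lt_0_compat; apply Hpos) Hi); cbv beta in T; fold D0 in T.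
  replace (beta O) with (beta O / beta i * beta i) by (field; specialize (Hpos i); lra).
  apply Rmult_le_compat_r; lra.
- apply Rle_trans with (K ^ S q * beta (q * S m + i)%nat); [|apply Rmult_le_compat_r; lra].
  apply P; [nia|]. rewrite Nat.pow_succ_r'; nia.
Qed.

Lemma weighted_bound :
  exists M, 0 <= M /\ forall f a, has_expansion f a -> ex_series (fun n => Cmod (a n) ^ 2 * beta n) ->
    forall L, rsum (fun m => Cmod (comp_coef b a m) ^ 2 * beta m) L
              <= M * Series (fun n => Cmod (a n) ^ 2 * beta n).
Proof.
destruct partial_sums_bound as (q & K0 & R0 & Hq & HK0 & HR0 & HP).
destruct Hdec as (K & HK & HKb).
destruct (decreasing_majorant beta K HKb) as (w & Hw & Hwdec).
destruct (block_weight q Hq) as (D & HD & HDb).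
assert (Hw0 : forall n, 0 <= w n) by (intros n; specialize (Hpos n); destruct (Hw n); lra).
exists (K0 * (K * D) + w O * R0).
split.
{ apply Rplus_le_le_0_compat; apply Rmult_le_pos; auto; apply Rmult_le_pos; lra. }
intros f a Hf Hex L.
set (A := Series (fun n => Cmod (a n) ^ 2 * beta n)).
assert (Hterm : forall n, 0 <= Cmod (a n) ^ 2 * beta n)
  by (intros; apply Rmult_le_pos; [apply pow2_ge_0|apply Rlt_le, Hpos]).
assert (HA : forall n, Cmod (a n) ^ 2 * beta n <= A)
  by (intros n; apply (Series_term_le (fun n => Cmod (a n) ^ 2 * beta n)); auto).
(* [y m] collects a block of [q] coefficients, so that its partial sums up to [l] reach the index
   [q l]. *)
set (y := fun m => K0 * rsum (fun i => Cmod (a (q * m + i)%nat) ^ 2) q).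
apply Rle_trans with (rsum (fun m => w m * Cmod (comp_coef b a m) ^ 2) L).
{ apply rsum_le; intros m _; rewrite Rmult_comm; apply Rmult_le_compat_r; [apply pow2_ge_0|apply Hw]. }
eapply Rle_trans.
{ apply (abel_bound w _ y (R0 * A)); auto.
  intros l; unfold y; rewrite rsum_scal, (rsum_blocks (fun n => Cmod (a n) ^ 2) q l).
  apply (HP f); auto. }
rewrite Rmult_plus_distr_r, Rmult_assoc.
apply Rplus_le_compat; [|right; ring].
apply Rle_trans with (rsum (fun m => K0 * (K * D) * rsum (fun i => Cmod (a (q * m + i)%nat) ^ 2 * beta (q * m + i)%nat) q) L).
- apply rsum_le; intros m _; unfold y.
  set (S1 := rsum (fun i => Cmod (a (q * m + i)%nat) ^ 2) q).
  replace (w m * (K0 * S1)) with (K0 * (w m * S1)) by ring.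
  rewrite (Rmult_assoc K0); apply Rmult_le_compat_l; auto.
  unfold S1; rewrite <- !rsum_scal; apply rsum_le; intros i Hi.
  assert (w m <= K * D * beta (q * m + i)%nat).
  { eapply Rle_trans; [apply Hw|]; rewrite Rmult_assoc; apply Rmult_le_compat_l; [lra|auto]. }
  generalize (pow2_ge_0 (Cmod (a (q * m + i)%nat))); nra.
- rewrite rsum_scal, (rsum_blocks (fun n => Cmod (a n) ^ 2 * beta n)), Rmult_assoc.
  apply Rmult_le_compat_l; auto.
  apply Rmult_le_compat_l; [apply Rmult_le_pos; lra|].
  apply rsum_le_Series; auto.
Qed.

Lemma sufficiency : composition_bounded beta phi.
Proof.
destruct weighted_bound as (M & HM & H).
assert (Hpos' : forall c n, 0 <= Cmod (c n) ^ 2 * beta n)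
  by (intros; apply Rmult_le_pos; [apply pow2_ge_0|apply Rlt_le, Hpos]).
split.
- intros f (a & Ha & Hex); exists (comp_coef b a); split; [apply has_expansion_compose; auto|].
  apply ex_series_bounded with (M * Series (fun n => Cmod (a n) ^ 2 * beta n)); auto.
  apply (H f); auto.
- exists (sqrt M); intros f N N' (HN & a & Ha & Hs) (HN' & a' & Ha' & Hs').
  assert (E := has_expansion_unique _ _ _ Ha' (has_expansion_compose f phi a b Ha Hb Hphi)).
  apply Rsqr_incr_0_var; [|apply Rmult_le_pos; [apply sqrt_pos|auto]]; rewrite !Rsqr_pow2.
  rewrite Rpow_mult_distr, pow2_sqrt by auto.
  rewrite <- (is_series_unique _ _ Hs), <- (is_series_unique _ _ Hs').
  apply Series_le_bound; [eexists; exact Hs'|]; intros n.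
  rewrite (rsum_ext _ (fun m => Cmod (comp_coef b a m) ^ 2 * beta m)).
  + apply (H f); auto; eexists; exact Hs.
  + intros k _; rewrite E; reflexivity.
Qed.
End Sufficiency.

(** * Coefficient form of boundedness *)

Lemma composition_bounded_coef beta phi :
  (forall n, 0 < beta n) -> composition_bounded beta phi ->
  exists M, 0 <= M /\ forall f a c, has_expansion f a -> has_expansion (compose phi f) c ->
    ex_series (fun n => Cmod (a n) ^ 2 * beta n) ->
    forall L, rsum (fun n => Cmod (c n) ^ 2 * beta n) L
              <= M * Series (fun n => Cmod (a n) ^ 2 * beta n).
Proof.
intros Hpos [H1 [M HM]].
assert (Hpos' : forall c n, 0 <= Cmod (c n) ^ 2 * beta n)
  by (intros; apply Rmult_le_pos; [apply pow2_ge_0|apply Rlt_le, Hpos]).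
exists (M ^ 2); split; [apply pow2_ge_0|]; intros f a c Ha Hc Hex L.
destruct (H1 f (ex_intro _ a (conj Ha Hex))) as (c' & Hc' & Hex').
assert (E := has_expansion_unique _ _ _ Hc' Hc).
assert (Hexc : ex_series (fun n => Cmod (c n) ^ 2 * beta n)).
{ refine (ex_series_ext _ _ _ Hex'); intros n; rewrite E; reflexivity. }
set (A := Series (fun n => Cmod (a n) ^ 2 * beta n)).
set (B := Series (fun n => Cmod (c n) ^ 2 * beta n)).
assert (HA : 0 <= A) by (apply Series_ge0; auto).
assert (HB : 0 <= B) by (apply Series_ge0; auto).
assert (HN : is_H2_norm beta f (sqrt A)).
{ split; [apply sqrt_pos|]; exists a; split; auto.
  rewrite pow2_sqrt by auto; apply Series_correct, Hex. }
assert (HN' : is_H2_norm beta (compose phi f) (sqrt B)).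
{ split; [apply sqrt_pos|]; exists c; split; auto.
  rewrite pow2_sqrt by auto; apply Series_correct, Hexc. }
apply Rle_trans with B; [apply rsum_le_Series; auto|].
rewrite <- (pow2_sqrt A), <- (pow2_sqrt B), <- Rpow_mult_distr by auto.
apply pow_incr; split; [apply sqrt_pos|apply (HM f); auto].
Qed.

Lemma Series_trunc_weight beta a d :
  is_series (fun n => Cmod (trunc a d n) ^ 2 * beta n) (rsum (fun n => Cmod (a n) ^ 2 * beta n) d).
Proof.
replace (rsum _ d) with (rsum (fun n => Cmod (trunc a d n) ^ 2 * beta n) d).
- apply Series_finite; intros n Hn; rewrite trunc_ge, Cmod_0 by auto; ring.
- apply rsum_ext; intros n Hn; rewrite trunc_lt; auto.
Qed.

Lemma polynomial_bound beta phi b :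
  (forall n, 0 < beta n) -> (forall z, in_disk z -> in_disk (phi z)) -> has_expansion phi b ->
  composition_bounded beta phi ->
  exists M, 0 <= M /\ forall a d L,
    rsum (fun k => Cmod (csum (fun n => a n * cpow b n k)%C d) ^ 2 * beta k) L
    <= M * rsum (fun n => Cmod (a n) ^ 2 * beta n) d.
Proof.
intros Hpos Hphi Hb Hc; destruct (composition_bounded_coef beta phi Hpos Hc) as (M & HM & H).
exists M; split; auto; intros a d L.
assert (S := Series_trunc_weight beta a d).
rewrite <- (is_series_unique _ _ S).
rewrite (rsum_ext _ (fun k => Cmod (comp_coef b (trunc a d) k) ^ 2 * beta k)).
- apply (H (peval a d)); [apply has_expansion_peval| |eexists; exact S].
  apply has_expansion_compose; auto using has_expansion_peval.
- intros k _; rewrite comp_coef_trunc; reflexivity.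
Qed.

(** * The singular inner functions [exp (- x (1 + z) / (1 - z))] *)

Definition Cexp (w : C) : C := psum (fun n => RtoC (/ INR (fact n))) w.

Lemma exp_series (x : R) : is_series (fun n => / INR (fact n) * x ^ n) (exp x).
Proof.
generalize (is_exp_Reals x); apply is_series_ext; intros n.
rewrite pow_n_pow; apply Rmult_comm.
Qed.

Lemma Rinv_fact_pos n : 0 < / INR (fact n).
Proof. apply Rinv_0_lt_compat, INR_fact_lt_0. Qed.

Lemma psabs_exp r : psabs (fun n => RtoC (/ INR (fact n))) r.
Proof.
exists (exp r); generalize (exp_series r); apply is_series_ext; intros n.
rewrite Cmod_R, Rabs_pos_eq; [reflexivity|apply Rlt_le, Rinv_fact_pos].
Qed.

Lemma bin_fact n k : (k <= n)%nat -> (bin n k * (fact k * fact (n - k)) = fact n)%nat.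
Proof.
revert k; induction n as [|n IH]; intros [|k] H; try lia.
- reflexivity.
- simpl (bin (S n) 0); rewrite Nat.sub_0_r; simpl (fact 0); lia.
- simpl bin; rewrite Nat.sub_succ.
  destruct (Nat.eq_dec k n) as [->|Hne].
  + rewrite (bin_gt n (S n)) by lia; specialize (IH n ltac:(lia)).
    rewrite Nat.sub_diag in *; simpl fact in *; nia.
  + assert (I1 := IH k ltac:(lia)); assert (I2 := IH (S k) ltac:(lia)).
    replace (n - k)%nat with (S (n - S k)) in * by lia.
    change (fact (S k)) with (S k * fact k)%nat in *.
    change (fact (S (n - S k))) with (S (n - S k) * fact (n - S k))%nat in *.
    change (fact (S n)) with (S n * fact n)%nat.
    replace (S n) with (S k + S (n - S k))%nat by lia; nia.
Qed.

(** Cauchy product of the series with coefficients [u^n / n!] and [v^n / n!], evaluated at 1. *)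
Lemma Cexp_plus u v : Cexp (u + v)%C = (Cexp u * Cexp v)%C.
Proof.
set (a := fun w n => (RtoC (/ INR (fact n)) * w ^ n)%C).
assert (Ha : forall w, psabs (a w) 1).
{ intros w; refine (ex_series_ext _ _ _ (psabs_absC _ _ w (psabs_exp (Cmod w)) (Rle_refl _))).
  intros n; cbv beta; rewrite pow1, Rmult_1_r; reflexivity. }
assert (E : forall w, psum (a w) 1 = Cexp w).
{ intros w; apply Csum_ext; intros n; unfold a; rewrite Cpow_1_l; ring. }
destruct (conv_psum_aux (a u) (a v) 1 1 (Ha u) (Ha v)) as [_ H]; [rewrite Cmod_1; lra|].
rewrite <- (E u), <- (E v), <- H; apply Csum_ext; intros n.
rewrite Cpow_1_l, Cmult_1_r; unfold conv, a.
rewrite (Cplus_comm u v), <- binomial_C, <- csum_scal; apply csum_ext; intros k Hk.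
assert (B := bin_fact n k ltac:(lia)); apply (f_equal INR) in B; rewrite !mult_INR in B.
assert (F : / INR (fact k) * / INR (fact (n - k)) = / INR (fact n) * INR (bin n k)).
{ rewrite <- B; field; repeat split; try apply INR_fact_neq_0.
  intros Eb; rewrite Eb in B; generalize (INR_fact_neq_0 n); lra. }
replace (RtoC (/ INR (fact k)) * u ^ k * (RtoC (/ INR (fact (n - k))) * v ^ (n - k)))%C
  with (RtoC (/ INR (fact k) * / INR (fact (n - k))) * u ^ k * v ^ (n - k))%C
  by (rewrite RtoC_mult; ring).
rewrite F, RtoC_mult; ring.
Qed.

Lemma Cexp_RtoC (x : R) : Cexp (RtoC x) = RtoC (exp x).
Proof.
unfold Cexp, psum; rewrite <- (is_series_unique _ _ (exp_series x)), <- Csum_RtoC.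
apply Csum_ext; intros n; rewrite RtoC_mult, RtoC_pow; reflexivity.
Qed.

Lemma Cexp_pow w n : (Cexp w ^ n)%C = Cexp (RtoC (INR n) * w)%C.
Proof.
induction n as [|n IH].
- simpl (INR 0); rewrite Cmult_0_l, Cexp_RtoC, exp_0; reflexivity.
- rewrite Cpow_S, IH, <- Cexp_plus, S_INR, RtoC_plus; f_equal; ring.
Qed.

Lemma Cexp_conj w : Cexp (Cconj w) = Cconj (Cexp w).
Proof.
unfold Cexp, psum, Csum, Cconj at 3; simpl; f_equal.
- apply Series_ext; intros n; rewrite <- Cpow_conj; unfold Cconj, Re, Im; simpl; ring.
- rewrite <- Series_opp; apply Series_ext; intros n; rewrite <- Cpow_conj.
  unfold Cconj, Re, Im; simpl; ring.
Qed.

(** [|exp w|^2] is the product of [exp w] and [exp (conj w)], that is [exp (2 Re w)]. *)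
Lemma Cmod_Cexp_lt1 w : Re w < 0 -> Cmod (Cexp w) < 1.
Proof.
intros Hw.
assert (E : Cmod (Cexp w) ^ 2 = exp (2 * Re w)).
{ apply RtoC_inj; rewrite Cmod2_conj, <- Cexp_conj, <- Cexp_plus, <- Cexp_RtoC; f_equal.
  destruct w as [x y]; unfold Cconj, Re, RtoC; apply injective_projections; simpl; ring. }
assert (exp (2 * Re w) < 1) by (rewrite <- exp_0; apply exp_increasing; lra).
generalize (Cmod_ge_0 (Cexp w)); nra.
Qed.

(** Conformal map of the disk onto the right half-plane, where the automorphisms fixing the boundary
    points 1 and -1 of the disk become dilations. *)
Definition cayley (z : C) : C := ((1 + z) / (1 - z))%C.

Lemma one_minus_neq0 z : in_disk z -> (1 - z)%C <> 0%C.
Proof.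
intros Hz E; assert (z = 1%C) by (replace z with (1 - (1 - z))%C by ring; rewrite E; ring).
subst z; unfold in_disk in Hz; rewrite Cmod_1 in Hz; lra.
Qed.

Lemma geometric_C w : Cmod w < 1 -> absC (fun k => w ^ k)%C /\ Csum (fun k => w ^ k)%C = (/ (1 - w))%C.
Proof.
intros Hw.
assert (Ha : absC (fun k => w ^ k)%C).
{ apply absC_dom with (fun k => 1 * Cmod w ^ k); [intros k; rewrite Cmod_pow; lra|].
  apply ex_series_geom_scal; split; [apply Cmod_ge_0|exact Hw]. }
split; [exact Ha|].
assert (Hn : (1 - w)%C <> 0%C) by (apply one_minus_neq0; exact Hw).
set (P := Csum (fun k => w ^ k)%C).
assert (HP : P = (1 + w * P)%C).
{ unfold P at 1; rewrite (Csum_split _ 1) by exact Ha.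
  rewrite (Csum_ext _ (fun k => w * w ^ k)%C) by (intros; reflexivity).
  rewrite Csum_scal by exact Ha; change (Csum (Cpow w)) with P; simpl; ring. }
transitivity (((1 - w) * P) / (1 - w))%C; [field; exact Hn|].
replace ((1 - w) * P)%C with (RtoC 1); [field; exact Hn|].
transitivity (P - w * P)%C; [rewrite HP at 1|]; ring.
Qed.

Lemma Re_cayley z : in_disk z -> 0 < Re (cayley z).
Proof.
intros Hz; assert (Hn := one_minus_neq0 z Hz); unfold in_disk in Hz.
assert (Hm : Cmod z ^ 2 < 1) by (generalize (Cmod_ge_0 z); simpl; nra).
rewrite Cmod2_alt in Hm.
assert (Hd : 0 < Cmod (1 - z)%C ^ 2) by (apply pow_lt, Cmod_gt_0, Hn).
rewrite Cmod2_alt in Hd.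
destruct z as [x y]; unfold cayley, Re, Im in *; simpl in *.
match goal with |- 0 < ?t => replace t with
  ((1 - (x * (x * 1) + y * (y * 1))) / ((1 + - x) * ((1 + - x) * 1) + (0 + - y) * ((0 + - y) * 1)))
  by (field; lra) end.
apply Rdiv_lt_0_compat; lra.
Qed.

Definition inner (x : R) (z : C) : C := Cexp (RtoC (- x) * cayley z)%C.

Lemma inner_disk x z : 0 < x -> in_disk z -> in_disk (inner x z).
Proof.
intros Hx Hz; apply Cmod_Cexp_lt1; rewrite re_scal_l.
generalize (Re_cayley z Hz); nra.
Qed.

Lemma inner_pow x z n : (inner x z ^ n)%C = inner (x * INR n) z.
Proof.
unfold inner; rewrite Cexp_pow; f_equal.
replace (- (x * INR n)) with (INR n * - x) by ring; rewrite RtoC_mult; ring.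
Qed.

Definition geo1 (k : nat) : R := match k with O => 0 | S _ => 1 end.

(* [geo j k] is the coefficient of [z^k] in [(z / (1 - z))^j]. *)
Definition geo (j : nat) : nat -> R := rpow geo1 j.

Lemma geo_S0 j : geo (S j) 0 = 0.
Proof. unfold geo; simpl; unfold rconv; simpl; ring. Qed.

(** Coefficient form of [(1 - z) g^(j+1) = z g^j] with [g = z / (1 - z)]. *)
Lemma geo_SS j k : geo (S j) (S k) = geo j k + geo (S j) k.
Proof.
change (rconv geo1 (geo j) (S k) = geo j k + rconv geo1 (geo j) k).
unfold rconv; rewrite (rsum_shift _ (S k)), !(rsum_shift _ k); simpl geo1; rewrite Nat.sub_0_r.
rewrite (rsum_ext (fun i => 1 * geo j (S k - S (S i))) (fun i => 1 * geo j (k - S i)%nat))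
  by reflexivity; simpl (S k - 1)%nat; rewrite Nat.sub_0_r; ring.
Qed.

Lemma geo_ge0 j k : 0 <= geo j k.
Proof. apply rpow_ge0; intros [|i]; simpl; lra. Qed.

Lemma geo_lt j k : (k < j)%nat -> geo j k = 0.
Proof.
revert k; induction j as [|j IHj]; intros k Hk; [lia|].
induction k as [|k IHk]; [apply geo_S0|]; rewrite geo_SS, IHj, IHk by lia; ring.
Qed.

(** [z / (1 - z)] equals [1/3] at [z = 1/4], and a term of a nonnegative series is at most its
    value. Any point below [1/3] gives a value under [1/2], so that [exp (- x)] later wins over
    [exp (2 x / 3)]. *)
Lemma geo_le j k : geo j k * 3 ^ j <= 4 ^ k.
Proof.
revert k; induction j as [|j IHj]; intros k.
- destruct k as [|k]; unfold geo; simpl; [lra|].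
  assert (0 < 4 ^ k) by (apply pow_lt; lra); lra.
- induction k as [|k IHk]; [rewrite geo_S0; simpl; lra|].
  rewrite geo_SS; specialize (IHj k); simpl in *; lra.
Qed.

Lemma geo_series j r :
  0 <= r < 1 -> is_series (fun k => geo j k * r ^ k) ((r / (1 - r)) ^ j).
Proof.
intros Hr.
assert (Hg : is_series (fun k => geo1 k * r ^ k) (r / (1 - r))).
{ assert (Hex : ex_series (fun k => r * r ^ k)) by (apply ex_series_geom_scal; exact Hr).
  assert (Hex1 : ex_series (fun k => geo1 k * r ^ k)).
  { apply ex_series_incr_1; refine (ex_series_ext _ _ _ Hex); intros k; symmetry; apply Rmult_1_l. }
  replace (r / (1 - r)) with (Series (fun k => geo1 k * r ^ k)); [apply Series_correct, Hex1|].
  rewrite Series_incr_1 by exact Hex1.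
  rewrite (Series_ext _ (fun k => r * r ^ k)) by (intros; simpl; ring).
  rewrite Series_scal_l, Series_geom by (rewrite Rabs_pos_eq; lra); simpl; field; lra. }
rewrite <- (is_series_unique _ _ Hg); apply rpow_series; [|lra|eexists; exact Hg].
intros [|i]; simpl; lra.
Qed.

Lemma geo_psabs j r : 0 <= r < 1 -> psabs (fun k => RtoC (geo j k)) r.
Proof.
intros Hr; exists ((r / (1 - r)) ^ j); generalize (geo_series j r Hr); apply is_series_ext.
intros k; rewrite Cmod_R, Rabs_pos_eq; [reflexivity|apply geo_ge0].
Qed.

Lemma geo_psum j z : in_disk z -> psum (fun k => RtoC (geo j k)) z = ((z / (1 - z)) ^ j)%C.
Proof.
intros Hz; unfold in_disk in Hz; generalize (Cmod_ge_0 z); intros Hz0.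
assert (H1 : forall k, geo1 k = geo 1 k).
{ intros k; induction k as [|k IH]; [rewrite geo_S0; reflexivity|].
  rewrite geo_SS, <- IH; unfold geo; destruct k; simpl; ring. }
assert (Hp : psabs (fun k => RtoC (geo1 k)) (Cmod z)).
{ refine (ex_series_ext _ _ _ (geo_psabs 1 _ (conj Hz0 Hz))); intros k; rewrite H1; reflexivity. }
transitivity (psum (cpow (fun k => RtoC (geo1 k)) j) z).
- apply Csum_ext; intros k; rewrite cpow_RtoC; reflexivity.
- rewrite (psum_cpow _ j (Cmod z)) by (auto; lra); f_equal.
  destruct (geometric_C z Hz) as [G1 G2].
  unfold psum; rewrite (Csum_split _ 1) by (apply psabs_absC with (Cmod z); auto; lra).
  rewrite (Csum_ext _ (fun k => z * z ^ k)%C) by (intros; simpl; ring).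
  rewrite (Csum_scal z (fun k => z ^ k)%C G1), G2; simpl; unfold Cdiv; ring.
Qed.

(** The Laguerre polynomial of parameter -1 at [2 x], with generating function
    [exp (- 2 x z / (1 - z))]. As [(1 + z) / (1 - z) = 1 + 2 z / (1 - z)], the factor [exp (- x)] in
    [ecoef] completes [E_x]. *)
Definition lag (k : nat) (x : R) : R :=
  rsum (fun j => geo j k * ((- 2 * x) ^ j / INR (fact j))) (S k).

Definition ecoef (k : nat) (x : R) : R := exp (- x) * lag k x.

Lemma lag_extend k x N : (k < N)%nat ->
  lag k x = rsum (fun j => geo j k * ((- 2 * x) ^ j / INR (fact j))) N.
Proof.
intros HN; replace N with (S k + (N - S k))%nat by lia.
rewrite rsum_add; fold (lag k x).
set (T := rsum _ (N - S k)); replace T with 0; [ring|].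
unfold T; symmetry; apply rsum_eq0; intros i _; rewrite geo_lt by lia; ring.
Qed.

Lemma has_expansion_inner x : has_expansion (inner x) (fun k => RtoC (ecoef k x)).
Proof.
set (w := RtoC (- 2 * x)).
set (u := fun z j k => (RtoC (/ INR (fact j)) * w ^ j * (RtoC (geo j k) * z ^ k))%C).
assert (Hrow : forall z, in_disk z -> forall j, absC (u z j)).
{ intros z Hz j; apply absC_scal, psabs_absC with (Cmod z); [|lra].
  apply geo_psabs; split; [apply Cmod_ge_0|exact Hz]. }
assert (Hrowabs : forall z, in_disk z -> ex_series (fun j => Series (fun k => Cmod (u z j k)))).
{ intros z Hz; unfold in_disk in Hz; generalize (Cmod_ge_0 z); intros Hz0.
  set (r := Cmod z / (1 - Cmod z)).
  exists (exp (Cmod w * r)); generalize (exp_series (Cmod w * r)); apply is_series_ext.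
  intros j; symmetry; transitivity (/ INR (fact j) * Cmod w ^ j * Series (fun k => geo j k * Cmod z ^ k)).
  - rewrite <- Series_scal_l; apply Series_ext; intros k; unfold u.
    rewrite !Cmod_mult, !Cmod_pow, !Cmod_R, !Rabs_pos_eq; auto using geo_ge0.
    apply Rlt_le, Rinv_fact_pos.
  - rewrite (is_series_unique _ _ (geo_series j _ (conj Hz0 Hz))); fold r.
    rewrite Rpow_mult_distr; apply Rmult_assoc. }
assert (Hcol : forall z k, (RtoC (exp (- x)) * Csum (fun j => u z j k))%C = (RtoC (ecoef k x) * z ^ k)%C).
{ intros z k; rewrite (Csum_finite _ (S k)).
  - unfold ecoef, lag; rewrite RtoC_mult, <- csum_RtoC, <- Cmult_assoc; f_equal.
    rewrite Cmult_comm, <- csum_scal; apply csum_ext; intros j _; unfold u, w, Rdiv.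
    rewrite !RtoC_mult, RtoC_pow, RtoC_mult; ring.
  - intros j Hj; unfold u; rewrite geo_lt by lia; ring. }
apply has_expansion_intro.
- intros r Hr.
  assert (Hz : in_disk (RtoC r)) by (apply in_disk_R; lra).
  destruct (fubini_C (u (RtoC r)) (Hrow _ Hz) (Hrowabs _ Hz)) as (_ & _ & H & _).
  apply (absC_scal (RtoC (exp (- x)))) in H.
  refine (ex_series_ext _ _ _ H); intros k; cbv beta.
  rewrite Hcol, Cmod_mult, Cmod_pow, (Cmod_R r), (Rabs_pos_eq r); lra.
- intros z Hz; assert (Hn := one_minus_neq0 z Hz).
  destruct (fubini_C (u z) (Hrow _ Hz) (Hrowabs _ Hz)) as (_ & _ & H1 & _ & H).
  unfold psum; rewrite <- (Csum_ext _ _ (Hcol z)), Csum_scal, H by exact H1.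
  transitivity (Cexp (RtoC (- x)) * Cexp (w * (z / (1 - z))))%C.
  + rewrite <- Cexp_plus; unfold inner; f_equal; unfold w, cayley.
    replace (- 2 * x) with (2 * - x) by ring; rewrite RtoC_mult; field; exact Hn.
  + rewrite Cexp_RtoC; f_equal; apply Csum_ext; intros j.
    unfold u; rewrite Csum_scal.
    * fold (psum (fun k => RtoC (geo j k)) z); rewrite geo_psum, Cpow_mult_l by exact Hz; ring.
    * apply psabs_absC with (Cmod z); [|lra].
      apply geo_psabs; split; [apply Cmod_ge_0|exact Hz].
Qed.

Lemma inner_symbol x : 0 < x -> symbol (inner x).
Proof.
intros Hx; split; [intros z; apply inner_disk, Hx|]; split.
- intros z Hz; apply (has_expansion_analytic _ _ z (has_expansion_inner x) Hz).
- exists 0%C, (RtoC (1 / 2)); split; [exact in_disk_0|].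
  split; [unfold in_disk; rewrite Cmod_R, Rabs_pos_eq; lra|].
  unfold inner, cayley.
  replace (RtoC (- x) * ((1 + 0) / (1 - 0)))%C with (RtoC (- x)) by field.
  replace (RtoC (- x) * ((1 + RtoC (1 / 2)) / (1 - RtoC (1 / 2))))%C with (RtoC (- x * 3)).
  + rewrite !Cexp_RtoC; intros E; apply RtoC_inj, exp_inv in E; lra.
  + rewrite <- RtoC_plus, <- RtoC_minus, <- RtoC_div, <- RtoC_mult by lra; f_equal; field.
Qed.

Lemma cpow_inner x n k : cpow (fun k => RtoC (ecoef k x)) n k = RtoC (ecoef k (x * INR n)).
Proof.
apply (has_expansion_unique (fun z => inner x z ^ n)%C
  (cpow (fun k => RtoC (ecoef k x)) n) (fun k => RtoC (ecoef k (x * INR n)))).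
- apply has_expansion_pow, has_expansion_inner.
- apply (has_expansion_ext (inner (x * INR n))); [|apply has_expansion_inner].
  intros z _; symmetry; apply inner_pow.
Qed.

(** * Mass distribution of the coefficients in the parameter *)

Lemma le_of_derive (f df : R -> R) a b :
  a <= b -> (forall x, is_derive f x (df x)) -> (forall x, a <= x <= b -> 0 <= df x) -> f a <= f b.
Proof.
intros Hab Hd Hpos.
destruct (MVT_gen f a b df) as (c & Hc & E).
- intros x _; apply Hd.
- intros x _; apply derivable_continuous_pt; exists (df x); apply is_derive_Reals, Hd.
- rewrite Rmin_left, Rmax_right in Hc by auto.
  assert (0 <= df c * (b - a)) by (apply Rmult_le_pos; [apply Hpos, Hc|lra]); lra.
Qed.

Lemma is_derive_Rconst (c x : R) : is_derive (fun _ : R => c) x 0.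
Proof. exact (is_derive_const (K := R_AbsRing) (V := R_NormedModule) c x). Qed.

Lemma is_derive_Rext (f g : R -> R) x (l : R) :
  (forall t, f t = g t) -> is_derive f x l -> is_derive g x l.
Proof. apply is_derive_ext. Qed.

Lemma is_derive_rsum (F dF : nat -> R -> R) x n :
  (forall k, is_derive (F k) x (dF k x)) ->
  is_derive (fun y => rsum (fun k => F k y) n) x (rsum (fun k => dF k x) n).
Proof.
intros H; induction n as [|n IH]; simpl.
- apply (is_derive_Rconst 0 x).
- apply (is_derive_plus (fun y => rsum (fun k => F k y) n) (F n)); auto.
Qed.

Lemma is_derive_eq (f : R -> R) x (l l' : R) : is_derive f x l -> l = l' -> is_derive f x l'.
Proof. intros H E; rewrite <- E; exact H. Qed.

Lemma is_derive_Rmult (f g : R -> R) x l l' :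
  is_derive f x l -> is_derive g x l' -> is_derive (fun y => f y * g y) x (l * g x + f x * l').
Proof. intros Hf Hg; apply (is_derive_mult f g); auto; intros; apply Rmult_comm. Qed.

Definition dlag (k : nat) (x : R) : R :=
  -2 * rsum (fun j => geo (S j) k * ((- 2 * x) ^ j / INR (fact j))) (S k).

Lemma is_derive_lag k x : is_derive (lag k) x (dlag k x).
Proof.
set (t := fun j y => (- 2 * y) ^ j / INR (fact j)).
assert (Ht : forall j, is_derive (t (S j)) x (-2 * t j x)).
{ intros j; unfold t.
  apply is_derive_eq with (INR (S j) * (-2) * (-2 * x) ^ j / INR (fact (S j))).
  - auto_derive; auto; change (fact j + j * fact j)%nat with (fact (S j)).
    change (match j with O => 1 | S _ => INR j + 1 end) with (INR (S j)).
    generalize (INR (S j)) (INR (fact (S j))); intros c d.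
    match goal with |- @eq _ ?l ?r => change (@eq R l r) end; unfold Rdiv; ring.
  - change (fact (S j)) with (S j * fact j)%nat; rewrite mult_INR; field.
    split; [apply INR_fact_neq_0|apply not_0_INR; lia]. }
apply (is_derive_Rext (fun y => geo 0 k + rsum (fun j => geo (S j) k * t (S j) y) (S k))).
{ intros y; rewrite (lag_extend k y (S (S k))) by lia; rewrite (rsum_shift _ (S k)); unfold t.
  replace ((- 2 * y) ^ 0 / INR (fact 0)) with 1 by (simpl; field); rewrite Rmult_1_r; reflexivity. }
apply is_derive_eq with (0 + rsum (fun j => geo (S j) k * (-2 * t j x)) (S k)).
- apply (is_derive_plus (fun _ => geo 0 k)); [apply is_derive_Rconst|].
  apply (is_derive_rsum (fun j y => geo (S j) k * t (S j) y) (fun j y => geo (S j) k * (-2 * t j y))).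
  intros j; apply (is_derive_scal (t (S j)) x (geo (S j) k)), Ht.
- unfold dlag; rewrite Rplus_0_l, <- rsum_scal; apply rsum_ext; intros; unfold t; ring.
Qed.

(** Coefficient form of [(1 - z) dF/dx = - 2 z F] for [F = exp (- 2 x z / (1 - z))]. *)
Lemma dlag_S k x : dlag (S k) x = dlag k x - 2 * lag k x.
Proof.
unfold dlag; rewrite (lag_extend k x (S (S k))) by lia.
set (N := S (S k)).
assert (E : rsum (fun j => geo (S j) k * ((- 2 * x) ^ j / INR (fact j))) (S k)
  = rsum (fun j => geo (S j) k * ((- 2 * x) ^ j / INR (fact j))) N).
{ unfold N; change (rsum ?u (S (S k))) with (rsum u (S k) + u (S k)).
  cbv beta; rewrite (geo_lt (S (S k)) k) by lia; ring. }
rewrite E.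
replace (-2 * rsum (fun j => geo (S j) k * ((- 2 * x) ^ j / INR (fact j))) N
   - 2 * rsum (fun j => geo j k * ((- 2 * x) ^ j / INR (fact j))) N)
 with (-2 * (rsum (fun j => geo (S j) k * ((- 2 * x) ^ j / INR (fact j))) N
   + rsum (fun j => geo j k * ((- 2 * x) ^ j / INR (fact j))) N)) by ring.
f_equal; rewrite <- rsum_plus; apply rsum_ext; intros j _; rewrite geo_SS; ring.
Qed.

Definition ecoef_pred (k : nat) (x : R) : R := match k with O => 0 | S k' => ecoef k' x end.
Definition udiff (k : nat) (x : R) : R := ecoef k x - ecoef_pred k x.

Lemma is_derive_ecoef k x : is_derive (ecoef k) x (exp (- x) * (dlag k x - lag k x)).
Proof.
apply is_derive_eq with (- exp (- x) * lag k x + exp (- x) * dlag k x); [|ring].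
apply (is_derive_Rmult (fun y => exp (- y)) (lag k)); [|apply is_derive_lag].
auto_derive; auto; ring.
Qed.

(** Coefficient form of [(1 - z) dE/dx = - (1 + z) E]: [udiff] holds the coefficients of
    [(1 - z) E_x]. *)
Lemma is_derive_udiff k x : is_derive (udiff k) x (- (ecoef k x + ecoef_pred k x)).
Proof.
destruct k as [|k].
- apply (is_derive_Rext (ecoef 0)); [intros; unfold udiff, ecoef_pred; ring|].
  apply is_derive_eq with (1 := is_derive_ecoef 0 x).
  unfold ecoef_pred, ecoef, dlag, lag; simpl rsum; rewrite geo_S0; unfold geo; simpl; field.
- apply (is_derive_Rext (fun y => ecoef (S k) y - ecoef k y)); [reflexivity|].
  apply is_derive_eq with (minus (exp (- x) * (dlag (S k) x - lag (S k) x)) (exp (- x) * (dlag k x - lag k x))).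
  + apply (is_derive_minus (ecoef (S k)) (ecoef k)); apply is_derive_ecoef.
  + unfold minus, plus, opp; simpl; rewrite dlag_S; unfold ecoef_pred, ecoef; ring.
Qed.

(* [lowmass k x] is the squared norm of the first [k + 1] coefficients of [(1 - z) inner x z];
   it decreases from [2] to [0], with derivative [- 2 (ecoef k)^2]. *)
Definition lowmass (k : nat) (x : R) : R := rsum (fun i => udiff i x ^ 2) (S k).

(** The derivatives of the terms are differences of consecutive squares, so their sum telescopes. *)
Lemma is_derive_lowmass k x : is_derive (lowmass k) x (-2 * ecoef k x ^ 2).
Proof.
apply is_derive_eq with (rsum (fun i => - (ecoef i x + ecoef_pred i x) * udiff i x
   + udiff i x * - (ecoef i x + ecoef_pred i x)) (S k)).
- apply (is_derive_rsum (fun i y => udiff i y ^ 2) (fun i y => - (ecoef i y + ecoef_pred i y) * udiff i y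
   + udiff i y * - (ecoef i y + ecoef_pred i y))).
  intros i; apply (is_derive_Rext (fun y => udiff i y * udiff i y)); [intros; ring|].
  apply (is_derive_Rmult (udiff i) (udiff i)); apply is_derive_udiff.
- induction k as [|k IH].
  + unfold udiff, ecoef_pred; simpl; ring.
  + change (rsum ?u (S (S k))) with (rsum u (S k) + u (S k)); rewrite IH.
    unfold udiff, ecoef_pred; ring.
Qed.

(** Its derivative telescopes too, to [- 2 e_k e_(k-1)]. This supplies the mixed term in a primitive
    [uprim] of [(e_k - e_(k-1))^2]; summing [uprim] gives a closed primitive of [lowmass]. *)
Definition crossmass (k : nat) (x : R) : R := rsum (fun i => udiff (S i) x * udiff i x) k.

Lemma is_derive_crossmass k x : is_derive (crossmass k) x (-2 * ecoef k x * ecoef_pred k x).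
Proof.
apply is_derive_eq with (rsum (fun i => - (ecoef (S i) x + ecoef_pred (S i) x) * udiff i x
   + udiff (S i) x * - (ecoef i x + ecoef_pred i x)) k).
- apply (is_derive_rsum (fun i y => udiff (S i) y * udiff i y)
    (fun i y => - (ecoef (S i) y + ecoef_pred (S i) y) * udiff i y
   + udiff (S i) y * - (ecoef i y + ecoef_pred i y))).
  intros i; apply (is_derive_Rmult (udiff (S i)) (udiff i)); apply is_derive_udiff.
- induction k as [|k IH]; [simpl; ring|].
  change (rsum ?u (S k)) with (rsum u k + u k); rewrite IH.
  unfold udiff; simpl ecoef_pred; ring.
Qed.

Definition lowmass_pred (k : nat) (x : R) : R := match k with O => 0 | S k' => lowmass k' x end.
Definition uprim (k : nat) (x : R) : R := - (lowmass k x + lowmass_pred k x - 2 * crossmass k x) / 2.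
Definition lowprim (k : nat) (x : R) : R := rsum (fun i => uprim i x) (S k).

Lemma is_derive_uprim k x : is_derive (uprim k) x (udiff k x ^ 2).
Proof.
assert (Hp : is_derive (lowmass_pred k) x (-2 * ecoef_pred k x ^ 2)).
{ destruct k as [|k]; [|apply is_derive_lowmass].
  apply is_derive_eq with 0; [apply (is_derive_Rconst 0 x)|simpl; ring]. }
assert (H1 := is_derive_lowmass k x); assert (H2 := is_derive_crossmass k x).
apply (is_derive_Rext (fun y => (- / 2) * (lowmass k y + lowmass_pred k y) + crossmass k y)).
{ intros y; unfold uprim; field. }
apply is_derive_eq with (plus ((- / 2) * plus (-2 * ecoef k x ^ 2) (-2 * ecoef_pred k x ^ 2))
   (-2 * ecoef k x * ecoef_pred k x)).
- apply (is_derive_plus (fun y => (- / 2) * (lowmass k y + lowmass_pred k y)) (crossmass k)); auto.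
  apply (is_derive_scal (fun y => lowmass k y + lowmass_pred k y)).
  apply (is_derive_plus (lowmass k) (lowmass_pred k)); auto.
- unfold plus; simpl; unfold udiff; field.
Qed.

Lemma is_derive_lowprim k x : is_derive (lowprim k) x (lowmass k x).
Proof.
apply (is_derive_rsum uprim (fun i y => udiff i y ^ 2)); intros i; apply is_derive_uprim.
Qed.

Lemma ecoef_at0 k : ecoef k 0 = match k with O => 1 | S _ => 0 end.
Proof.
unfold ecoef, lag; rewrite Ropp_0, exp_0, rsum_shift.
rewrite rsum_eq0.
- destruct k; unfold geo; simpl; field.
- intros j _; rewrite Rmult_0_r; simpl; unfold Rdiv; rewrite !Rmult_0_l; ring.
Qed.

Lemma udiff_at0 k : udiff k 0 = match k with O => 1 | 1%nat => -1 | _ => 0 end.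
Proof.
unfold udiff; rewrite ecoef_at0; destruct k as [|k]; simpl; [ring|].
rewrite ecoef_at0; destruct k; ring.
Qed.

Lemma lowmass_at0 k : lowmass (S k) 0 = 2.
Proof.
unfold lowmass; rewrite !rsum_shift, !udiff_at0.
rewrite rsum_eq0; [ring|].
intros i _; rewrite udiff_at0; ring.
Qed.

Lemma crossmass_at0 k : crossmass (S k) 0 = -1.
Proof.
unfold crossmass; rewrite rsum_shift, !udiff_at0.
rewrite rsum_eq0; [ring|].
intros i _; rewrite udiff_at0; ring.
Qed.

(** The terms of index 0 and 1 are [-1/2] and [-5/2]; every later one is [-3]. *)
Lemma lowprim_at0 k : lowprim (S k) 0 = -3 * INR (S k).
Proof.
induction k as [|k IH].
- assert (L0 : lowmass 0 0 = 1) by (unfold lowmass; simpl rsum; rewrite udiff_at0; ring).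
  unfold lowprim; simpl rsum; unfold uprim; simpl lowmass_pred.
  rewrite (lowmass_at0 0), (crossmass_at0 0), L0; unfold crossmass; simpl; field.
- unfold lowprim in *; change (rsum ?u (S (S (S k)))) with (rsum u (S (S k)) + u (S (S k))).
  rewrite IH; unfold uprim; simpl lowmass_pred.
  rewrite !lowmass_at0, crossmass_at0, !S_INR; field.
Qed.

Lemma lowmass_ge0 k x : 0 <= lowmass k x.
Proof. apply rsum_ge0; intros; apply pow2_ge_0. Qed.

Lemma lowmass_mono j k x : (j <= k)%nat -> lowmass j x <= lowmass k x.
Proof. intros H; apply rsum_mono; [intros; apply pow2_ge_0|lia]. Qed.

Lemma lowmass_decr k x y : x <= y -> lowmass k y <= lowmass k x.
Proof.
intros H; apply Ropp_le_cancel.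
apply (le_of_derive (fun t => - lowmass k t) (fun t => - (-2 * ecoef k t ^ 2))); auto.
- intros t; apply (is_derive_opp (lowmass k)), is_derive_lowmass.
- intros t _; generalize (pow2_ge_0 (ecoef k t)); lra.
Qed.

(** From [2 u v >= - u^2 - v^2] for neighbouring terms, the two end terms being counted only
    once. *)
Lemma crossmass_ge k x : - lowmass k x <= crossmass k x.
Proof.
assert (P : - (2 * lowmass k x - udiff k x ^ 2 - udiff 0 x ^ 2) <= 2 * crossmass k x).
{ unfold lowmass, crossmass; induction k as [|k IH]; [simpl; lra|].
  change (rsum ?u (S (S k))) with (rsum u (S k) + u (S k)).
  change (rsum (fun i => udiff (S i) x * udiff i x) (S k))
    with (rsum (fun i => udiff (S i) x * udiff i x) k + udiff (S k) x * udiff k x).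
  generalize (pow2_ge_0 (udiff (S k) x + udiff k x)); nra. }
generalize (pow2_ge_0 (udiff k x)) (pow2_ge_0 (udiff 0 x)); lra.
Qed.

Lemma lowprim_ge k x : -2 * INR (S k) * lowmass k x <= lowprim k x.
Proof.
unfold lowprim; rewrite Rmult_assoc, (Rmult_comm (-2)), Rmult_assoc, <- rsum_const.
apply rsum_le; intros i Hi.
assert (L := lowmass_mono i k x ltac:(lia)).
assert (C := crossmass_ge i x); unfold uprim.
assert (P : lowmass_pred i x <= lowmass i x).
{ destruct i as [|i]; [apply lowmass_ge0|apply lowmass_mono; lia]. }
lra.
Qed.

Lemma lag_bound k x : 0 <= x -> Rabs (lag k x) <= 4 ^ k * exp (2 * x / 3).
Proof.
intros Hx; unfold lag.
apply Rle_trans with (rsum (fun j => 4 ^ k * (/ INR (fact j) * (2 * x / 3) ^ j)) (S k)).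
- generalize (S k); intros n; induction n as [|n IH]; simpl rsum; [rewrite Rabs_R0; lra|].
  eapply Rle_trans; [apply Rabs_triang|]; apply Rplus_le_compat; auto.
  assert (G := geo_le n k); assert (G0 := geo_ge0 n k).
  assert (H3 : 0 < 3 ^ n) by (apply pow_lt; lra).
  replace (-2 * x) with (- (2 * x)) by ring.
  unfold Rdiv; rewrite !Rabs_mult, (Rabs_pos_eq (geo n k)), <- RPow_abs, Rabs_Ropp by auto.
  rewrite (Rabs_pos_eq (2 * x)) by lra.
  rewrite Rabs_pos_eq by (apply Rlt_le, Rinv_fact_pos).
  replace (geo n k * ((2 * x) ^ n * / INR (fact n)))
    with (geo n k * 3 ^ n * (/ INR (fact n) * (2 * x * / 3) ^ n)).
  + apply Rmult_le_compat_r; auto; apply Rmult_le_pos; [apply Rlt_le, Rinv_fact_pos|apply pow_le; lra].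
  + rewrite !Rpow_mult_distr, pow_inv; field; split; [apply INR_fact_neq_0|lra].
- rewrite rsum_scal; apply Rmult_le_compat_l; [apply pow_le; lra|].
  rewrite <- (is_series_unique _ _ (exp_series (2 * x / 3))).
  apply rsum_le_Series; [|eexists; apply exp_series].
  intros n; apply Rmult_le_pos; [apply Rlt_le, Rinv_fact_pos|apply pow_le; lra].
Qed.

Lemma ecoef_bound i k x : 0 <= x -> (i <= k)%nat -> Rabs (ecoef i x) <= 4 ^ k * exp (- x / 3).
Proof.
intros Hx Hi; unfold ecoef.
rewrite Rabs_mult, (Rabs_pos_eq (exp (- x))) by (apply Rlt_le, exp_pos).
replace (- x / 3) with (- x + 2 * x / 3) by field; rewrite exp_plus.
replace (4 ^ k * (exp (- x) * exp (2 * x / 3))) with (exp (- x) * (4 ^ k * exp (2 * x / 3))) by ring.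
apply Rmult_le_compat_l; [apply Rlt_le, exp_pos|].
eapply Rle_trans; [apply lag_bound, Hx|].
apply Rmult_le_compat_r; [apply Rlt_le, exp_pos|apply Rle_pow; [lra|exact Hi]].
Qed.

(** At [x = 30 n] the decay [exp (- x / 3) = exp (- 10 n)] beats the factor [4^n] of [ecoef_bound]
    and the polynomial factors. *)
Lemma lowmass_far k : lowmass (S k) (30 * INR (S k)) * INR (S (S k)) <= INR (S k) / 512.
Proof.
set (n := S k); set (X := 30 * INR n).
assert (Hn : 1 <= INR n) by (apply INR_ge1; unfold n; lia).
assert (HX : 0 <= X) by (unfold X; lra).
assert (He : exp (- X / 3) <= (1 / 2) ^ (10 * n)).
{ replace (- X / 3) with (INR (10 * n) * - (1)) by (unfold X; rewrite mult_INR; simpl; field).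
  replace (exp (INR (10 * n) * - (1))) with (exp (- (1)) ^ (10 * n)).
  - apply pow_incr; split; [apply Rlt_le, exp_pos|].
    rewrite exp_Ropp; replace (1 / 2) with (/ 2) by field; apply Rinv_le_contravar; [lra|].
    generalize (exp_ineq1 1 ltac:(lra)); lra.
  - rewrite <- Rpower_pow by apply exp_pos; unfold Rpower; rewrite ln_exp; reflexivity. }
set (B := 4 ^ n * (1 / 2) ^ (10 * n)).
assert (HB : 0 < B) by (apply Rmult_lt_0_compat; apply pow_lt; lra).
assert (Hu : forall i, (i <= n)%nat -> udiff i X ^ 2 <= (2 * B) ^ 2).
{ assert (Hec : forall i, (i <= n)%nat -> Rabs (ecoef i X) <= B).
  { intros i Hi; eapply Rle_trans; [apply (ecoef_bound i n); auto|].
    apply Rmult_le_compat_l; [apply pow_le; lra|exact He]. }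
  intros i Hi; rewrite <- (pow2_abs (udiff i X)); apply pow_incr; split; [apply Rabs_pos|].
  unfold udiff; eapply Rle_trans; [apply Rabs_triang|]; rewrite Rabs_Ropp.
  assert (Rabs (ecoef_pred i X) <= B).
  { destruct i as [|i]; [simpl; rewrite Rabs_R0; lra|apply Hec; lia]. }
  specialize (Hec i Hi); lra. }
assert (HL : lowmass n X <= INR (S n) * (2 * B) ^ 2).
{ unfold lowmass; rewrite <- rsum_const; apply rsum_le; intros i Hi; apply Hu; lia. }
assert (HSn : INR (S n) <= 2 * INR n) by (rewrite S_INR; lra).
assert (Hpow : INR n <= 2 ^ n).
{ clear; induction n as [|n IH]; [simpl; lra|]; rewrite S_INR; simpl.
  assert (1 <= 2 ^ n) by (apply pow_R1_Rle; lra); lra. }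
assert (HBn : B * 2 ^ n <= (1 / 2) ^ 7).
{ unfold B; rewrite pow_mult.
  replace (4 ^ n * ((1 / 2) ^ 10) ^ n * 2 ^ n) with (((1 / 2) ^ 7) ^ n)
    by (rewrite <- !Rpow_mult_distr; f_equal; field).
  rewrite <- (pow_1 ((1 / 2) ^ 7)) at 2; apply pow_le_pow_base; [|unfold n; lia].
  simpl; lra. }
apply Rle_trans with (2 * INR n * (2 * B) ^ 2 * (2 * INR n)).
{ apply Rmult_le_compat; auto; [apply lowmass_ge0|apply pos_INR|].
  eapply Rle_trans; [exact HL|]; apply Rmult_le_compat_r; [apply pow2_ge_0|exact HSn]. }
replace (2 * INR n * (2 * B) ^ 2 * (2 * INR n)) with (INR n * (16 * ((B * INR n) * B))) by ring.
unfold Rdiv; apply Rmult_le_compat_l; [lra|].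
assert (H1 : 0 <= B * INR n <= (1 / 2) ^ 7).
{ split; [apply Rmult_le_pos; lra|]; eapply Rle_trans; [|exact HBn].
  apply Rmult_le_compat_l; lra. }
assert (H2 : B <= (1 / 2) ^ 7).
{ eapply Rle_trans; [|exact HBn]; assert (1 <= 2 ^ n) by (apply pow_R1_Rle; lra); nra. }
apply Rle_trans with (16 * ((1 / 2) ^ 7 * (1 / 2) ^ 7)); [|simpl; lra].
apply Rmult_le_compat_l; [lra|]; apply Rmult_le_compat; lra.
Qed.

(* The primitive [lowprim] starts at [-3k] and is almost nonnegative at [30k], while its
   derivative [lowmass] is at most [2] and decreasing: so [lowmass] is still of order one at [k/2]. *)
Lemma lowmass_drop k a b :
  (1 <= k)%nat -> a <= INR k / 2 -> 30 * INR k <= b -> / 40 <= lowmass k a - lowmass k b.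
Proof.
intros Hk Ha Hb; destruct k as [|k]; [lia|]; set (n := S k) in *.
assert (Hn : 1 <= INR n) by (apply INR_ge1; unfold n; lia).
assert (Hfar := lowmass_far k); fold n in Hfar.
assert (Hlast := lowprim_ge n (30 * INR n)).
assert (H0 := lowprim_at0 k); fold n in H0.
(* On [[0, n / 2]] the derivative is at most its value 2 at 0, so [lowprim] is still at most [- 2 n]
   at [n / 2]. *)
assert (H1 : lowprim n (INR n / 2) - lowprim n 0 <= INR n).
{ assert (T := le_of_derive (fun x => 2 * x - lowprim n x) (fun x => 2 - lowmass n x) 0 (INR n / 2)).
  cbv beta in T; cut (2 * 0 - lowprim n 0 <= 2 * (INR n / 2) - lowprim n (INR n / 2)); [lra|].
  apply T; [lra| |].
  - intros x; apply (is_derive_minus (fun x => 2 * x) (lowprim n)); [|apply is_derive_lowprim].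
    auto_derive; auto; ring.
  - intros x Hx; assert (L := lowmass_decr n 0 x ltac:(lra)).
    unfold n in L; rewrite lowmass_at0 in L; unfold n; lra. }
set (l := lowmass n (INR n / 2)).
(* From [- 2 n] it has to climb back almost to 0 over a length below [30 n], at rate at most [l].
   Hence [l] is at least about [2 / 30], above [1 / 16]. *)
assert (H2 : lowprim n (30 * INR n) - lowprim n (INR n / 2) <= l * (30 * INR n)).
{ assert (T := le_of_derive (fun x => l * x - lowprim n x) (fun x => l - lowmass n x) (INR n / 2) (30 * INR n)).
  cbv beta in T.
  cut (l * (INR n / 2) - lowprim n (INR n / 2) <= l * (30 * INR n) - lowprim n (30 * INR n)).
  { assert (0 <= l) by apply lowmass_ge0; nra. }
  apply T; [lra| |].
  - intros x; apply (is_derive_minus (fun x => l * x) (lowprim n)); [|apply is_derive_lowprim].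
    auto_derive; auto; ring.
  - intros x Hx; assert (L := lowmass_decr n (INR n / 2) x ltac:(lra)); fold l in L; lra. }
assert (Da := lowmass_decr n a (INR n / 2) Ha); fold l in Da.
assert (Db := lowmass_decr n (30 * INR n) b Hb).
assert (Hl : / 16 <= l).
{ apply Rmult_le_reg_r with (30 * INR n); [lra|]; nra. }
assert (Hf : lowmass n (30 * INR n) <= / 512).
{ assert (lowmass n (30 * INR n) * INR n <= INR n / 512).
  { eapply Rle_trans; [|exact Hfar]; apply Rmult_le_compat_l; [apply lowmass_ge0|apply le_INR; lia]. }
  apply Rmult_le_reg_r with (INR n); lra. }
lra.
Qed.

(** * Slow oscillation is necessary *)

Definition mobius (a : R) (z : C) : C := ((RtoC a + z) / (1 + RtoC a * z))%C.

Section Mobius.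
Variable a : R.
Hypothesis Ha : Rabs a < 1.

Let Haz z : in_disk z -> Cmod (- RtoC a * z)%C < 1.
Proof.
intros Hz; unfold in_disk in Hz; rewrite Cmod_mult, Cmod_opp, Cmod_R.
generalize (Cmod_ge_0 z) (Rabs_pos a); nra.
Qed.

Let mobius_den z : in_disk z -> (1 + RtoC a * z)%C <> 0%C.
Proof.
intros Hz; replace (1 + RtoC a * z)%C with (1 - (- RtoC a * z))%C by ring.
apply one_minus_neq0; exact (Haz z Hz).
Qed.

Lemma mobius_disk z : in_disk z -> in_disk (mobius a z).
Proof.
intros Hz; assert (Hd := mobius_den z Hz); unfold mobius, in_disk.
assert (Hp : 0 < Cmod (1 + RtoC a * z)%C) by (apply Cmod_gt_0, Hd).
rewrite Cmod_div by exact Hd.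
apply Rmult_lt_reg_r with (Cmod (1 + RtoC a * z)%C); auto.
unfold Rdiv; rewrite Rmult_assoc, Rinv_l, Rmult_1_r, Rmult_1_l by lra.
assert (Hz2 : Cmod z ^ 2 < 1) by (unfold in_disk in Hz; generalize (Cmod_ge_0 z); simpl; nra).
assert (Ha2 : a ^ 2 < 1) by (rewrite <- (pow2_abs a); generalize (Rabs_pos a); simpl; nra).
assert (E : Cmod (1 + RtoC a * z)%C ^ 2 - Cmod (RtoC a + z)%C ^ 2 = (1 - a ^ 2) * (1 - Cmod z ^ 2)).
{ rewrite !Cmod2_alt; destruct z; simpl; ring. }
assert (0 < (1 - a ^ 2) * (1 - Cmod z ^ 2)) by (apply Rmult_lt_0_compat; lra).
apply Rnot_le_lt; intros Hle.
assert (Cmod (1 + RtoC a * z)%C ^ 2 <= Cmod (RtoC a + z)%C ^ 2) by (apply pow_incr; lra); lra.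
Qed.

(** Geometric series for [a + (1 - a^2) z / (1 + a z)]. *)
Lemma has_expansion_mobius :
  has_expansion (mobius a)
    (fun k => match k with O => RtoC a | S k' => RtoC (1 - a ^ 2) * (- RtoC a) ^ k' end)%C.
Proof.
set (b := fun k : nat => _).
assert (H : forall z, in_disk z ->
   absC (fun k => b k * z ^ k)%C /\ psum b z = mobius a z).
{ intros z Hz; destruct (geometric_C _ (Haz z Hz)) as [G1 G2].
  assert (E : forall k, (b (1 + k)%nat * z ^ (1 + k))%C
     = (RtoC (1 - a ^ 2) * z * (- RtoC a * z) ^ k)%C).
  { intros k; change (1 + k)%nat with (S k); unfold b; rewrite Cpow_S, Cpow_mult_l; ring. }
  assert (Hb : absC (fun k => b k * z ^ k)%C).
  { apply (absC_shift _ 1), absC_ext with (fun k => RtoC (1 - a ^ 2) * z * (- RtoC a * z) ^ k)%C.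
    - intros k; symmetry; apply E.
    - apply absC_scal, G1. }
  split; [exact Hb|].
  unfold psum; rewrite (Csum_split _ 1), (Csum_ext _ _ E) by exact Hb.
  rewrite (Csum_scal _ (fun k => (- RtoC a * z) ^ k)%C G1), G2.
  unfold mobius; simpl csum; rewrite RtoC_minus, RtoC_pow.
  assert (Hd := mobius_den z Hz); field; exact Hd. }
apply has_expansion_intro.
- intros r Hr.
  assert (Hz : in_disk (RtoC r)) by (apply in_disk_R; lra).
  refine (ex_series_ext _ _ _ (proj1 (H _ Hz))); intros k; cbv beta.
  rewrite Cmod_mult, Cmod_pow, Cmod_R, Rabs_pos_eq; lra.
- intros z Hz; symmetry; apply H, Hz.
Qed.

Lemma mobius_symbol : symbol (mobius a).
Proof.
split; [exact mobius_disk|]; split.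
- intros z Hz; apply (has_expansion_analytic _ _ z has_expansion_mobius Hz).
- assert (H0 : in_disk 0%C) by exact in_disk_0.
  assert (H1 : in_disk (RtoC (1 / 2))) by (apply in_disk_R; lra).
  exists 0%C, (RtoC (1 / 2)); split; [exact H0|]; split; [exact H1|].
  assert (Hd := mobius_den _ H1).
  assert (Hd' : 1 + a * (1 / 2) <> 0).
  { intros Ez; apply Hd; rewrite <- RtoC_mult, <- RtoC_plus, Ez; reflexivity. }
  assert (M0 : mobius a 0 = RtoC a).
  { unfold mobius; rewrite Cmult_0_r, !Cplus_0_r; field. }
  assert (M1 : mobius a (RtoC (1 / 2)) = RtoC ((a + 1 / 2) / (1 + a * (1 / 2)))).
  { unfold mobius; rewrite (RtoC_div _ _ Hd'), !RtoC_plus, (RtoC_mult a); reflexivity. }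
  rewrite M0, M1; intros E; apply RtoC_inj in E.
  apply (f_equal (fun x => x * (1 + a * (1 / 2)))) in E.
  unfold Rdiv in E; rewrite (Rmult_assoc (a + _)), Rinv_l in E by exact Hd'.
  apply Rabs_def2 in Ha; nra.
Qed.
End Mobius.

(** The parameter is chosen so that [cayley] conjugates the automorphism to the dilation by
    [lam]. *)
Lemma cayley_mobius lam z :
  0 < lam -> in_disk z -> cayley (mobius ((lam - 1) / (lam + 1)) z) = (RtoC lam * cayley z)%C.
Proof.
intros Hl Hz; unfold cayley, mobius.
assert (Hn := one_minus_neq0 z Hz).
assert (Hl1 : RtoC (lam + 1) <> 0%C) by (intros E; apply RtoC_inj in E; lra).
(* Divided by [1 - z] this is [1 + lam * cayley z], whose real part is positive. *)
assert (H1 : (RtoC (lam + 1) + RtoC (lam - 1) * z)%C <> 0%C).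
{ intros E.
  assert (F : (1 + RtoC lam * cayley z)%C = 0%C).
  { unfold cayley.
    transitivity ((RtoC (lam + 1) + RtoC (lam - 1) * z) / (1 - z))%C.
    - rewrite RtoC_minus, RtoC_plus; field; exact Hn.
    - rewrite E; unfold Cdiv; ring. }
  apply (f_equal Re) in F.
  change (1 + Re (RtoC lam * cayley z)%C = 0) in F; rewrite re_scal_l in F.
  generalize (Re_cayley z Hz); nra. }
assert (Hd : forall w, (RtoC ((lam - 1) / (lam + 1)) * w)%C = (RtoC (lam - 1) * w / RtoC (lam + 1))%C).
{ intros w; rewrite RtoC_div by lra; field; exact Hl1. }
replace ((RtoC ((lam - 1) / (lam + 1)) + z) / (1 + RtoC ((lam - 1) / (lam + 1)) * z))%C
  with ((RtoC (lam - 1) + RtoC (lam + 1) * z) / (RtoC (lam + 1) + RtoC (lam - 1) * z))%C.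
- rewrite !RtoC_minus, !RtoC_plus in *; field; repeat split; auto.
  intros E; apply Hn.
  assert (E2 : (RtoC 2 * (1 - z))%C = 0%C) by (rewrite <- E; ring).
  replace (1 - z)%C with (/ RtoC 2 * (RtoC 2 * (1 - z)))%C.
  + rewrite E2; ring.
  + field.
- rewrite Hd, RtoC_div by lra; field; auto.
Qed.

Lemma inner_mobius lam x z :
  0 < lam -> in_disk z -> inner x (mobius ((lam - 1) / (lam + 1)) z) = inner (lam * x) z.
Proof.
intros Hl Hz; unfold inner; rewrite cayley_mobius by auto; f_equal.
replace (- (lam * x)) with (- x * lam) by ring; rewrite RtoC_mult; ring.
Qed.

Lemma mobius_param lam : 0 < lam -> Rabs ((lam - 1) / (lam + 1)) < 1.
Proof.
intros Hl; apply Rabs_def1; apply Rmult_lt_reg_r with (lam + 1); try lra;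
  unfold Rdiv; rewrite Rmult_assoc, Rinv_l; lra.
Qed.

Lemma continuity_pt_ecoef k x : continuity_pt (ecoef k) x.
Proof.
apply derivable_continuous_pt; exists (exp (- x) * (dlag k x - lag k x)).
apply is_derive_Reals, is_derive_ecoef.
Qed.

(** * Baire category on nested intervals *)

Definition in_order (lo hi : R) (I : R * R) : Prop := lo <= fst I /\ fst I < snd I /\ snd I <= hi.

Section BaireInterval.
Variable bad : nat -> R -> Prop.
Hypothesis Hstep : forall lo hi n, 0 < lo < hi ->
  exists I, in_order lo hi I /\ forall s, fst I <= s <= snd I -> bad n s.

(** The default branch serves intervals that are degenerate or not positive, which the nested
    sequence never meets. *)
Let step (n : nat) (I : R * R) : R * R :=
  match Rlt_dec 0 (fst I), Rlt_dec (fst I) (snd I) with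
  | left H1, left H2 => proj1_sig (constructive_indefinite_description _ (Hstep (fst I) (snd I) n (conj H1 H2)))
  | _, _ => I
  end.

Fixpoint intervals (I0 : R * R) (n : nat) : R * R :=
  match n with O => I0 | S k => step k (intervals I0 k) end.

(** The supremum of the left endpoints of the nested intervals lies in all of them. *)
Lemma baire_interval lo hi : 0 < lo < hi -> exists s, lo <= s <= hi /\ forall n, bad n s.
Proof.
intros Hlh; set (I := intervals (lo, hi)).
assert (Hs : forall n J, 0 < fst J < snd J ->
   in_order (fst J) (snd J) (step n J) /\ forall s, fst (step n J) <= s <= snd (step n J) -> bad n s).
{ intros n J [H1 H2]; unfold step.
  destruct (Rlt_dec 0 (fst J)) as [H1'|]; [|lra].
  destruct (Rlt_dec (fst J) (snd J)) as [H2'|]; [|lra].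
  exact (proj2_sig (constructive_indefinite_description _ (Hstep _ _ n (conj H1' H2')))). }
assert (Hpos : forall n, lo <= fst (I n) /\ fst (I n) < snd (I n)).
{ induction n as [|n IH]; [simpl; lra|].
  destruct (Hs n (I n) ltac:(lra)) as [[A [B C]] _]; unfold I in *; simpl in *; lra. }
assert (Hnest : forall n m, (n <= m)%nat -> fst (I n) <= fst (I m) /\ snd (I m) <= snd (I n)).
{ intros n m Hnm; induction Hnm as [|m Hnm IH]; [lra|].
  destruct (Hpos m); destruct (Hs m (I m) ltac:(lra)) as [[A [B C]] _].
  unfold I in *; simpl in *; lra. }
destruct (completeness (fun x => exists n, x = fst (I n))) as [s [S1 S2]].
- exists hi; intros x [n ->]; destruct (Hnest O n ltac:(lia)); destruct (Hpos n).
  unfold I in *; simpl in *; lra.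
- exists lo, O; reflexivity.
- assert (Hin : forall n, fst (I n) <= s <= snd (I n)).
  { intros n; split; [apply S1; eauto|]; apply S2; intros x [m ->].
    destruct (Hnest n (max n m) ltac:(lia)); destruct (Hnest m (max n m) ltac:(lia)).
    destruct (Hpos (max n m)); lra. }
  exists s; split; [apply (Hin O)|]; intros n.
  destruct (Hpos n); apply (proj2 (Hs n (I n) ltac:(lra))), (Hin (S n)).
Qed.
End BaireInterval.

Section SlowOscillation.
Variable beta : nat -> R.
Hypothesis Hpos : forall n, 0 < beta n.
Hypothesis Hall : forall phi, symbol phi -> composition_bounded beta phi.

Definition inner_gram (a : nat -> C) (d L : nat) (s : R) : R :=
  rsum (fun k => Cmod (csum (fun n => a n * RtoC (ecoef k (s * INR n)))%C d) ^ 2 * beta k) L.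

(** With polynomials and finite sections, each violation is a strict inequality in a function
    continuous in [s], so it persists on an interval. *)
Definition inner_bounded (s M : R) : Prop :=
  forall a d L, inner_gram a d L s <= M * rsum (fun n => Cmod (a n) ^ 2 * beta n) d.

Lemma weight_sum_ge0 (a : nat -> C) d : 0 <= rsum (fun n => Cmod (a n) ^ 2 * beta n) d.
Proof. apply rsum_ge0; intros; apply Rmult_le_pos; [apply pow2_ge_0|apply Rlt_le, Hpos]. Qed.

Lemma inner_bounded_mono s M M' : M <= M' -> inner_bounded s M -> inner_bounded s M'.
Proof.
intros HM H a d L; eapply Rle_trans; [apply H|].
apply Rmult_le_compat_r; [apply weight_sum_ge0|exact HM].
Qed.

Lemma inner_bounded_ex s : 0 < s -> exists M, inner_bounded s M.
Proof.
intros Hs; destruct (polynomial_bound beta (inner s) _ Hpos (fun z => inner_disk s z Hs)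
  (has_expansion_inner s) (Hall _ (inner_symbol s Hs))) as (M & _ & H).
exists M; intros a d L; eapply Rle_trans; [|apply (H a d L)].
right; apply rsum_ext; intros k _; do 3 f_equal; apply csum_ext; intros n _.
rewrite cpow_inner; reflexivity.
Qed.

(** [f o E_(lam s)] is [f o E_s] composed with the automorphism. As [f o E_s] is no longer a
    polynomial, the automorphism is used through the full coefficient form of boundedness. *)
Lemma inner_bounded_scale lam :
  0 < lam -> exists M, 0 <= M /\ forall s K, 0 < s -> inner_bounded s K -> inner_bounded (lam * s) (M * K).
Proof.
intros Hl; assert (Hp := mobius_param lam Hl); set (al := (lam - 1) / (lam + 1)) in *.
destruct (composition_bounded_coef beta (mobius al) Hpos (Hall _ (mobius_symbol al Hp))) as (M & HM & H).
exists M; split; auto; intros s K Hs HK a d L.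
set (f := compose (inner s) (peval a d)).
assert (Hf : forall t, 0 < t -> has_expansion (compose (inner t) (peval a d))
   (comp_coef (fun k => RtoC (ecoef k t)) (trunc a d))).
{ intros t Ht; apply has_expansion_compose; [apply has_expansion_peval|apply has_expansion_inner|].
  intros z; apply inner_disk, Ht. }
assert (Hc : forall t k, comp_coef (fun k => RtoC (ecoef k t)) (trunc a d) k
   = csum (fun n => a n * RtoC (ecoef k (t * INR n)))%C d).
{ intros t k; rewrite comp_coef_trunc; apply csum_ext; intros n _; rewrite cpow_inner; reflexivity. }
assert (Hls : 0 < lam * s) by (apply Rmult_lt_0_compat; auto).
assert (Hg : has_expansion (compose (mobius al) f) (comp_coef (fun k => RtoC (ecoef k (lam * s))) (trunc a d))).
{ refine (has_expansion_ext _ _ _ _ (Hf _ Hls)); intros z Hz; unfold compose, f, compose.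
  unfold al; rewrite inner_mobius; auto. }
set (c := comp_coef (fun k => RtoC (ecoef k s)) (trunc a d)).
assert (Hc1 : forall n, 0 <= Cmod (c n) ^ 2 * beta n)
  by (intros; apply Rmult_le_pos; [apply pow2_ge_0|apply Rlt_le, Hpos]).
assert (Hb : forall N, rsum (fun n => Cmod (c n) ^ 2 * beta n) N <= K * rsum (fun n => Cmod (a n) ^ 2 * beta n) d).
{ intros N; eapply Rle_trans; [|apply (HK a d N)]; right; apply rsum_ext; intros k _.
  unfold c; rewrite Hc; reflexivity. }
assert (Hex : ex_series (fun n => Cmod (c n) ^ 2 * beta n)) by (eapply ex_series_bounded; eauto).
apply Rle_trans with (M * Series (fun n => Cmod (c n) ^ 2 * beta n)).
- eapply Rle_trans; [|apply (H f c _ (Hf s Hs) Hg Hex L)].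
  right; apply rsum_ext; intros k _; rewrite Hc; reflexivity.
- rewrite Rmult_assoc; apply Rmult_le_compat_l; auto; apply Series_le_bound; auto.
Qed.

Lemma continuity_inner_gram a d L s : continuity_pt (inner_gram a d L) s.
Proof.
unfold inner_gram.
apply (continuity_pt_rsum (fun k s => Cmod (csum (fun n => a n * RtoC (ecoef k (s * INR n)))%C d) ^ 2 * beta k)).
intros k.
assert (He : forall n, continuity_pt (fun t => ecoef k (t * INR n)) s).
{ intros n; apply (continuity_pt_comp (fun t => t * INR n) (ecoef k)); [|apply continuity_pt_ecoef].
  apply derivable_continuous_pt; reg. }
apply continuity_pt_ext with (fun t =>
  (rsum (fun n => Re (a n) * ecoef k (t * INR n)) d * rsum (fun n => Re (a n) * ecoef k (t * INR n)) d
   + rsum (fun n => Im (a n) * ecoef k (t * INR n)) d * rsum (fun n => Im (a n) * ecoef k (t * INR n)) d) * beta k).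
- intros t; rewrite Cmod2_alt, Re_csum, Im_csum.
  rewrite (rsum_ext (fun n => Re (a n * RtoC (ecoef k (t * INR n)))%C) (fun n => Re (a n) * ecoef k (t * INR n)))
    by (intros; apply re_scal_r).
  rewrite (rsum_ext (fun n => Im (a n * RtoC (ecoef k (t * INR n)))%C) (fun n => Im (a n) * ecoef k (t * INR n)))
    by (intros; apply im_scal_r).
  ring.
- assert (Hr : forall w : nat -> R, continuity_pt (fun t => rsum (fun n => w n * ecoef k (t * INR n)) d) s).
  { intros w; apply (continuity_pt_rsum (fun n t => w n * ecoef k (t * INR n))).
    intros n; apply (continuity_pt_scal (fun t => ecoef k (t * INR n)) (w n)), He. }
  set (F := fun t => rsum (fun n => Re (a n) * ecoef k (t * INR n)) d).
  set (G := fun t => rsum (fun n => Im (a n) * ecoef k (t * INR n)) d).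
  change (continuity_pt (fun t => (F t * F t + G t * G t) * beta k) s).
  apply (continuity_pt_mult (fun t => F t * F t + G t * G t) (fun _ => beta k)).
  + apply (continuity_pt_plus (fun t => F t * F t) (fun t => G t * G t)).
    * apply (continuity_pt_mult F F); apply Hr.
    * apply (continuity_pt_mult G G); apply Hr.
  + apply continuity_pt_const; intros ? ?; reflexivity.
Qed.

Lemma inner_bounded_interval :
  exists p q M, 0 < p < q /\ forall s, p <= s <= q -> inner_bounded s M.
Proof.
apply NNPP; intros Hno.
assert (Hstep : forall lo hi n, 0 < lo < hi ->
  exists I, in_order lo hi I /\ forall s, fst I <= s <= snd I -> ~ inner_bounded s (INR n)).
{ intros lo hi n Hlh.
  (* The violating point is sought in the middle third, so that a neighbourhood of it fits into the
     given interval. *)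
  set (lo' := (2 * lo + hi) / 3); set (hi' := (lo + 2 * hi) / 3).
  assert (Hs : exists s, lo' <= s <= hi' /\ ~ inner_bounded s (INR n)).
  { apply NNPP; intros Hs; apply Hno; exists lo', hi', (INR n); split; [unfold lo', hi'; lra|].
    intros s Hin; apply NNPP; intros Hb; apply Hs; exists s; auto. }
  destruct Hs as (s0 & Hs0 & Hb).
  assert (Hw : exists a d L, INR n * rsum (fun n => Cmod (a n) ^ 2 * beta n) d < inner_gram a d L s0).
  { apply NNPP; intros Hw; apply Hb; intros a d L; apply Rnot_lt_le; intros Hlt; apply Hw; eauto. }
  destruct Hw as (a & d & L & Hlt).
  set (gap := inner_gram a d L s0 - INR n * rsum (fun n => Cmod (a n) ^ 2 * beta n) d) in *.
  assert (Hgap : 0 < gap) by (unfold gap; lra).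
  destruct (continuity_inner_gram a d L s0 gap Hgap) as (del & Hdel & Hc).
  set (e := Rmin (del / 2) ((hi - lo) / 3)).
  assert (He : 0 < e) by (apply Rmin_pos; lra).
  assert (He1 : e <= del / 2) by apply Rmin_l.
  assert (He2 : e <= (hi - lo) / 3) by apply Rmin_r.
  exists (s0 - e, s0 + e); split; [unfold in_order; simpl; unfold lo', hi' in *; lra|].
  simpl; intros s Hin Hbs; specialize (Hbs a d L).
  destruct (Req_dec s s0) as [->|Hne]; [lra|].
  specialize (Hc s); simpl in Hc; unfold R_dist in Hc.
  assert (Hcl : Rabs (inner_gram a d L s - inner_gram a d L s0) < gap).
  { apply Hc; split; [split; [exact I|lra]|].
    apply Rabs_def1; lra. }
  apply Rabs_def2 in Hcl; unfold gap in *; lra. }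
destruct (baire_interval (fun n s => ~ inner_bounded s (INR n)) Hstep 1 2 ltac:(lra)) as (s & Hs & Hbad).
(* This [s] violates every integer bound, although the operator of [E_s] is bounded. *)
destruct (inner_bounded_ex s ltac:(lra)) as [M HM].
destruct (INR_archimed 1 M ltac:(lra)) as [n Hn].
apply (Hbad n), (inner_bounded_mono s M); [lra|exact HM].
Qed.

(** Scaling by [q = p' / p] carries [[p, p']] to the adjacent interval, so its images chain up to
    [[p, q^n p]] for every [n]; a last scaling moves the left end to [s1]. *)
Lemma inner_bounded_uniform s1 s2 :
  0 < s1 -> exists M, 0 <= M /\ forall s, s1 <= s <= s2 -> inner_bounded s M.
Proof.
intros Hs1.
set (B := fun x y => exists M, 0 <= M /\ forall s, x <= s <= y -> inner_bounded s M).
assert (Hscale : forall lam x y, 0 < lam -> 0 < x -> B x y -> B (lam * x) (lam * y)).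
{ intros lam x y Hl Hx (M & HM & H).
  destruct (inner_bounded_scale lam Hl) as (M' & HM' & H').
  exists (M' * M); split; [apply Rmult_le_pos; auto|]; intros s Hs.
  assert (Hs' : x <= s / lam <= y).
  { split; apply Rmult_le_reg_r with lam; auto; unfold Rdiv; rewrite Rmult_assoc, Rinv_l; lra. }
  replace s with (lam * (s / lam)) by (field; lra).
  apply H'; [lra|apply H, Hs']. }
assert (Hcat : forall x y z, B x y -> B y z -> B x z).
{ intros x y z (M & HM & H) (M' & HM' & H'); exists (M + M'); split; [lra|]; intros s Hs.
  destruct (Rle_lt_dec s y).
  - apply (inner_bounded_mono s M); [lra|apply H; lra].
  - apply (inner_bounded_mono s M'); [lra|apply H'; lra]. }
destruct inner_bounded_interval as (p & p' & M0 & Hp & HM0).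
set (q := p' / p).
assert (Hq : 1 < q).
{ apply Rmult_lt_reg_r with p; [lra|]; unfold q, Rdiv; rewrite Rmult_assoc, Rinv_l; lra. }
assert (HB1 : B p (q * p)).
{ exists (Rmax 0 M0); split; [apply Rmax_l|]; intros s Hs.
  apply (inner_bounded_mono s M0); [apply Rmax_r|]; apply HM0.
  replace p' with (q * p) by (unfold q; field; lra); exact Hs. }
assert (HBn : forall n, B p (q ^ n * p)).
{ induction n as [|n IH].
  - destruct HB1 as (M & HM & H); exists M; split; auto; intros s Hs; apply H; simpl in Hs; nra.
  - apply Hcat with (q * p); [exact HB1|].
    replace (q ^ S n * p) with (q * (q ^ n * p)) by (simpl; ring).
    apply Hscale; auto; lra. }
destruct (Pow_x_infinity q ltac:(rewrite Rabs_pos_eq; lra) (s2 / s1)) as [n Hn].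
specialize (Hn n ltac:(lia)); rewrite Rabs_pos_eq in Hn by (apply pow_le; lra).
assert (Hlam : 0 < s1 / p) by (apply Rdiv_lt_0_compat; lra).
destruct (Hscale _ _ _ Hlam (proj1 Hp) (HBn n)) as (M & HM & H).
exists M; split; auto; intros s Hs; apply H.
replace (s1 / p * p) with s1 by (field; lra).
replace (s1 / p * (q ^ n * p)) with (s1 * q ^ n) by (field; lra).
split; [lra|]; apply Rle_trans with s2; [lra|].
apply Rge_le, (Rmult_le_compat_l s1) in Hn; [|lra].
replace (s1 * (s2 / s1)) with s2 in Hn by (field; lra); exact Hn.
Qed.

(** * Averages over the parameter *)

Lemma is_derive_lowmass_scal k c s :
  is_derive (fun t => lowmass k (t * c)) s (-2 * c * ecoef k (s * c) ^ 2).
Proof.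
apply is_derive_eq with (scal c (-2 * ecoef k (s * c) ^ 2)); [|unfold scal; simpl; unfold mult; simpl; ring].
apply (is_derive_comp (lowmass k) (fun t => t * c)); [apply is_derive_lowmass|].
auto_derive; auto; ring.
Qed.

(** Integration of the hypothesis over [[s1, s2]], since [2 c * ecoef(t c)^2] is minus the
    derivative of [lowmass(t c)] in [t]. The integral appears as monotonicity of [K t + F t]. *)
Lemma average_bound (k : nat -> nat) (c w : nat -> R) K s1 s2 d :
  s1 <= s2 ->
  (forall t, s1 <= t <= s2 -> rsum (fun i => w i * (2 * c i) * ecoef (k i) (t * c i) ^ 2) d <= K) ->
  rsum (fun i => w i * (lowmass (k i) (s1 * c i) - lowmass (k i) (s2 * c i))) d <= K * (s2 - s1).
Proof.
intros Hs HK.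
set (F := fun t => rsum (fun i => w i * lowmass (k i) (t * c i)) d).
set (dF := fun t => rsum (fun i => w i * (-2 * c i * ecoef (k i) (t * c i) ^ 2)) d).
assert (T : K * s1 + F s1 <= K * s2 + F s2).
{ apply (le_of_derive (fun t => K * t + F t) (fun t => K + dF t)); auto.
  - intros t; apply (is_derive_plus (fun t => K * t) F); [auto_derive; auto; ring|].
    apply (is_derive_rsum (fun i t => w i * lowmass (k i) (t * c i))
      (fun i t => w i * (-2 * c i * ecoef (k i) (t * c i) ^ 2))).
    intros i; apply (is_derive_scal (fun t => lowmass (k i) (t * c i))), is_derive_lowmass_scal.
  - intros t Ht; specialize (HK t Ht).
    assert (E : dF t = -1 * rsum (fun i => w i * (2 * c i) * ecoef (k i) (t * c i) ^ 2) d)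
      by (unfold dF; rewrite <- rsum_scal; apply rsum_ext; intros; ring).
    lra. }
unfold F in T.
rewrite (rsum_ext _ (fun i => w i * lowmass (k i) (s1 * c i) + (-1) * (w i * lowmass (k i) (s2 * c i))))
  by (intros; ring).
rewrite rsum_plus, rsum_scal; lra.
Qed.

(** The test function [z^n] has image [E_(t n)]. *)
Lemma input_average s1 s2 M n L :
  s1 <= s2 -> (forall s, s1 <= s <= s2 -> inner_bounded s M) ->
  rsum (fun k => beta k * (lowmass k (s1 * INR n) - lowmass k (s2 * INR n))) L
    <= 2 * INR n * M * beta n * (s2 - s1).
Proof.
intros Hs HM; apply (average_bound (fun k => k) (fun _ => INR n)); auto.
intros t Ht; set (a := fun i => if Nat.eq_dec i n then RtoC 1 else RtoC 0).
assert (H := HM t Ht a (S n) L).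
assert (Ea : forall u : nat -> C, csum (fun i => a i * u i)%C (S n) = u n).
{ intros u; simpl; unfold a at 2; destruct (Nat.eq_dec n n); [|lia].
  rewrite csum_eq0; [ring|]; intros i Hi; unfold a; destruct (Nat.eq_dec i n); [lia|ring]. }
assert (Er : rsum (fun i => Cmod (a i) ^ 2 * beta i) (S n) = beta n).
{ change (rsum ?u (S n)) with (rsum u n + u n); cbv beta.
  unfold a at 2; destruct (Nat.eq_dec n n); [|lia].
  rewrite rsum_eq0, Cmod_1; [ring|].
  intros i Hi; unfold a; destruct (Nat.eq_dec i n); [lia|rewrite Cmod_0; ring]. }
rewrite Er in H; unfold inner_gram in H; rewrite Rmult_assoc.
apply (Rmult_le_compat_l (2 * INR n)) in H; [|generalize (pos_INR n); lra].
eapply Rle_trans; [|exact H]; rewrite <- rsum_scal; right; apply rsum_ext; intros k _.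
rewrite (Ea (fun i => RtoC (ecoef k (t * INR i)))), Cmod_R, pow2_abs; ring.
Qed.

(** Duality: for the input with coefficients [ecoef m (t n) / beta n], the squared norm and the
    [m]-th coefficient of the image both equal [Q], so [Q^2 beta m <= M Q]. Index 0 is left out
    because the weights divide by it. *)
Lemma output_average s1 s2 M m d :
  s1 <= s2 -> 0 <= M -> (forall s, s1 <= s <= s2 -> inner_bounded s M) ->
  rsum (fun n => / (2 * INR (S n) * beta (S n)) * (lowmass m (s1 * INR (S n)) - lowmass m (s2 * INR (S n)))) d
    <= M / beta m * (s2 - s1).
Proof.
intros Hs HM0 HM; apply (average_bound (fun _ => m) (fun n => INR (S n))); auto.
intros t Ht; set (Q := rsum (fun n => ecoef m (t * INR (S n)) ^ 2 / beta (S n)) d).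
assert (HQ0 : 0 <= Q).
{ apply rsum_ge0; intros; apply Rdiv_le_0_compat; [apply pow2_ge_0|apply Hpos]. }
set (a := fun i => match i with O => RtoC 0 | S n => RtoC (ecoef m (t * INR (S n)) / beta (S n)) end).
assert (H := HM t Ht a (S d) (S m)).
assert (E1 : rsum (fun n => Cmod (a n) ^ 2 * beta n) (S d) = Q).
{ rewrite rsum_shift; simpl (a O); rewrite Cmod_0.
  replace (0 ^ 2 * beta O) with 0 by ring; rewrite Rplus_0_l; apply rsum_ext; intros n _.
  unfold a; rewrite Cmod_R, pow2_abs; specialize (Hpos (S n)); field; lra. }
assert (E2 : csum (fun n => a n * RtoC (ecoef m (t * INR n)))%C (S d) = RtoC Q).
{ rewrite csum_shift; simpl (a O); rewrite Cmult_0_l, Cplus_0_l; unfold Q; rewrite <- csum_RtoC.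
  apply csum_ext; intros n _; unfold a; rewrite <- RtoC_mult; f_equal.
  specialize (Hpos (S n)); field; lra. }
rewrite E1 in H; unfold inner_gram in H.
change (rsum ?u (S m)) with (rsum u m + u m) in H; cbv beta in H; rewrite E2, Cmod_R, pow2_abs in H.
assert (Hrest : 0 <= rsum (fun k => Cmod (csum (fun n => a n * RtoC (ecoef k (t * INR n)))%C (S d)) ^ 2 * beta k) m).
{ apply rsum_ge0; intros; apply Rmult_le_pos; [apply pow2_ge_0|apply Rlt_le, Hpos]. }
apply Rle_trans with Q.
- right; apply rsum_ext; intros n _; specialize (Hpos (S n)); field.
  split; [lra|apply not_0_INR; lia].
- apply Rmult_le_reg_r with (beta m); [apply Hpos|].
  unfold Rdiv; rewrite Rmult_assoc, Rinv_l, Rmult_1_r by (specialize (Hpos m); lra).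
  destruct (Rle_lt_or_eq_dec _ _ HQ0) as [HQ1|HQ1]; [|rewrite <- HQ1; lra].
  apply Rmult_le_reg_r with Q; auto; simpl in *; nra.
Qed.

Lemma harmonic_mean (x : nat -> R) n :
  (forall i, 0 < x i) -> INR n ^ 2 <= rsum x n * rsum (fun i => / x i) n.
Proof.
intros Hx; induction n as [|n IH]; [simpl; lra|].
rewrite S_INR; simpl rsum.
assert (HX : 0 <= rsum x n) by (apply rsum_ge0; intros; apply Rlt_le, Hx).
assert (HY : 0 <= rsum (fun i => / x i) n)
  by (apply rsum_ge0; intros; apply Rlt_le, Rinv_0_lt_compat, Hx).
set (X := rsum x n) in *; set (Y := rsum (fun i => / x i) n) in *.
set (t := x n); assert (Ht : 0 < t) by apply Hx.
assert (Hi : 0 < / t) by (apply Rinv_0_lt_compat, Ht).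
assert (E : t * / t = 1) by (apply Rinv_r; lra).
(* Arithmetic against geometric mean of [X / t] and [t Y], whose product is [X Y >= n^2]. *)
assert (P : 2 * INR n <= X * / t + t * Y).
{ generalize (pos_INR n); intros Hn.
  assert (0 <= X * / t) by (apply Rmult_le_pos; lra).
  assert (0 <= t * Y) by (apply Rmult_le_pos; lra).
  apply Rsqr_incr_0_var; [|lra]; unfold Rsqr.
  assert (E2 : (X * / t) * (t * Y) = X * Y) by (field; lra).
  generalize (pow2_ge_0 (X * / t - t * Y)); simpl in *; nra. }
simpl in *; nra.
Qed.

Lemma slow_oscillation_upper :
  exists K, 0 <= K /\ forall m n, (1 <= n)%nat -> INR n / 2 <= INR m <= 2 * INR n -> beta m <= K * beta n.
Proof.
(* [lowmass_drop] requires [s1 a <= b / 2] and [s2 a >= 30 b] for [a] in [[n, 2 n]] and [b] in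
   [[n / 2, 2 n]]; the extreme cases give [s1 = 1/8] and [s2 = 60]. *)
destruct (inner_bounded_uniform (1 / 8) 60 ltac:(lra)) as (M & HM0 & HM).
(* [4800 = 40 * 2 * 60] and [9600 = 40 * 4 * 60]: 40 from [lowmass_drop], [2 n] and
   [2 (n + i) <= 4 n] from the averages, 60 for the length of the window. *)
exists (4800 * M * (9600 * M)); split; [nra|]; intros m n Hn Hmn.
assert (HnR : 1 <= INR n) by (apply INR_ge1; auto).
assert (Hm : (1 <= m)%nat).
{ destruct m; [simpl in Hmn; lra|lia]. }
(* Sums of [beta] and [1 / beta] over the same block [[n, 2 n)]. Their product is at least [n^2],
   which ties the bound by [beta n] to the bound by [1 / beta m]. *)
set (X := rsum (fun i => beta (n + i)%nat) n); set (Y := rsum (fun i => / beta (n + i)%nat) n).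
assert (HX : X <= 4800 * M * INR n * beta n).
{ assert (T := input_average (1 / 8) 60 M n (n + n) ltac:(lra) HM).
  assert (T2 : X * / 40 <= 2 * INR n * M * beta n * (60 - 1 / 8)).
  { eapply Rle_trans; [|exact T].
    assert (Hterm : forall k, 0 <= beta k * (lowmass k (1 / 8 * INR n) - lowmass k (60 * INR n))).
    { intros k; apply Rmult_le_pos; [apply Rlt_le, Hpos|].
      assert (D := lowmass_decr k (1 / 8 * INR n) (60 * INR n) ltac:(lra)); lra. }
    eapply Rle_trans; [|apply rsum_tail_le; exact Hterm].
    unfold X; rewrite Rmult_comm, <- rsum_scal; apply rsum_le; intros i Hi.
    rewrite Rmult_comm; apply Rmult_le_compat_l; [apply Rlt_le, Hpos|].
    assert (Hi1 : INR n <= INR (n + i)) by (apply le_INR; lia).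
    assert (Hi2 : INR (n + i) <= INR n + INR n) by (rewrite <- plus_INR; apply le_INR; lia).
    apply lowmass_drop; [lia|lra|lra]. }
  assert (0 <= INR n * M * beta n) by (apply Rmult_le_pos; [nra|apply Rlt_le, Hpos]); nra. }
assert (HY : Y <= 9600 * M * INR n / beta m).
{ assert (T := output_average (1 / 8) 60 M m (n + n - 1) ltac:(lra) HM0 HM).
  assert (HMb : 0 <= M / beta m) by (apply Rdiv_le_0_compat; [auto|apply Hpos]).
  assert (T2 : / (160 * INR n) * Y <= M / beta m * (60 - 1 / 8)).
  { eapply Rle_trans; [|exact T]; replace (n + n - 1)%nat with ((n - 1) + n)%nat by lia.
    assert (Hterm : forall k, 0 <= / (2 * INR (S k) * beta (S k))
        * (lowmass m (1 / 8 * INR (S k)) - lowmass m (60 * INR (S k)))).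
    { intros k; assert (HSk : 0 < INR (S k)) by (apply lt_0_INR; lia); apply Rmult_le_pos.
      - apply Rlt_le, Rinv_0_lt_compat; specialize (Hpos (S k)); nra.
      - assert (D := lowmass_decr m (1 / 8 * INR (S k)) (60 * INR (S k)) ltac:(lra)); lra. }
    eapply Rle_trans; [|apply rsum_tail_le; exact Hterm].
    unfold Y; rewrite <- rsum_scal; apply rsum_le; intros i Hi.
    replace (S (n - 1 + i)) with (n + i)%nat by lia.
    assert (Hi1 : INR n <= INR (n + i)) by (apply le_INR; lia).
    assert (Hi2 : INR (n + i) <= INR n + INR n) by (rewrite <- plus_INR; apply le_INR; lia).
    assert (D := lowmass_drop m (1 / 8 * INR (n + i)) (60 * INR (n + i)) Hm ltac:(lra) ltac:(lra)).
    assert (Hb := Hpos (n + i)%nat).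
    apply Rle_trans with (/ (2 * INR (n + i) * beta (n + i)%nat) * / 40).
    - rewrite <- !Rinv_mult; apply Rinv_le_contravar; [|nra].
      apply Rmult_lt_0_compat; [|lra]; apply Rmult_lt_0_compat; lra.
    - apply Rmult_le_compat_l; [|exact D]; apply Rlt_le, Rinv_0_lt_compat.
      apply Rmult_lt_0_compat; lra. }
  apply Rmult_le_reg_l with (/ (160 * INR n)); [apply Rinv_0_lt_compat; lra|].
  replace (/ (160 * INR n) * (9600 * M * INR n / beta m)) with (M / beta m * 60)
    by (specialize (Hpos m); field; lra).
  nra. }
assert (HCS := harmonic_mean (fun i => beta (n + i)%nat) n ltac:(intros; apply Hpos)).
fold X in HCS; fold Y in HCS.
assert (HX0 : 0 <= X) by (apply rsum_ge0; intros; apply Rlt_le, Hpos).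
assert (HY0 : 0 <= Y) by (apply rsum_ge0; intros; apply Rlt_le, Rinv_0_lt_compat, Hpos).
assert (HXY : INR n ^ 2 <= (4800 * M * INR n * beta n) * (9600 * M * INR n / beta m)).
{ eapply Rle_trans; [exact HCS|]; apply Rmult_le_compat; auto. }
assert (Hbm := Hpos m).
apply Rmult_le_reg_r with (INR n ^ 2 * / beta m).
{ apply Rmult_lt_0_compat; [apply pow_lt; lra|apply Rinv_0_lt_compat; auto]. }
replace (beta m * (INR n ^ 2 * / beta m)) with (INR n ^ 2) by (field; lra).
eapply Rle_trans; [exact HXY|]; right; field; lra.
Qed.

Lemma slowly_oscillating_necessary : slowly_oscillating beta.
Proof.
destruct slow_oscillation_upper as (K & HK & H).
exists (/ (K + 2)), (K + 2).
assert (Hi : 0 < / (K + 2)) by (apply Rinv_0_lt_compat; lra).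
split; [exact Hi|]; split; [|split; [lra|]].
- rewrite <- Rinv_1; apply Rinv_lt_contravar; lra.
- intros m n Hmn; assert (Hm := Hpos m); assert (Hn := Hpos n).
  destruct n as [|n].
  + assert (m = O) as -> by (destruct m; [auto|]; rewrite S_INR in Hmn; simpl in Hmn; generalize (pos_INR m); lra).
    replace (beta O / beta O) with 1 by (field; lra); split; [|lra].
    rewrite <- Rinv_1; apply Rinv_le_contravar; lra.
  + assert (HnR : 1 <= INR (S n)) by (apply INR_ge1; lia).
    assert (Hm1 : (1 <= m)%nat) by (destruct m; [simpl (INR 0) in Hmn; lra|lia]).
    assert (H1 := H m (S n) ltac:(lia) Hmn).
    (* The range condition is symmetric in the two indices, so the upper bound also yields the lower
       one. *)
    assert (H2 := H (S n) m Hm1 ltac:(lra)).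
    split.
    * apply Rmult_le_reg_r with (beta (S n) * (K + 2)); [nra|].
      replace (/ (K + 2) * (beta (S n) * (K + 2))) with (beta (S n)) by (field; lra).
      replace (beta m / beta (S n) * (beta (S n) * (K + 2))) with (beta m * (K + 2)) by (field; lra); nra.
    * apply Rmult_le_reg_r with (beta (S n)); auto.
      unfold Rdiv; rewrite Rmult_assoc, Rinv_l; nra.
Qed.
End SlowOscillation.

(** * Essential decrease is necessary *)

Definition sh (m : nat) (r : nat -> R) (k : nat) : R := if le_dec m k then r (k - m)%nat else 0.

Lemma rconv_sh q m r k : rconv q (sh m r) k = sh m (rconv q r) k.
Proof.
unfold sh at 2; destruct (le_dec m k) as [H|H].
- unfold rconv; replace (S k) with (S (k - m) + m)%nat by lia; rewrite rsum_add.
  set (T := rsum (fun i => _) m); replace T with 0.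
  + rewrite Rplus_0_r; apply rsum_ext; intros i Hi; unfold sh.
    destruct (le_dec m (k - i)); [|lia]; do 2 f_equal; lia.
  + unfold T; symmetry; apply rsum_eq0; intros i Hi; unfold sh; destruct (le_dec m (k - (S (k - m) + i))); [lia|ring].
- unfold rconv; rewrite rsum_eq0; [ring|].
  intros i Hi; unfold sh; destruct (le_dec m (k - i)); [lia|ring].
Qed.

Lemma rconv_delta_ge p q eps m r k :
  0 <= eps -> (forall i, 0 <= r i) ->
  (forall i, q i + (if Nat.eq_dec i m then eps else 0) <= p i) ->
  rconv q r k + eps * sh m r k <= rconv p r k.
Proof.
intros He Hr Hp; unfold rconv.
apply Rle_trans with (rsum (fun i => q i * r (k - i)%nat + (if Nat.eq_dec i m then eps * r (k - i)%nat else 0)) (S k)).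
- rewrite rsum_plus; apply Rplus_le_compat_l; unfold sh; destruct (le_dec m k) as [H|H].
  + eapply Rle_trans; [|apply (rsum_term_le (fun i => if Nat.eq_dec i m then eps * r (k - i)%nat else 0) (S k) m)].
    * destruct (Nat.eq_dec m m); [lra|lia].
    * intros i; destruct (Nat.eq_dec i m); [apply Rmult_le_pos; auto|lra].
    * lia.
  + rewrite Rmult_0_r; apply rsum_ge0; intros i _; destruct (Nat.eq_dec i m); [apply Rmult_le_pos; auto|lra].
- apply rsum_le; intros i _; specialize (Hp i); specialize (Hr (k - i)%nat).
  destruct (Nat.eq_dec i m); nra.
Qed.

(** The first two terms of the binomial expansion of [(q + eps z^m)^j], the others being
    nonnegative; [sh m] is multiplication by [z^m]. *)
Lemma rpow_lower p q eps m :
  0 <= eps -> (forall i, 0 <= q i) ->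
  (forall i, q i + (if Nat.eq_dec i m then eps else 0) <= p i) ->
  forall j k, rpow q j k + INR j * eps * sh m (rpow q (pred j)) k <= rpow p j k.
Proof.
intros He Hq Hp.
assert (Hp0 : forall i, 0 <= p i).
{ intros i; specialize (Hq i); specialize (Hp i); destruct (Nat.eq_dec i m); lra. }
assert (Hsh : forall r k, (forall i, 0 <= r i) -> 0 <= sh m r k).
{ intros r k Hr; unfold sh; destruct (le_dec m k); [auto|lra]. }
induction j as [|j IH]; intros k; [simpl; lra|].
change (rpow p (S j) k) with (rconv p (rpow p j) k); simpl pred.
eapply Rle_trans; [|apply (rconv_delta_ge p q eps m); auto; intros; apply rpow_ge0; auto].
assert (H1 : rpow q (S j) k + INR j * eps * sh m (rpow q j) k <= rconv q (rpow p j) k).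
{ apply Rle_trans with (rconv q (rpow q j) k + INR j * eps * rconv q (sh m (rpow q (pred j))) k).
  - rewrite rconv_sh; apply Rplus_le_compat_l.
    destruct j as [|j]; [simpl; lra|]; apply Rle_refl.
  - unfold rconv; rewrite <- rsum_scal, <- rsum_plus; apply rsum_le; intros i _.
    specialize (IH (k - i)%nat); specialize (Hq i); nra. }
assert (H2 : sh m (rpow q j) k <= sh m (rpow p j) k).
{ unfold sh; destruct (le_dec m k); [|lra].
  eapply Rle_trans; [|apply IH].
  assert (0 <= INR j * eps * sh m (rpow q (pred j)) (k - m)); [|lra].
  apply Rmult_le_pos; [apply Rmult_le_pos; [apply pos_INR|auto]|apply Hsh; intros; apply rpow_ge0; auto]. }
rewrite S_INR; nra.
Qed.

Lemma bernoulli x n : 0 <= x <= 1 -> 1 - INR n * x <= (1 - x) ^ n.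
Proof.
intros Hx; induction n as [|n IH]; [simpl; lra|].
rewrite S_INR; simpl.
assert (0 <= INR n) by apply pos_INR.
assert ((1 - x) * (1 - INR n * x) <= (1 - x) * (1 - x) ^ n) by (apply Rmult_le_compat_l; lra).
nra.
Qed.

(* Most of the mass of [q^n] sits at indices [t < T], because [q r] is close to [1] at some
   [r] for which [r^T] is small. *)
Lemma rpow_mass q n r T :
  (forall i, 0 <= q i) -> 0 <= r <= 1 -> ex_series q -> Series q <= 1 ->
  / 4 <= Series (fun k => q k * r ^ k) ^ n -> r ^ T <= / 8 ->
  / 8 <= rsum (rpow q n) T.
Proof.
intros Hq Hr Hex H1 H4 H8.
assert (Hp : forall k, 0 <= rpow q n k) by (intros; apply rpow_ge0; auto).
assert (Hrk : forall k, 0 <= r ^ k <= 1).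
{ intros k; apply pow_le1; lra. }
assert (Hexr : ex_series (fun k => q k * r ^ k)).
{ apply ex_series_dom with q; auto; intros k; specialize (Hq k); specialize (Hrk k); nra. }
assert (Hs := rpow_series q n r Hq (proj1 Hr) Hexr).
assert (Hs1 : is_series (rpow q n) (Series q ^ n)).
{ assert (E : ex_series (fun k => q k * 1 ^ k))
    by (refine (ex_series_ext _ _ _ Hex); intros; rewrite pow1; symmetry; apply Rmult_1_r).
  assert (S1 := rpow_series q n 1 Hq Rle_0_1 E).
  replace (Series q) with (Series (fun k => q k * 1 ^ k))
    by (apply Series_ext; intros; rewrite pow1; ring).
  refine (is_series_ext _ _ _ _ S1); intros; rewrite pow1; apply Rmult_1_r. }
assert (Hq1 : 0 <= Series q ^ n <= 1).
{ assert (0 <= Series q) by (apply Series_ge0; auto).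
  split; [apply pow_le; auto|rewrite <- (pow1 n); apply pow_incr; lra]. }
rewrite <- (is_series_unique _ _ Hs), (Series_split _ T) in H4 by (eexists; exact Hs).
assert (Ha : rsum (fun k => rpow q n k * r ^ k) T <= rsum (rpow q n) T).
{ apply rsum_le; intros k _; specialize (Hp k); specialize (Hrk k); nra. }
assert (Hb : Series (fun k => rpow q n (T + k)%nat * r ^ (T + k)) <= / 8).
{ assert (Hext : ex_series (fun k => rpow q n (T + k)%nat))
    by (apply (ex_series_incr_n (rpow q n) T); eexists; exact Hs1).
  apply Rle_trans with (r ^ T * Series (fun k => rpow q n (T + k)%nat)).
  - rewrite <- Series_scal_l; apply Series_le; [|apply ex_series_scal, Hext].
    intros k; rewrite pow_add; specialize (Hp (T + k)%nat).
    assert (A := Hrk T); assert (B := Hrk k).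
    split; [apply Rmult_le_pos; [auto|apply Rmult_le_pos; lra]|].
    replace (rpow q n (T + k)%nat * (r ^ T * r ^ k)) with (r ^ T * rpow q n (T + k)%nat * r ^ k) by ring.
    rewrite <- (Rmult_1_r (r ^ T * rpow q n (T + k)%nat)) at 2.
    apply Rmult_le_compat_l; [apply Rmult_le_pos; lra|lra].
  - assert (Hle : Series (fun k => rpow q n (T + k)%nat) <= 1).
    { assert (Sp := Series_split (rpow q n) T ltac:(eexists; exact Hs1)).
      rewrite (is_series_unique _ _ Hs1) in Sp.
      assert (0 <= rsum (rpow q n) T) by (apply rsum_ge0; auto); lra. }
    assert (H0 : 0 <= Series (fun k => rpow q n (T + k)%nat)) by (apply Series_ge0; auto).
    specialize (Hrk T); nra. }
lra.
Qed.

Lemma rsum_sqr_le (x : nat -> R) n : rsum x n ^ 2 <= INR n * rsum (fun k => x k ^ 2) n.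
Proof.
induction n as [|n IH]; [simpl; lra|].
rewrite S_INR; change (rsum ?u (S n)) with (rsum u n + u n); cbv beta.
set (X := rsum x n) in *; set (Q := rsum (fun k => x k ^ 2) n) in *.
destruct n as [|n].
- unfold X, Q; simpl; right; ring.
- assert (Hn : 0 < INR (S n)) by (apply lt_0_INR; lia).
  set (c := INR (S n)) in *; set (y := x (S n)).
  assert (P : 2 * X * y <= Q + c * y ^ 2).
  { apply Rmult_le_reg_l with c; auto; generalize (pow2_ge_0 (X - c * y)); nra. }
  nra.
Qed.

(** * The gliding hump *)

Section GlidingHump.
Variable beta : nat -> R.
Hypothesis Hpos : forall n, 0 < beta n.
Variable K : R.
Hypothesis HK : 1 <= K.
Hypothesis Hosc : forall m n, INR n / 2 <= INR m <= 2 * INR n -> beta m / beta n <= K.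

(* One hump: if [p] dominates [q + z^m / (8 N)] with [q 1 >= 1 - 1/(4 N)] and [q' 1 <= lam],
   the image of [z^N + ... + z^(2N-1)] has mass of order [N] near the index [m]. *)
Lemma hump p q N m lam r M :
  (1 <= N)%nat -> (N <= m)%nat -> 1 <= lam -> (26 * lam <= 2 ^ r) ->
  (forall i, 0 <= q i) -> ex_series q -> Series q <= 1 ->
  (forall x, 0 <= x <= 1 -> 1 - / (4 * INR N) - lam * (1 - x) <= Series (fun k => q k * x ^ k)) ->
  (forall i, q i + (if Nat.eq_dec i m then / (8 * INR N) else 0) <= p i) ->
  (forall a d L, rsum (fun k => Cmod (csum (fun n => a n * cpow (fun k => RtoC (p k)) n k)%C d) ^ 2 * beta k) L
      <= M * rsum (fun n => Cmod (a n) ^ 2 * beta n) d) ->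
  0 <= M ->
  beta m <= 102400 * lam * K ^ S r * M * beta N.
Proof.
intros HN HNm Hlam Hr Hq Hqex Hq1 Hqx Hpq HM HM0.
assert (HNR : 1 <= INR N) by (apply INR_ge1; auto).
(* At [1 - x0] the lower bound for [q] becomes [1 - 3 / (8 N)]; by Bernoulli its powers of exponent
   below [2 N] stay above [1/4]. *)
set (x0 := / (8 * INR N * lam)).
assert (HNl : 1 <= INR N * lam) by nra.
assert (Hx0 : 0 < x0 <= 1 / 8).
{ unfold x0; split; [apply Rinv_0_lt_compat; nra|].
  replace (1 / 8) with (/ 8) by field; apply Rinv_le_contravar; nra. }
(* This gives [T x0 >= 3] with [exp (-3) <= 1/8]; rounding up costs at most [N lam], which is at
   least 1. *)
assert (HTex : exists T, 24 * INR N * lam <= INR T <= 25 * INR N * lam).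
{ destruct (nfloor_ex (24 * INR N * lam) ltac:(nra)) as [T1 HT1]; exists (S T1); rewrite S_INR; lra. }
destruct HTex as [T HT].
set (rho := 1 - x0).
assert (HrT : rho ^ T <= / 8).
{ apply Rle_trans with (exp (- x0) ^ T).
  - apply pow_incr; split; [unfold rho; lra|]; unfold rho.
    generalize (exp_ineq1_le (- x0)); lra.
  - rewrite <- Rpower_pow by apply exp_pos; unfold Rpower; rewrite ln_exp.
    apply Rle_trans with (exp (- (3))).
    + apply exp_le_exp.
      assert (3 <= INR T * x0); [|lra].
      replace 3 with ((24 * INR N * lam) * x0) by (unfold x0; field; lra).
      apply Rmult_le_compat_r; lra.
    + rewrite exp_Ropp; apply Rinv_le_contravar; [lra|].
      replace 3 with (1 + 1 + 1) by ring; rewrite !exp_plus.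
      generalize (exp_ineq1 1 ltac:(lra)); intros; nra. }
assert (Hmass : forall j, (j < 2 * N)%nat -> / 8 <= rsum (rpow q j) T).
{ intros j Hj; apply rpow_mass with rho; auto; [unfold rho; lra|].
  assert (Hy : 1 - 3 / (8 * INR N) <= Series (fun k => q k * rho ^ k)).
  { eapply Rle_trans; [|apply Hqx; unfold rho; lra].
    unfold rho, x0; right; field; lra. }
  assert (Hj' : INR j <= 2 * INR N).
  { replace 2 with (INR 2) by (simpl; ring); rewrite <- mult_INR; apply le_INR; lia. }
  assert (H38 : 0 <= 3 / (8 * INR N) <= 1).
  { split; [apply Rdiv_le_0_compat; lra|].
    apply Rmult_le_reg_r with (8 * INR N); [lra|]; unfold Rdiv; rewrite Rmult_assoc, Rinv_l; lra. }
  apply Rle_trans with ((1 - 3 / (8 * INR N)) ^ j); [|apply pow_incr; lra].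
  eapply Rle_trans; [|apply bernoulli; exact H38].
  assert (INR j * (3 / (8 * INR N)) <= 2 * INR N * (3 / (8 * INR N)))
    by (apply Rmult_le_compat_r; lra).
  replace (2 * INR N * (3 / (8 * INR N))) with (3 / 4) in H by (field; lra); lra. }
set (a := fun i => if le_dec N i then RtoC 1 else RtoC 0).
set (c := fun k => rsum (fun j => rpow p (N + j)%nat k) N).
assert (Hc : forall k, csum (fun n => a n * cpow (fun k => RtoC (p k)) n k)%C (N + N) = RtoC (c k)).
{ intros k; rewrite csum_add, (csum_eq0 _ N), Cplus_0_l.
  - unfold c; rewrite <- csum_RtoC; apply csum_ext; intros j _; rewrite cpow_RtoC.
    unfold a; destruct (le_dec N (N + j)); [ring|lia].
  - intros i Hi; unfold a; destruct (le_dec N i); [lia|ring]. }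
assert (Hin : rsum (fun n => Cmod (a n) ^ 2 * beta n) (N + N) <= INR N * (K * beta N)).
{ rewrite rsum_add, (rsum_eq0 _ N), Rplus_0_l.
  - rewrite <- rsum_const; apply rsum_le; intros j Hj.
    unfold a; destruct (le_dec N (N + j)); [|lia].
    rewrite Cmod_1, pow1, Rmult_1_l.
    assert (Hjj : INR N <= INR (N + j) <= 2 * INR N).
    { split; [apply le_INR; lia|]; replace 2 with (INR 2) by (simpl; ring).
      rewrite <- mult_INR; apply le_INR; lia. }
    assert (H := Hosc (N + j)%nat N ltac:(lra)).
    apply Rmult_le_reg_r with (/ beta N); [apply Rinv_0_lt_compat, Hpos|].
    specialize (Hpos N); rewrite Rmult_assoc, Rinv_r, Rmult_1_r; [exact H|lra].
  - intros i Hi; unfold a; destruct (le_dec N i); [lia|]; rewrite Cmod_0; ring. }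
(* Only the second term of [rpow_lower] is kept; its factor [(N + j) / (8 N)] is at least [1/8]. *)
assert (Hct : forall t, 1 / 8 * rsum (fun j => rpow q (N + j - 1)%nat t) N <= c (m + t)%nat).
{ intros t; unfold c; rewrite <- rsum_scal; apply rsum_le; intros j Hj.
  eapply Rle_trans; [|apply (rpow_lower p q (/ (8 * INR N)) m)]; auto.
  - unfold sh; destruct (le_dec m (m + t)); [|lia].
    replace (m + t - m)%nat with t by lia; replace (pred (N + j)) with (N + j - 1)%nat by lia.
    assert (0 <= rpow q (N + j) (m + t)) by (apply rpow_ge0; auto).
    assert (Hqt : 0 <= rpow q (N + j - 1) t) by (apply rpow_ge0; auto).
    assert (1 / 8 <= INR (N + j) * / (8 * INR N)).
    { replace (1 / 8) with (INR N * / (8 * INR N)) by (field; lra).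
      apply Rmult_le_compat_r; [apply Rlt_le, Rinv_0_lt_compat; lra|apply le_INR; lia]. }
    assert (1 / 8 * rpow q (N + j - 1) t <= INR (N + j) * / (8 * INR N) * rpow q (N + j - 1) t)
      by (apply Rmult_le_compat_r; auto).
    lra.
  - apply Rlt_le, Rinv_0_lt_compat; lra. }
assert (Hsum : INR N / 64 <= rsum (fun t => c (m + t)%nat) T).
{ apply Rle_trans with (rsum (fun t => 1 / 8 * rsum (fun j => rpow q (N + j - 1)%nat t) N) T);
    [|apply rsum_le; intros; apply Hct].
  rewrite rsum_scal, rsum_exchange.
  apply Rle_trans with (1 / 8 * (INR N * / 8)); [right; field|].
  apply Rmult_le_compat_l; [lra|]; rewrite <- rsum_const; apply rsum_le; intros j Hj.
  apply Hmass; lia. }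
(* [t < T <= 25 N lam] and [N <= m] put [m + t] below [26 lam m], within [r] doublings of [m]. *)
assert (Hbeta : forall t, (t < T)%nat -> beta m <= K ^ r * beta (m + t)%nat).
{ intros t Ht; apply (slowly_oscillating_iter beta K HK Hpos Hosc); [lia|].
  apply INR_le; rewrite plus_INR, mult_INR, pow_INR; simpl (INR 2).
  assert (INR t <= INR T) by (apply le_INR; lia).
  assert (INR N <= INR m) by (apply le_INR; auto).
  assert (INR N * lam <= INR m * lam) by (apply Rmult_le_compat_r; lra).
  replace (1 + 1) with 2 by ring; nra. }
assert (Hlow : beta m * rsum (fun t => c (m + t)%nat ^ 2) T <= K ^ r * (M * (INR N * (K * beta N)))).
{ rewrite <- rsum_scal.
  apply Rle_trans with (K ^ r * rsum (fun t => c (m + t)%nat ^ 2 * beta (m + t)%nat) T).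
  - rewrite <- rsum_scal; apply rsum_le; intros t Ht.
    specialize (Hbeta t Ht); generalize (pow2_ge_0 (c (m + t)%nat)); nra.
  - apply Rmult_le_compat_l; [apply pow_le; lra|].
    apply Rle_trans with (M * rsum (fun n => Cmod (a n) ^ 2 * beta n) (N + N));
      [|apply Rmult_le_compat_l; auto].
    eapply Rle_trans; [|apply (HM a (N + N)%nat (m + T)%nat)].
    eapply Rle_trans; [|apply rsum_tail_le].
    + right; apply rsum_ext; intros t _; rewrite Hc, Cmod_R, pow2_abs; reflexivity.
    + intros k; apply Rmult_le_pos; [apply pow2_ge_0|apply Rlt_le, Hpos]. }
(* Cauchy-Schwarz over the window of length [T]; the constant 102400 is [64^2 * 25]. *)
assert (HCS := rsum_sqr_le (fun t => c (m + t)%nat) T).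
set (Q := rsum (fun t => c (m + t)%nat ^ 2) T) in *.
assert (HQ : (INR N / 64) ^ 2 <= 25 * INR N * lam * Q).
{ apply Rle_trans with (rsum (fun t => c (m + t)%nat) T ^ 2); [apply pow_incr; split; [apply Rdiv_le_0_compat; lra|exact Hsum]|].
  eapply Rle_trans; [exact HCS|]; apply Rmult_le_compat_r; [apply rsum_ge0; intros; apply pow2_ge_0|lra]. }
assert (Hbm := Hpos m).
apply Rmult_le_reg_l with (INR N ^ 2); [apply pow_lt; lra|].
apply Rle_trans with (beta m * (102400 * (INR N * lam * Q))).
{ rewrite Rmult_comm; apply Rmult_le_compat_l; [lra|]; simpl in *; lra. }
replace (beta m * (102400 * (INR N * lam * Q))) with (102400 * INR N * lam * (beta m * Q)) by ring.
replace (INR N ^ 2 * (102400 * lam * K ^ S r * M * beta N))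
  with (102400 * INR N * lam * (K ^ r * (M * (INR N * (K * beta N))))) by (simpl; ring).
apply Rmult_le_compat_l; [|exact Hlow]; nra.
Qed.

Hypothesis Hall : forall phi, symbol phi -> composition_bounded beta phi.
Hypothesis Hbad : forall B (N0 : nat), exists nm : nat * nat,
  (1 <= fst nm /\ N0 <= fst nm /\ fst nm <= snd nm)%nat /\ B * beta (fst nm) < beta (snd nm).

Let pick B N0 : nat * nat := proj1_sig (constructive_indefinite_description _ (Hbad B N0)).

Let expo (lam : R) : nat := proj1_sig (constructive_indefinite_description _
  (Pow_x_infinity 2 ltac:(rewrite Rabs_pos_eq; lra) (26 * lam))).

(* The state at stage [i] is the derivative at [1] of the part of the symbol chosen so far,
   and a lower bound for the next index. *)
Let choose (i : nat) (st : R * nat) : nat * nat :=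
  pick (102400 * fst st * K ^ S (expo (fst st)) * INR i) (snd st).

(** The next index exceeds twice the current exponent, so [ep] at least halves at each stage and a
    tail of its series is controlled by its first term. *)
Let next (i : nat) (st : R * nat) : R * nat :=
  let nm := choose i st in
  (fst st + INR (snd nm) / (8 * INR (fst nm)), (2 * snd nm + 1)%nat).

Let Fixpoint state (i : nat) : R * nat :=
  match i with O => (1, 1%nat) | S k => next k (state k) end.

Let nn i : nat := fst (choose i (state i)).
Let dd i : nat := snd (choose i (state i)).
Let ep i : R := / (8 * INR (nn i)).

Let pick_spec i : (1 <= nn i /\ snd (state i) <= nn i /\ nn i <= dd i)%nat /\
  102400 * fst (state i) * K ^ S (expo (fst (state i))) * INR i * beta (nn i) < beta (dd i).
Proof. exact (proj2_sig (constructive_indefinite_description _ (Hbad _ (snd (state i))))). Qed.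

Let dd_lt i : (2 * dd i < nn (S i))%nat.
Proof. generalize (pick_spec (S i)); simpl state; unfold next; simpl; fold (dd i); lia. Qed.

Let nn_INR i : 1 <= INR (nn i).
Proof. apply INR_ge1, pick_spec. Qed.

Let ep_pos i : 0 < ep i.
Proof. apply Rinv_0_lt_compat; generalize (nn_INR i); lra. Qed.

Let ep_half i : ep (S i) <= ep i * (1 / 2).
Proof.
unfold ep; assert (H := nn_INR i).
replace (/ (8 * INR (nn i)) * (1 / 2)) with (/ (8 * (2 * INR (nn i)))) by (field; lra).
apply Rinv_le_contravar; [lra|]; apply Rmult_le_compat_l; [lra|].
replace 2 with (INR 2) by (simpl; ring); rewrite <- mult_INR; apply le_INR.
generalize (dd_lt i) (pick_spec i); lia.
Qed.

Let ep_geom i l : ep (i + l) <= ep i * (1 / 2) ^ l.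
Proof.
induction l as [|l IH]; [rewrite Nat.add_0_r; simpl; lra|].
rewrite Nat.add_succ_r; eapply Rle_trans; [apply ep_half|]; simpl; lra.
Qed.

Let ep_ex : ex_series ep.
Proof.
apply ex_series_dom with (fun l => ep 0 * (1 / 2) ^ l).
- intros l; split; [apply Rlt_le, ep_pos|apply (ep_geom 0)].
- apply ex_series_geom_scal; lra.
Qed.

Let mass : R := Series ep.

(** The mass still to be placed at stage [i] is at most [2 ep i = 1 / (4 nn i)], the defect at 1
    that [hump] allows for [q i]. *)
Let ep_tail i : mass <= rsum ep i + 2 * ep i.
Proof.
unfold mass; rewrite (Series_split ep i) by exact ep_ex; apply Rplus_le_compat_l.
apply Rle_trans with (Series (fun l => ep i * (1 / 2) ^ l)).
- apply Series_le; [|apply ex_series_geom_scal; lra].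
  intros l; split; [apply Rlt_le, ep_pos|apply ep_geom].
- rewrite Series_scal_l, Series_geom by (rewrite Rabs_pos_eq; lra); lra.
Qed.

Let mass_bounds : 0 <= mass <= 1 / 4.
Proof.
split; [apply Series_ge0; [intros; apply Rlt_le, ep_pos|exact ep_ex]|].
eapply Rle_trans; [apply (ep_tail 0)|]; simpl.
assert (ep 0 <= / 8); [|lra].
apply Rinv_le_contravar; [lra|]; generalize (nn_INR 0); lra.
Qed.

Let dd_ge i : (i < dd i)%nat.
Proof.
induction i as [|i IH]; [generalize (pick_spec 0); lia|].
generalize (dd_lt i) (pick_spec (S i)); lia.
Qed.

Let dd_mono i l : (l <= i)%nat -> (dd l <= dd i)%nat.
Proof.
induction 1 as [|i H IH]; [lia|]; generalize (dd_lt i) (pick_spec (S i)); lia.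
Qed.

Let state_eq i : fst (state i) = 1 + rsum (fun l => ep l * INR (dd l)) i.
Proof.
induction i as [|i IH]; [simpl; ring|].
simpl state; unfold next; simpl fst; fold (dd i); fold (nn i); rewrite IH; simpl; unfold ep.
assert (H := nn_INR i); field; lra.
Qed.

Let base (k : nat) : R := if Nat.eq_dec k 1 then 1 - mass else 0.
Let jump (l k : nat) : R := if Nat.eq_dec k (dd l) then ep l else 0.
Let q (i k : nat) : R := base k + rsum (fun l => jump l k) i.
(** The diagonal replaces a limit: since [dd l > l], no jump of index [l >= k] falls on [k], and
    [q i k] is constant for [i >= k]. *)
Let p (k : nat) : R := q k k.

Let base_ge0 k : 0 <= base k.
Proof. unfold base; destruct (Nat.eq_dec k 1); generalize mass_bounds; lra. Qed.

Let jump_ge0 l k : 0 <= jump l k.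
Proof. unfold jump; destruct (Nat.eq_dec k (dd l)); [apply Rlt_le, ep_pos|lra]. Qed.

Let q_ge0 i k : 0 <= q i k.
Proof. apply Rplus_le_le_0_compat; [apply base_ge0|apply rsum_ge0; intros; apply jump_ge0]. Qed.

Let p_eq i k : (k <= i)%nat -> p k = q i k.
Proof.
intros H; unfold p, q; f_equal; replace i with (k + (i - k))%nat by lia; rewrite rsum_add.
set (T := rsum _ (i - k)); replace T with 0; [ring|].
unfold T; symmetry; apply rsum_eq0; intros l _; unfold jump; destruct (Nat.eq_dec k (dd (k + l))); [|reflexivity].
generalize (dd_ge (k + l)); lia.
Qed.

Let p_ge i k : q i k + (if Nat.eq_dec k (dd i) then ep i else 0) <= p k.
Proof.
rewrite (p_eq (k + S i) k) by lia; unfold q.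
assert (H := rsum_mono (fun l => jump l k) (S i) (k + S i) (fun l => jump_ge0 l k) ltac:(lia)).
simpl in H; unfold jump in H at 2; lra.
Qed.

Let jump_sum l B (w : nat -> R) : (dd l < B)%nat -> rsum (fun k => jump l k * w k) B = ep l * w (dd l).
Proof.
induction B as [|B IH]; intros H; [lia|]; simpl.
destruct (Nat.eq_dec B (dd l)) as [->|Hne].
- rewrite rsum_eq0.
  + unfold jump; destruct (Nat.eq_dec (dd l) (dd l)); [ring|lia].
  + intros k Hk; unfold jump; destruct (Nat.eq_dec k (dd l)); [lia|ring].
- rewrite IH by lia; unfold jump; destruct (Nat.eq_dec B (dd l)); [lia|ring].
Qed.

Let q_sum i (w : nat -> R) :
  is_series (fun k => q i k * w k) ((1 - mass) * w 1%nat + rsum (fun l => ep l * w (dd l)) i).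
Proof.
set (B := S (S (dd i))).
replace ((1 - mass) * w 1%nat + rsum (fun l => ep l * w (dd l)) i) with (rsum (fun k => q i k * w k) B).
- apply Series_finite; intros k Hk; unfold q, base, B in *.
  destruct (Nat.eq_dec k 1); [lia|].
  rewrite rsum_eq0; [ring|].
  intros l Hl; unfold jump; destruct (Nat.eq_dec k (dd l)); [|reflexivity].
  generalize (dd_mono i l ltac:(lia)); lia.
- rewrite (rsum_ext _ (fun k => base k * w k + rsum (fun l => jump l k * w k) i)).
  + rewrite rsum_plus; f_equal.
    * unfold B; rewrite !rsum_shift, rsum_eq0; [unfold base; simpl; ring|].
      intros k _; unfold base; simpl; ring.
    * rewrite rsum_exchange; apply rsum_ext; intros l Hl; apply jump_sum.
      unfold B; generalize (dd_mono i l ltac:(lia)); lia.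
  + intros k _; unfold q; rewrite Rmult_plus_distr_r; f_equal.
    rewrite Rmult_comm, <- rsum_scal; apply rsum_ext; intros; ring.
Qed.

Let q_total i : is_series (q i) (1 - mass + rsum ep i).
Proof.
assert (H := q_sum i (fun _ => 1)).
replace (1 - mass + rsum ep i) with ((1 - mass) * 1 + rsum (fun l => ep l * 1) i).
- refine (is_series_ext _ _ _ _ H); intros; apply Rmult_1_r.
- rewrite (rsum_ext _ ep) by (intros; ring); ring.
Qed.

Let q_le1 i : Series (q i) <= 1.
Proof.
rewrite (is_series_unique _ _ (q_total i)).
assert (rsum ep i <= mass) by (apply rsum_le_Series; [intros; apply Rlt_le, ep_pos|exact ep_ex]); lra.
Qed.

Let p_partial n : rsum p n <= 1.
Proof.
rewrite (rsum_ext _ (q n)) by (intros; apply p_eq; lia).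
eapply Rle_trans; [apply rsum_le_Series; [intros; apply q_ge0|eexists; apply q_total]|apply q_le1].
Qed.

Let p_ge0 k : 0 <= p k.
Proof. apply q_ge0. Qed.

Let p_ex : ex_series p.
Proof. apply ex_series_bounded with 1; auto. Qed.

(** Each power [x^n] lies above its tangent at 1. The slope of [q i] there is at most
    [fst (state i)], in which 1 replaces the linear coefficient [1 - mass]. *)
Let q_eval i x : 0 <= x <= 1 ->
  1 - / (4 * INR (nn i)) - fst (state i) * (1 - x) <= Series (fun k => q i k * x ^ k).
Proof.
intros Hx; rewrite (is_series_unique _ _ (q_sum i (fun k => x ^ k))), state_eq.
assert (Hp : forall n, 1 - INR n * (1 - x) <= x ^ n).
{ intros n; replace x with (1 - (1 - x)) at 2 by ring; apply bernoulli; lra. }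
assert (H1 : rsum ep i - (1 - x) * rsum (fun l => ep l * INR (dd l)) i <= rsum (fun l => ep l * x ^ dd l) i).
{ unfold Rminus at 1; rewrite <- Ropp_mult_distr_l_reverse, <- rsum_scal, <- rsum_plus.
  apply rsum_le; intros l _; specialize (Hp (dd l)); generalize (ep_pos l); nra. }
assert (H2 := ep_tail i); unfold ep in H2 at 2.
replace (2 * / (8 * INR (nn i))) with (/ (4 * INR (nn i))) in H2
  by (generalize (nn_INR i); intros; field; lra).
generalize mass_bounds; simpl (x ^ 1); nra.
Qed.

Let phi (z : C) : C := psum (fun k => RtoC (p k)) z.

Let phi_expansion : has_expansion phi (fun k => RtoC (p k)).
Proof.
apply has_expansion_intro; [|reflexivity]; intros r Hr.
apply ex_series_dom with p; [|exact p_ex]; intros k.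
rewrite Cmod_R, Rabs_pos_eq by apply p_ge0.
assert (0 <= r ^ k <= 1) by (apply pow_le1; lra).
generalize (p_ge0 k); nra.
Qed.

Let phi_symbol : symbol phi.
Proof.
split; [|split].
- intros z Hz; unfold in_disk in *; apply Rle_lt_trans with (2 := Hz).
  generalize (Cmod_ge_0 z); intros Hz0.
  assert (Ha : absC (fun k => RtoC (p k) * z ^ k)%C).
  { apply psabs_absC with (Cmod z); [|lra]; apply (has_expansion_abs phi _ _ phi_expansion); lra. }
  eapply Rle_trans; [apply Cmod_Csum, Ha|].
  apply Rle_trans with (Series (fun k => Cmod z * p k)).
  + apply Series_le; [|apply ex_series_scal, p_ex]; intros k; split; [apply Cmod_ge_0|].
    rewrite Cmod_mult, Cmod_pow, Cmod_R, Rabs_pos_eq, Rmult_comm by apply p_ge0.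
    (* As [p 0 = 0], a factor [|z|] comes out of every term, which gives [|phi z| <= |z|]. *)
    destruct k as [|k]; [unfold p, q, base; simpl; lra|].
    apply Rmult_le_compat_r; [apply p_ge0|]; simpl.
    assert (Cmod z ^ k <= 1) by (rewrite <- (pow1 k); apply pow_incr; lra); nra.
  + rewrite Series_scal_l; assert (Series p <= 1) by (apply Series_le_bound; auto); nra.
- intros z Hz; apply (has_expansion_analytic _ _ z phi_expansion Hz).
- assert (Hh : in_disk (RtoC (1 / 2))) by (apply in_disk_R; lra).
  exists 0%C, (RtoC (1 / 2)); split; [exact in_disk_0|]; split; [exact Hh|].
  unfold phi; rewrite psum_0; intros E.
  assert (E2 : psum (fun k => RtoC (p k)) (RtoC (1 / 2)) = RtoC (Series (fun k => p k * (1 / 2) ^ k))).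
  { rewrite <- Csum_RtoC; apply Csum_ext; intros k; rewrite RtoC_mult, RtoC_pow; reflexivity. }
  rewrite E2 in E; apply RtoC_inj in E.
  assert (Hex : ex_series (fun k => p k * (1 / 2) ^ k)).
  { apply ex_series_dom with p; [|exact p_ex]; intros k.
    assert (0 <= (1 / 2) ^ k <= 1) by (apply pow_le1; lra).
    generalize (p_ge0 k); nra. }
  (* The linear term alone makes [phi] positive at [1/2], while [phi 0 = 0]. *)
  assert (T := Series_term_le (fun k => p k * (1 / 2) ^ k) 1
    ltac:(intros; apply Rmult_le_pos; [apply p_ge0|apply pow_le; lra]) Hex).
  cbv beta in T; rewrite <- E in T.
  assert (Hp1 : 1 - mass <= p 1).
  { assert (Hq : q 0 1 = 1 - mass) by (unfold q, base; simpl; ring).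
    generalize (p_ge 0 1); rewrite Hq; destruct (Nat.eq_dec 1 (dd 0)); generalize (ep_pos 0); lra. }
  assert (Hp0 : p 0 = 0) by (unfold p, q, base; simpl; ring).
  rewrite Hp0 in T; generalize mass_bounds; simpl in T; lra.
Qed.

Lemma gliding_hump : False.
Proof.
destruct (polynomial_bound beta phi _ Hpos (proj1 phi_symbol) phi_expansion (Hall phi phi_symbol))
  as (M & HM0 & HM).
(* [M] is known only once the symbol is complete, so stage [i] was built against the bound [i]; any
   [i > M] contradicts [hump]. *)
destruct (INR_archimed 1 M ltac:(lra)) as [i Hi]; rewrite Rmult_1_r in Hi.
destruct (pick_spec i) as [[H1 [H2 H3]] H4].
set (lam := fst (state i)) in *.
assert (Hlam : 1 <= lam).
{ unfold lam; rewrite state_eq.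
  assert (0 <= rsum (fun l => ep l * INR (dd l)) i); [|lra].
  apply rsum_ge0; intros; apply Rmult_le_pos; [apply Rlt_le, ep_pos|apply pos_INR]. }
assert (Hexpo : 26 * lam <= 2 ^ expo lam).
{ unfold expo; destruct (constructive_indefinite_description _ _) as [r Hr]; simpl.
  specialize (Hr r ltac:(lia)); rewrite Rabs_pos_eq in Hr by (apply pow_le; lra); lra. }
assert (H := hump p (q i) (nn i) (dd i) lam (expo lam) M H1 H3 Hlam Hexpo (q_ge0 i)
  (ex_intro _ _ (q_total i)) (q_le1 i) (q_eval i) (p_ge i) HM HM0).
assert (HKp : 0 < K ^ S (expo lam)) by (apply pow_lt; lra).
assert (102400 * lam * K ^ S (expo lam) * M * beta (nn i)
  <= 102400 * lam * K ^ S (expo lam) * INR i * beta (nn i)); [|lra].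
apply Rmult_le_compat_r; [apply Rlt_le, Hpos|]; apply Rmult_le_compat_l; [|lra].
apply Rmult_le_pos; lra.
Qed.
End GlidingHump.

(** Downward induction on the threshold: the index [N] is absorbed by comparing it with [N + 1]. *)
Lemma essentially_decreasing_of_eventually beta K N0 :
  (forall n, 0 < beta n) ->
  (forall n m, (N0 <= n)%nat -> (n <= m)%nat -> beta m <= K * beta n) ->
  essentially_decreasing beta.
Proof.
intros Hpos; revert K; induction N0 as [|N IH]; intros K H.
- exists (1 + Rabs K); split; [generalize (Rabs_pos K); lra|]; intros m n Hnm.
  eapply Rle_trans; [apply (H n m); [lia|exact Hnm]|].
  apply Rmult_le_compat_r; [apply Rlt_le, Hpos|generalize (Rle_abs K); lra].
- set (c := Rabs K * beta (S N) / beta N).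
  assert (Hc : 0 <= c).
  { apply Rdiv_le_0_compat; [|apply Hpos].
    apply Rmult_le_pos; [apply Rabs_pos|apply Rlt_le, Hpos]. }
  apply (IH (1 + Rabs K + c)); intros n m Hn Hnm; assert (Hb := Hpos n).
  generalize (Rabs_pos K) (Rle_abs K); intros.
  destruct (Nat.eq_dec n N) as [->|Hne]; [destruct (Nat.eq_dec m N) as [->|Hne]|].
  + nra.
  + specialize (H (S N) m ltac:(lia) ltac:(lia)); specialize (Hpos (S N)).
    apply Rle_trans with (c * beta N); [|nra].
    unfold c; replace (Rabs K * beta (S N) / beta N * beta N) with (Rabs K * beta (S N)) by (field; lra).
    nra.
  + eapply Rle_trans; [apply (H n m); lia|]; apply Rmult_le_compat_r; lra.
Qed.

Lemma essentially_decreasing_necessary beta :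
  (forall n, 0 < beta n) -> (forall phi, symbol phi -> composition_bounded beta phi) ->
  slowly_oscillating beta -> essentially_decreasing beta.
Proof.
intros Hpos Hall (c & K & _ & _ & HK & Hosc).
apply NNPP; intros Hno.
apply (gliding_hump beta Hpos K ltac:(lra) (fun m n Hmn => proj2 (Hosc m n Hmn)) Hall).
intros B N0; apply NNPP; intros Hno2; apply Hno.
(* The threshold [S N0] keeps the smaller index of the bad pair at least 1. *)
apply (essentially_decreasing_of_eventually beta B (S N0) Hpos).
intros n m HN Hnm; apply Rnot_lt_le; intros Hlt; apply Hno2; exists (n, m); simpl.
split; [lia|exact Hlt].
Qed.

Theorem theorem1p2 (beta : nat -> R) (hbeta : admissible_weight beta) :
  (forall phi : C -> C, symbol phi -> composition_bounded beta phi) <->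
  (essentially_decreasing beta /\ slowly_oscillating beta).
Proof.
split.
- intros Hall.
  assert (Hosc := slowly_oscillating_necessary beta (proj1 hbeta) Hall).
  split; [|exact Hosc].
  exact (essentially_decreasing_necessary beta (proj1 hbeta) Hall Hosc).
- intros [Hdec Hosc] phi (Hphi & Han & _).
  destruct (disk_expansion phi) as [b Hb]; auto.
  { intros z Hz; apply Rlt_le, Hphi, Hz. }
  apply (sufficiency beta phi b); auto.
Qed.
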